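(* Let $M$ be an $n$-dimensional hypersurface of constant mean curvature $H$ immersed in $\mathcal N$ and let $\varphi=|\phi|$. Then there exists $\varepsilon>0$ such that the following inequality holds on $M$: $$\varphi\Delta\varphi\ge \frac{2}{n(1+\varepsilon)}|\nabla\varphi|^2-\varphi^4-\frac{n(n-2)H}{\sqrt{n(n-1)}}\varphi^3+n\left(H^2+\frac{(K_2-K_1)H}{2}+2K_2-K_1\right)\varphi^2-2nK'\varphi+\frac{n^2H(K_2-K_1)}{2}-\frac{n(n-1)}{2\varepsilon}(K_1-K_2)^2.$$
   Context: $\mathcal N$ is an orientable Riemannian manifold of dimension $n+1$ ($n\ge2$) with curvature tensor $R$ and Levi-Civita connection $\overline\nabla$, such that all sectional curvatures satisfy $K_2\le sec\le K_1$, and there is a constant $K'$ with $\sqrt{\sum_{ijkst}\langle(\overline\nabla_{e_t}R)(e_i,e_j)e_k,e_s\rangle^2}\le K'$ for every local orthonormal frame. $M$ is an orientable immersed hypersurface with unit normal $\nu$; if $H\neq0$ the orientation is chosen so that the mean curvature vector is $H\nu$ with $H>0$. $A$ is the shape operator, $H=\frac1n\mathrm{tr}A$, $\phi=A-H\,\mathrm{Id}$ is the traceless part of the second fundamental form and $|\phi|$ its Hilbert–Schmidt norm. $\Delta$ is the trace of the Hessian on $M$ with the induced metric. The inequality is understood pointwise where $\varphi$ is smooth (in particular wherever $\varphi\ne0$). *)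

(* Defs.v *)
From HB Require Import structures.
From mathcomp Require Import all_boot all_order all_algebra.
From mathcomp Require Import all_classical all_reals all_analysis.

Set Implicit Arguments.
Unset Strict Implicit.
Unset Printing Implicit Defensive.

Import Order.TTheory GRing.Theory Num.Theory.
Import numFieldNormedType.Exports.
Local Open Scope classical_set_scope.
Local Open Scope ring_scope.

(* The coordinate space R^m is 'rV[R]_m, and linear maps act on it on the     *)
(* right: u |-> u *m A.                                                       *)
Definition ei (R : realType) (m : nat) (i : 'I_m) : 'rV[R]_m := delta_mx 0 i.

Fixpoint Ck_on (R : realType) (m : nat) (V : normedModType R) (k : nat)
    (U : set 'rV[R]_m) (f : 'rV[R]_m -> V) : Prop :=
  if k is k'.+1 then
    {in U, continuous f} /\
    (forall i, (forall x, U x -> derivable f x (ei R i)) /\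
               Ck_on k' U (fun x => 'D_(ei R i) f x))
  else {in U, continuous f}.

(* Meant for open U, so that the derivatives only involve f on U. *)
Definition smooth_on (R : realType) (m : nat) (V : normedModType R)
    (U : set 'rV[R]_m) (f : 'rV[R]_m -> V) : Prop :=
  forall k, Ck_on k U f.

Definition smooth_near (R : realType) (m : nat) (V : normedModType R)
    (x : 'rV[R]_m) (f : 'rV[R]_m -> V) : Prop :=
  exists U : set 'rV[R]_m, [/\ open U, U x & smooth_on U f].

(* cmap is only relevant on dom, and param, the inverse chart, on img. *)
Record chart (R : realType) (m : nat) (T : Type) := Chart {
  dom : set T;
  cmap : T -> 'rV[R]_m;
  param : 'rV[R]_m -> T }.

Definition img (R : realType) (m : nat) (T : Type) (c : chart R m T) :
  set 'rV[R]_m := cmap c @` dom c.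

Definition is_chart (R : realType) (m : nat) (T : topologicalType)
    (c : chart R m T) : Prop :=
  [/\ open (dom c), open (img c),
      forall p, dom c p -> param c (cmap c p) = p,
      {in dom c, continuous (cmap c)} & {in img c, continuous (param c)}].

Definition ldom (R : realType) (m m' : nat) (T T' : Type) (f : T -> T')
    (c : chart R m T) (d : chart R m' T') : set 'rV[R]_m :=
  cmap c @` (dom c `&` f @^-1` dom d).

Definition lrep (R : realType) (m m' : nat) (T T' : Type) (f : T -> T')
    (c : chart R m T) (d : chart R m' T') : 'rV[R]_m -> 'rV[R]_m' :=
  fun x => cmap d (f (param c x)).

Definition overlap (R : realType) (m : nat) (T : Type) (c c' : chart R m T) :
  set 'rV[R]_m := ldom idfun c c'.

Definition transition (R : realType) (m : nat) (T : Type)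
    (c c' : chart R m T) : 'rV[R]_m -> 'rV[R]_m := lrep idfun c c'.

Definition compatible (R : realType) (m : nat) (T : Type)
    (c c' : chart R m T) : Prop :=
  smooth_on (overlap c c') (transition c c') /\
  smooth_on (overlap c' c) (transition c' c).

Definition smooth_atlas (R : realType) (m : nat) (T : topologicalType)
    (A : set (chart R m T)) : Prop :=
  [/\ forall c, A c -> is_chart c,
      forall p, exists2 c, A c & dom c p
    & forall c c', A c -> A c' -> compatible c c'].

Record manifold (R : realType) (m : nat) := Manifold {
  carrier :> topologicalType;
  atlas : set (chart R m carrier);
  manifold_hausdorff : hausdorff_space carrier;
  manifold_second_countable : @second_countable carrier;
  atlasP : smooth_atlas atlas }.
Arguments atlas {R m} M _ : rename.

Definition orientable (R : realType) (m : nat) (M : manifold R m) : Prop :=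
  exists A : set (chart R m M),
    [/\ smooth_atlas A,
        forall a c, A a -> atlas M c -> compatible a c
      & forall a a', A a -> A a' ->
          forall x, overlap a a' x -> 0 < \det (jacobian (transition a a') x)].

(* Inner product with Gram matrix G. *)
Definition ip (R : realType) (m : nat) (G : 'M[R]_m) (u v : 'rV[R]_m) : R :=
  (u *m G *m v^T) 0 0.

Record riemannian_metric (R : realType) (m : nat) (N : manifold R m) :=
  RiemannianMetric {
    gram :> chart R m N -> 'rV[R]_m -> 'M[R]_m;
    gram_sym : forall c x, atlas N c -> img c x -> (gram c x)^T = gram c x;
    gram_pos : forall c x u, atlas N c -> img c x -> u != 0 ->
      0 < ip (gram c x) u u;
    gram_smooth : forall c, atlas N c -> smooth_on (img c) (gram c);
    gram_transition : forall c c' x, atlas N c -> atlas N c' ->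
      overlap c c' x ->
      let J := jacobian (transition c c') x in
      gram c x = J *m gram c' (transition c c' x) *m J^T }.

(* In a chart, a vector field is a function 'rV_m -> 'rV_m, and g is the      *)
(* Gram matrix function of the metric. christoffel g x u v is the Levi-Civita *)
(* derivative at x of the constant field v along u, given by Koszul:          *)
(* 2 <nabla_u v, z> = D_u <v, z> + D_v <u, z> - D_z <u, v>, u, v, z constant. *)
Definition christoffel (R : realType) (m : nat) (g : 'rV[R]_m -> 'M[R]_m)
    (x u v : 'rV[R]_m) : 'rV[R]_m :=
  (\row_k (2^-1 * ('D_u (fun y => ip (g y) v (ei R k)) x
                   + 'D_v (fun y => ip (g y) u (ei R k)) x
                   - 'D_(ei R k) (fun y => ip (g y) u v) x)))
  *m invmx (g x).

Section Curvature.
Variables (R : realType) (m : nat) (g : 'rV[R]_m -> 'M[R]_m).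
Implicit Types X Y Z W : 'rV[R]_m -> 'rV[R]_m.

Definition covd X Y : 'rV[R]_m -> 'rV[R]_m :=
  fun x => 'D_(X x) Y x + christoffel g x (X x) (Y x).

Definition bracket X Y : 'rV[R]_m -> 'rV[R]_m :=
  fun x => 'D_(X x) Y x - 'D_(Y x) X x.

Definition Rm X Y Z : 'rV[R]_m -> 'rV[R]_m :=
  fun x => covd X (covd Y Z) x - covd Y (covd X Z) x - covd (bracket X Y) Z x.

Definition covd_Rm W X Y Z : 'rV[R]_m -> 'rV[R]_m :=
  fun x => covd W (Rm X Y Z) x
           - Rm (covd W X) Y Z x - Rm X (covd W Y) Z x - Rm X Y (covd W Z) x.

(* Tensors are evaluated on tangent vectors through their constant extension. *)
Definition Rm_at (x u v w : 'rV[R]_m) : 'rV[R]_m :=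
  Rm (cst u) (cst v) (cst w) x.

Definition covd_Rm_at (x t u v w : 'rV[R]_m) : 'rV[R]_m :=
  covd_Rm (cst t) (cst u) (cst v) (cst w) x.

Definition sec (x u v : 'rV[R]_m) : R :=
  ip (g x) (Rm_at x u v v) u
  / (ip (g x) u u * ip (g x) v v - ip (g x) u v ^+ 2).

Definition orthonormal_basis (x : 'rV[R]_m) (e : 'I_m -> 'rV[R]_m) : Prop :=
  forall i j, ip (g x) (e i) (e j) = (i == j)%:R.

Definition covd_Rm_norm (x : 'rV[R]_m) (e : 'I_m -> 'rV[R]_m) : R :=
  Num.sqrt (\sum_i \sum_j \sum_k \sum_s \sum_t
    ip (g x) (covd_Rm_at x (e t) (e i) (e j) (e k)) (e s) ^+ 2).

End Curvature.

Definition sec_bounded (R : realType) (m : nat) (N : manifold R m)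
    (g : riemannian_metric N) (K2 K1 : R) : Prop :=
  forall c x u v, atlas N c -> img c x -> free [:: u; v] ->
    K2 <= sec (g c) x u v <= K1.

Definition covd_Rm_bounded (R : realType) (m : nat) (N : manifold R m)
    (g : riemannian_metric N) (K' : R) : Prop :=
  forall c x e, atlas N c -> img c x -> orthonormal_basis (g c) x e ->
    covd_Rm_norm (g c) x e <= K'.

Section FunctionsOnChart.
Variables (R : realType) (m : nat) (G : 'rV[R]_m -> 'M[R]_m).
Variable (phi : 'rV[R]_m -> R).

Definition grad (x : 'rV[R]_m) : 'rV[R]_m :=
  (\row_i 'D_(ei R i) phi x) *m invmx (G x).

(* Hess phi (X, Y) = X (Y phi) - (nabla_X Y) phi *)
Definition hessian (x u v : 'rV[R]_m) : R :=
  'D_u (fun y => 'D_v phi y) x - 'D_(christoffel G x u v) phi x.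

(* The trace of a bilinear form B with respect to the metric is tr (G^-1 B). *)
Definition laplacian (x : 'rV[R]_m) : R :=
  \tr (invmx (G x) *m \matrix_(i, j) hessian x (ei R i) (ei R j)).

End FunctionsOnChart.

Definition immersion (R : realType) (m m' : nat) (M : manifold R m)
    (N : manifold R m') (f : M -> N) : Prop :=
  continuous f /\
  forall c d, atlas M c -> atlas N d ->
    smooth_on (ldom f c d) (lrep f c d) /\
    (forall x u, ldom f c d x -> u != 0 -> 'D_u (lrep f c d) x != 0).

(* nu d p is the component vector of nu(p) in the chart d at f p. *)
Definition unit_normal (R : realType) (m m' : nat) (M : manifold R m)
    (N : manifold R m') (g : riemannian_metric N) (f : M -> N)
    (nu : chart R m' N -> M -> 'rV[R]_m') : Prop :=
  (forall d d' p, atlas N d -> atlas N d' -> dom d (f p) -> dom d' (f p) ->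
     nu d' p = nu d p *m jacobian (transition d d') (cmap d (f p))) /\
  (forall c d, atlas M c -> atlas N d ->
     smooth_on (ldom f c d) (fun x => nu d (param c x)) /\
     (forall x, ldom f c d x ->
        let G := g d (lrep f c d x) in
        ip G (nu d (param c x)) (nu d (param c x)) = 1 /\
        (forall u, ip G ('D_u (lrep f c d) x) (nu d (param c x)) = 0))).

(* A hypersurface in a pair of charts: F is the immersion, g the Gram matrix  *)
(* function of the ambient metric and nu the components of the unit normal.   *)
Section Hypersurface.
Variables (R : realType) (m m' : nat).
Variables (g : 'rV[R]_m' -> 'M[R]_m') (F nu : 'rV[R]_m -> 'rV[R]_m').

Definition induced_metric (x : 'rV[R]_m) : 'M[R]_m :=
  \matrix_(i, j) ip (g (F x)) ('D_(ei R i) F x) ('D_(ei R j) F x).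

(* Ambient derivative along F, in direction u, of dF applied to constant v. *)
Definition covd_along (x u v : 'rV[R]_m) : 'rV[R]_m' :=
  'D_u (fun y => 'D_v F y) x + christoffel g (F x) ('D_u F x) ('D_v F x).

Definition second_form (x : 'rV[R]_m) : 'M[R]_m :=
  \matrix_(i, j) ip (g (F x)) (covd_along x (ei R i) (ei R j)) (nu x).

(* <A X, Y> = <nabla_X Y, nu> *)
Definition shape (x : 'rV[R]_m) : 'M[R]_m :=
  second_form x *m invmx (induced_metric x).

Definition mean_curvature (x : 'rV[R]_m) : R := \tr (shape x) / m%:R.

Definition traceless (x : 'rV[R]_m) : 'M[R]_m :=
  shape x - (mean_curvature x)%:M.

(* G *m B^T *m invmx G is the adjoint of B for the inner product ip G. *)
Definition HS_norm (G B : 'M[R]_m) : R :=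
  Num.sqrt (\tr (B *m (G *m B^T *m invmx G))).

Definition traceless_norm (x : 'rV[R]_m) : R :=
  HS_norm (induced_metric x) (traceless x).

End Hypersurface.

(* Main.v *)
(* Fix a point and a principal frame e_1, ..., e_n of the hypersurface, with
   principal curvatures lam_i = mu_i + H, and put T = nabla h, N_ai =
   (nabla^2 h)(e_a, e_a; e_i, e_i) for the second fundamental form h. The
   Codazzi, Ricci and Gauss equations give Simons' identity
     N_ai = N_ia + (lam_i - lam_a) (2 K_ai + lam_a lam_i)
            + lam_a r_i - lam_i r_a + (two components of nabla R),
   where K_ai and r_i are ambient sectional curvatures of the planes (e_a, e_i)
   and (nu, e_i). Since H is constant, \sum_i N_ai = 0, so that
   \sum lam_i N_ai = \sum mu_i (N_ai - N_ia), and this is bounded below using the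
   curvature bounds, Okumura's inequality for \sum mu_i^3 and Cauchy-Schwarz.
   Moreover phi Delta phi + |nabla phi|^2 = |T|^2 + \sum lam_i N_ai, and a Kato
   inequality bounds |T|^2 by |nabla phi|^2 from below: T is traceless in its last
   two slots and symmetric up to the Codazzi defect <R(e_a, e_j) e_a, nu>, which
   by polarization is at most (K1 - K2) / 2. Where phi = 0 the gradient vanishes.
   The argument works for every eps > 0. *)
Require Import Defs.
From HB Require Import structures.
From mathcomp Require Import all_boot all_order all_algebra.
From mathcomp Require Import all_classical all_reals all_analysis.
From mathcomp Require Import ring lra.
Import Order.TTheory GRing.Theory Num.Theory.
Import numFieldNormedType.Exports.
Local Open Scope classical_set_scope.
Local Open Scope ring_scope.

Set Implicit Arguments.
Unset Strict Implicit.
Unset Printing Implicit Defensive.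

(** * Smooth functions on open subsets of R^m *)

Section Smooth.
Variables (R : realType) (m : nat).
Implicit Types (U : set 'rV[R]_m).

(** Orthonormal frames are never extended off a point, since principal directions need not depend
    smoothly on it. Differentiation is done on constant coordinate vectors, with Christoffel
    corrections that make the results tensorial, and a principal frame is substituted only at the
    point itself. Likewise phi is a square root, so what gets differentiated is phi^2, written as a
    trace of matrices. This yields formulas for phi * D phi, and dividing by phi is what forces the
    separate case phi = 0.

    Origin of the constants: 2 n K2 comes from the sum of (mu_i - mu_a)^2 over ordered pairs, which
    is 2 n phi^2; - n K1 from the sum of the n curvatures r_a; both terms in H (K2 - K1) / 2 from
    |m| <= m^2 + 1, after centring r_i at (K1 + K2) / 2; 2 n K' from two Cauchy-Schwarz estimates,
    one per component of nabla R. The coefficient n (n - 1) / (2 eps) counts ordered pairs: each has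
    squared Codazzi defect at most (K1 - K2)^2 / 4, enters |T|^2 twice, and carries the weight 1 /
    eps. *)

Lemma Ck_on_eq (V : normedModType R) k U (f g : 'rV[R]_m -> V) :
  open U -> (forall x, U x -> f x = g x) -> Ck_on k U f -> Ck_on k U g.
Proof.
move=> oU; have nfg (W : Type) (p q : 'rV[R]_m -> W) x :
    (forall x, U x -> p x = q x) -> U x -> \near x, p x = q x.
  move=> pq Ux; have : nbhs x U by exact: open_nbhs_nbhs.
  by apply: filterS => y; exact: pq.
have ceq (p q : 'rV[R]_m -> V) : (forall x, U x -> p x = q x) ->
    {in U, continuous p} -> {in U, continuous q}.
  move=> pq cf x xU; have Ux : U x by rewrite inE in xU.
  move: (cf x xU); rewrite /continuous_at -pq//; apply: cvg_trans.
  exact: (near_eq_cvg (nfg _ _ _ _ pq Ux)).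
elim: k f g => [|k IH] f g fg /=; first exact: ceq.
move=> [cf Df]; split; first exact: ceq cf.
move=> i; have [df ckf] := Df i; split.
  by move=> x Ux; apply: near_eq_derivable (df x Ux); exact: nfg.
apply: IH ckf => x Ux; apply: near_eq_derive; exact: nfg.
Qed.

Lemma Ck_onW (V : normedModType R) k U (f : 'rV[R]_m -> V) :
  Ck_on k.+1 U f -> Ck_on k U f.
Proof.
elim: k f => [|k IH] f; first by case.
move=> [cf Df]; split => // i; have [df ckf] := Df i; split => //.
exact: IH.
Qed.

Lemma is_derive_line (V : normedModType R) (f : 'rV[R]_m -> V) (y v : 'rV[R]_m) (t : R) :
  derivable f (y + t *: v) v ->
  is_derive t 1 (fun s : R => f (y + s *: v)) ('D_v f (y + t *: v)).
Proof.
move=> df.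
have E : (fun h : R => h^-1 *: (f (y + (h *: 1 + t) *: v) - f (y + t *: v))) =
         (fun h : R => h^-1 *: (f (h *: v + (y + t *: v)) - f (y + t *: v))).
  apply/funext => h; congr (_ *: (f _ - _)).
  by rewrite [h *: 1]mulr1 scalerDl addrCA.
apply: DeriveDef; first by rewrite /derivable/= E.
by rewrite /derive/= E.
Qed.

(** The increment [c] may have either sign, which lets a coordinate of a displacement be used as it
    is; hence the bound on [t] in absolute value. *)
Lemma MVT_line (f : 'rV[R]_m -> R) (y v : 'rV[R]_m) (c : R) :
  (forall t, `|t| <= `|c| -> derivable f (y + t *: v) v) ->
  exists2 t, `|t| <= `|c| & f (y + c *: v) - f y = c * 'D_v f (y + t *: v).
Proof.
move=> df; pose F (s : R) := f (y + s *: v).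
have dF (s : R) : `|s| <= `|c| -> is_derive s 1 F ('D_v f (y + s *: v)).
  by move=> sc; apply: is_derive_line; apply: df.
have cF (a b : R) : (forall s : R, s \in `[a, b] -> `|s| <= `|c|) ->
    {within `[a, b], continuous F}.
  move=> ab; apply: derivable_within_continuous => s sab.
  by have [] := dF s (ab s sab).
have [c0|c0] := leP 0 c.
  have ab (s : R) : s \in `[0, c] -> `|s| <= `|c|.
    by rewrite in_itv/= => /andP[s0 sc]; rewrite !ger0_norm// (le_trans s0).
  have [//||t tc E] := @MVT_segment R F (fun s => 'D_v f (y + s *: v)) 0 c c0.
  - by move=> s /subset_itv_oo_cc /ab /dF.
  - exact: cF.
  exists t; first exact: ab.
  by move: E; rewrite /F scale0r addr0 subr0 mulrC.
have ab (s : R) : s \in `[c, 0] -> `|s| <= `|c|.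
  by rewrite in_itv/= => /andP[s0 sc]; rewrite !ler0_norm ?(ltW c0)// lerN2.
have [//||t tc E] := @MVT_segment R F (fun s => 'D_v f (y + s *: v)) c 0 (ltW c0).
- by move=> s /subset_itv_oo_cc /ab /dF.
- exact: cF.
exists t; first exact: ab.
by move: E; rewrite /F scale0r addr0 sub0r mulrN mulrC => /(congr1 -%R); rewrite opprK opprB.
Qed.

(** The vertices of the staircase path from 0 to [h], which changes one coordinate at a time. *)
Definition trunc_row (h : 'rV[R]_m) (k : nat) : 'rV[R]_m :=
  \row_j (if (j < k)%N then h 0 j else 0).

Lemma trunc_row0 h : trunc_row h 0 = 0.
Proof. by apply/rowP => j; rewrite !mxE. Qed.

Lemma trunc_row_full h : trunc_row h m = h.
Proof. by apply/rowP => j; rewrite !mxE ltn_ord. Qed.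

Lemma trunc_rowS (h : 'rV[R]_m) (k : 'I_m) :
  trunc_row h k.+1 = trunc_row h k + h 0 k *: ei R k.
Proof.
apply/rowP => j; rewrite !mxE eqxx/= ltnS leq_eqVlt -val_eqE/=.
case: eqP => [jk|_] /=; first by rewrite jk ltnn add0r mulr1 (ord_inj jk).
by rewrite mulr0 addr0.
Qed.

Lemma norm_rowP (h : 'rV[R]_m) (r : R) : 0 <= r ->
  `|h| <= r <-> forall j, `|h 0 j| <= r.
Proof.
move=> r0; rewrite [`|h|]/Num.norm/= mx_normrE; split.
  move=> hr j; apply: le_trans hr; exact: (le_bigmax _ _ (0, j)).
by move=> hr; apply: bigmax_le => //= -[i j] _ /=; rewrite ord1.
Qed.

Lemma norm_trunc_line (h : 'rV[R]_m) (k : 'I_m) (t : R) : `|t| <= `|h 0 k| ->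
  `|trunc_row h k + t *: ei R k| <= `|h|.
Proof.
move=> th; have hj := (norm_rowP h (normr_ge0 h)).1 (lexx _).
apply/norm_rowP => // j; rewrite !mxE eqxx/=.
case: eqP => [->|_]; first by rewrite ltnn add0r mulr1 (le_trans th).
by rewrite mulr0 addr0; case: ifP => _; rewrite ?normr0.
Qed.

Definition row_form (c : 'I_m -> R) (h : 'rV[R]_m) : R := \sum_i h 0 i * c i.

Lemma row_form_linear c : linear (row_form c).
Proof.
move=> a u v; rewrite /row_form scaler_sumr -big_split/=.
by apply: eq_bigr => i _; rewrite !mxE mulrDl -mulrA.
Qed.

HB.instance Definition _ c :=
  GRing.isLinear.Build R 'rV[R]_m R _ (row_form c) (row_form_linear c).

Lemma continuous_sum (I : Type) (r : seq I) (P : pred I)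
    (F : I -> 'rV[R]_m -> R) (x : 'rV[R]_m) :
  (forall i, P i -> continuous_at x (F i)) ->
  continuous_at x (fun y => \sum_(i <- r | P i) F i y).
Proof.
move=> cF; elim: r => [|i r IH].
  rewrite (_ : (fun _ => _) = cst 0); first exact: cst_continuous.
  by apply/funext => y; rewrite big_nil.
have [Pi|nPi] := boolP (P i).
  rewrite (_ : (fun _ => _) = F i + (fun y => \sum_(i <- r | P i) F i y)).
    by apply: continuousD; [exact: cF|exact: IH].
  by apply/funext => y; rewrite big_cons Pi.
rewrite (_ : (fun _ => _) = (fun y => \sum_(i <- r | P i) F i y))//.
by apply/funext => y; rewrite big_cons (negbTE nPi).
Qed.

Lemma row_form_continuous c : continuous (row_form c).
Proof.
move=> x; apply: continuous_sum => i _.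
by apply: continuousM; [exact: coord_continuous|exact: cst_continuous].
Qed.

(** Along each edge of the staircase from [x] to [x + h] the mean value theorem produces a partial
    derivative at a nearby point, and continuity replaces it by the one at [x]. The errors of the
    edges add up. *)
Lemma C1_estimate U (f : 'rV[R]_m -> R) (x : 'rV[R]_m) (e : R) : open U -> U x -> Ck_on 1 U f ->
  0 < e -> \forall h \near (0 : 'rV[R]_m),
    `|f (h + x) - (f x + row_form (fun i => 'D_(ei R i) f x) h)| <= e * `|h|.
Proof.
move=> oU Ux [_ Df] e0.
(* Each of the [m] edges may cost this much times the norm of [h]. The successor keeps the tolerance
   positive in dimension 0. *)
have e'0 : 0 < e / m.+1%:R by rewrite divr_gt0.
have /nbhs_ballP[r /= r0 rU] : nbhs x U by exact: open_nbhs_nbhs.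
have : \forall y \near x, forall i : 'I_m,
    `|'D_(ei R i) f x - 'D_(ei R i) f y| < e / m.+1%:R.
  apply: (@filter_forall _ _ _ (nbhs x)) => i.
  have /(_ x (mem_set Ux)) cD := (Df i).2.
  by move/cvgrPdist_lt : cD; apply.
move=> /nbhs_ballP[r' /= r'0 rD].
near=> h.
have hr : `|h| < Num.min r r'.
  near: h; apply/nbhs_ballP; exists (Num.min r r').
    by rewrite /= lt_min r0.
  by move=> h; rewrite -ball_normE /ball_/= sub0r normrN.
have step (k : 'I_m) :
    `|f (x + trunc_row h k.+1) - f (x + trunc_row h k)
      - h 0 k * 'D_(ei R k) f x| <= e / m.+1%:R * `|h|.
  have inb t : `|t| <= `|h 0 k| ->
      ball x (Num.min r r') (x + trunc_row h k + t *: ei R k).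
    move=> th; rewrite -ball_normE /ball_/= -addrA opprD addrA subrr sub0r normrN.
    by rewrite (le_lt_trans _ hr) // norm_trunc_line.
  have [|t th E] := @MVT_line f (x + trunc_row h k) (ei R k) (h 0 k).
    move=> t /inb tb; apply: (Df k).1; apply: rU.
    by apply: le_ball tb; rewrite ge_min lexx.
  rewrite trunc_rowS addrA E -mulrBr normrM mulrC ler_pM//.
    rewrite distrC ltW//; apply: rD.
    by have := inb t th; apply: le_ball; rewrite ge_min lexx orbT.
  by have := (norm_rowP h (normr_ge0 h)).1 (lexx _) k.
have main k : (k <= m)%N ->
    `|f (x + trunc_row h k) - f x
      - \sum_(i < m | (i < k)%N) h 0 i * 'D_(ei R i) f x|
    <= k%:R * (e / m.+1%:R * `|h|).
  elim: k => [_|k IH km].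
    by rewrite trunc_row0 addr0 subrr big_pred0// subr0 normr0 mul0r.
  have -> : \sum_(i < m | (i < k.+1)%N) h 0 i * 'D_(ei R i) f x =
    h 0 (Ordinal km) * 'D_(ei R (Ordinal km)) f x +
    \sum_(i < m | (i < k)%N) h 0 i * 'D_(ei R i) f x.
    rewrite (bigD1 (Ordinal km))//=; congr (_ + _); apply: eq_bigl => i.
    by rewrite ltnS -val_eqE/= andbC ltn_neqAle.
  rewrite -natr1 mulrDl mul1r.
  apply: le_trans (lerD (IH (ltnW km)) (step (Ordinal km))).
  apply: le_trans (ler_normD _ _); rewrite le_eqVlt; apply/orP; left; apply/eqP.
  congr `|_|; rewrite /=.
  set a := f _; set b := f _; set c := f _; set p := h 0 _ * _; set q := \sum_(_ | _) _.
  rewrite -/p; ring.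
have := main m (leqnn m); rewrite trunc_row_full (addrC h).
rewrite (eq_bigl xpredT); last by move=> i; rewrite ltn_ord.
rewrite -/(row_form (fun i => 'D_(ei R i) f x) h) opprD addrA => /le_trans; apply.
rewrite mulrA ler_wpM2r// mulrC -mulrA ler_piMr ?(ltW e0)//.
by rewrite mulrC ler_pdivrMr// mul1r ler_nat.
Unshelve. all: by end_near. Qed.

(** [Ck_on] speaks only of partial derivatives along the coordinate axes. Differentiability is what
    makes ['D_v f x] linear in [v] and gives the chain rule. *)
Lemma C1_differentiable U (f : 'rV[R]_m -> R) (x : 'rV[R]_m) : open U -> U x ->
  Ck_on 1 U f -> differentiable f x.
Proof.
move=> oU Ux cf.
pose L := row_form (fun i => 'D_(ei R i) f x) : {linear 'rV[R]_m -> R}.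
have cL : continuous L by exact: row_form_continuous.
have E : f \o shift x = cst (f x) + L +o_ (0 : 'rV[R]_m) id.
  apply/eqaddoP => e e0; have := C1_estimate oU Ux cf e0.
  by apply: filterS => h /=; rewrite !fctE/=.
apply/diff_locallyP; rewrite (diff_unique cL E); split => //.
Qed.

End Smooth.

(** * Algebra of smooth functions and symmetry of second derivatives *)

Section SmoothAlgebra.
Variables (R : realType) (m : nat) (U : set 'rV[R]_m).
Hypothesis oU : open U.
Implicit Types (f g : 'rV[R]_m -> R) (x u v : 'rV[R]_m).

Lemma smooth_differentiable f x : smooth_on U f -> U x -> differentiable f x.
Proof. by move=> sf Ux; apply: C1_differentiable oU Ux (sf 1%N). Qed.

Lemma smooth_derivable f x v : smooth_on U f -> U x -> derivable f x v.
Proof. by move=> sf Ux; apply/diff_derivable/smooth_differentiable. Qed.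

Lemma smooth_continuous f x : smooth_on U f -> U x -> {for x, continuous f}.
Proof. by move=> sf Ux; apply: (sf 0%N); rewrite inE. Qed.

Lemma smooth_on_eq f g : (forall x, U x -> f x = g x) ->
  smooth_on U f -> smooth_on U g.
Proof. by move=> fg sf k; apply: Ck_on_eq fg (sf k). Qed.

Lemma derive_eq_on (V : normedModType R) (f g : 'rV[R]_m -> V) x v :
  (forall y, U y -> f y = g y) -> U x -> 'D_v f x = 'D_v g x.
Proof.
move=> fg Ux; apply: near_eq_derive.
have : nbhs x U by exact: open_nbhs_nbhs.
by apply: filterS.
Qed.

Lemma Ck_on_cst k (a : R) : Ck_on k U (fun=> a).
Proof.
elim: k a => [|k IH] a /=; first by move=> x _; exact: cst_continuous.
split; first by move=> x _; exact: cst_continuous.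
move=> i; split=> [x _|]; first exact: derivable_cst.
by apply: Ck_on_eq oU _ (IH 0) => x _; rewrite derive_cst.
Qed.

Lemma Ck_onD k f g : Ck_on k U f -> Ck_on k U g -> Ck_on k U (fun x => f x + g x).
Proof.
elim: k f g => [|k IH] f g /=.
  by move=> cf cg x xU; apply: continuousD; [exact: cf|exact: cg].
move=> [cf Df] [cg Dg]; split.
  by move=> x xU; apply: continuousD; [exact: cf|exact: cg].
move=> i; have [df ckf] := Df i; have [dg ckg] := Dg i; split.
  by move=> x Ux; apply: derivableD; [exact: df|exact: dg].
apply: Ck_on_eq oU _ (IH _ _ ckf ckg) => x Ux.
by rewrite -deriveD; [|exact: df|exact: dg].
Qed.

Lemma Ck_onM k f g : Ck_on k U f -> Ck_on k U g -> Ck_on k U (fun x => f x * g x).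
Proof.
elim: k f g => [|k IH] f g.
  by move=> cf cg x xU; apply: continuousM; [exact: cf|exact: cg].
move=> Cf Cg; have [cf Df] := Cf; have [cg Dg] := Cg; split.
  by move=> x xU; apply: continuousM; [exact: cf|exact: cg].
move=> i; have [df ckf] := Df i; have [dg ckg] := Dg i; split.
  by move=> x Ux; apply: derivableM; [exact: df|exact: dg].
have := Ck_onD (IH _ _ (Ck_onW Cf) ckg) (IH _ _ (Ck_onW Cg) ckf).
apply: Ck_on_eq => // x Ux.
by rewrite deriveM; [|exact: df|exact: dg].
Qed.

(** The derivative of 1/f is -(1/f)^2 times that of f, so the induction hypothesis applied to 1/f
    itself closes the step. *)
Lemma Ck_onV k f : (forall x, U x -> f x != 0) -> Ck_on k U f ->
  Ck_on k U (fun x => (f x)^-1).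
Proof.
move=> f0; elim: k => [|k IH].
  move=> cf x xU; have Ux : U x by rewrite inE in xU.
  by apply: continuousV; [exact: f0|exact: cf].
move=> Cf; have [cf Df] := Cf; split.
  move=> x xU; have Ux : U x by rewrite inE in xU.
  by apply: continuousV; [exact: f0|exact: cf].
move=> i; have [df ckf] := Df i; split.
  by move=> x Ux; apply: derivableV; [exact: f0|exact: df].
have CV := IH (Ck_onW Cf).
have := Ck_onM (Ck_onM CV CV) (Ck_onM (Ck_on_cst k (-1)) ckf).
apply: Ck_on_eq => // x Ux.
rewrite deriveV; [|exact: f0|exact: df].
by rewrite mulN1r mulrN -invfM -mulNr -expr2.
Qed.

Lemma smooth_cst (a : R) : smooth_on U (fun=> a).
Proof. by move=> k; exact: Ck_on_cst. Qed.

Lemma smoothD f g : smooth_on U f -> smooth_on U g ->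
  smooth_on U (fun x => f x + g x).
Proof. by move=> sf sg k; apply: Ck_onD. Qed.

Lemma smoothM f g : smooth_on U f -> smooth_on U g ->
  smooth_on U (fun x => f x * g x).
Proof. by move=> sf sg k; apply: Ck_onM. Qed.

Lemma smoothN f : smooth_on U f -> smooth_on U (fun x => - f x).
Proof.
move=> sf; rewrite (_ : (fun x => - f x) = fun x => -1 * f x).
  by apply: smoothM => //; exact: smooth_cst.
by apply/funext => x; rewrite mulN1r.
Qed.

Lemma smoothB f g : smooth_on U f -> smooth_on U g ->
  smooth_on U (fun x => f x - g x).
Proof. by move=> sf sg; apply: smoothD => //; exact: smoothN. Qed.

Lemma smoothV f : (forall x, U x -> f x != 0) -> smooth_on U f ->
  smooth_on U (fun x => (f x)^-1).
Proof. by move=> f0 sf k; apply: Ck_onV. Qed.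

Lemma Ck_on_sum k (I : Type) (r : seq I) (P : pred I) (F : I -> 'rV[R]_m -> R) :
  (forall i, Ck_on k U (F i)) -> Ck_on k U (fun x => \sum_(i <- r | P i) F i x).
Proof.
move=> sF; elim: r => [|i r IH].
  by apply: Ck_on_eq oU _ (Ck_on_cst k 0) => x _; rewrite big_nil.
have [Pi|Pi] := boolP (P i); last first.
  by apply: Ck_on_eq oU _ IH => x _; rewrite big_cons (negbTE Pi).
by apply: Ck_on_eq oU _ (Ck_onD (sF i) IH) => x _; rewrite big_cons Pi.
Qed.

Lemma smooth_sum (I : Type) (r : seq I) (P : pred I) (F : I -> 'rV[R]_m -> R) :
  (forall i, smooth_on U (F i)) -> smooth_on U (fun x => \sum_(i <- r | P i) F i x).
Proof. by move=> sF k; apply: Ck_on_sum => i; exact: sF. Qed.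

Lemma smooth_prod (I : Type) (r : seq I) (P : pred I) (F : I -> 'rV[R]_m -> R) :
  (forall i, smooth_on U (F i)) -> smooth_on U (fun x => \prod_(i <- r | P i) F i x).
Proof.
move=> sF; elim: r => [|i r IH].
  by apply: smooth_on_eq (smooth_cst 1) => x _; rewrite big_nil.
have [Pi|Pi] := boolP (P i); last first.
  by apply: smooth_on_eq IH => x _; rewrite big_cons (negbTE Pi).
by apply: smooth_on_eq (smoothM (sF i) IH) => x _; rewrite big_cons Pi.
Qed.

Lemma row_sum_ei u : u = \sum_i u 0 i *: ei R i.
Proof. exact: row_sum_delta. Qed.

Lemma derive_dirE (V : normedModType R) (f : 'rV[R]_m -> V) x v :
  differentiable f x -> 'D_v f x = \sum_i v 0 i *: 'D_(ei R i) f x.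
Proof.
move=> df; rewrite deriveE// {1}(row_sum_ei v) linear_sum.
by apply: eq_bigr => i _; rewrite linearZ deriveE.
Qed.

Lemma derive_dirD (V : normedModType R) (f : 'rV[R]_m -> V) x u v :
  differentiable f x -> 'D_(u + v) f x = 'D_u f x + 'D_v f x.
Proof. by move=> df; rewrite !deriveE// linearD. Qed.

Lemma derive_dirZ (V : normedModType R) (f : 'rV[R]_m -> V) x a v :
  differentiable f x -> 'D_(a *: v) f x = a *: 'D_v f x.
Proof. by move=> df; rewrite !deriveE// linearZ. Qed.

Lemma derive_dir_linear f x : smooth_on U f -> U x -> linear (fun v => 'D_v f x).
Proof.
move=> sf Ux a u v; have df := smooth_differentiable sf Ux.
by rewrite derive_dirD// derive_dirZ.
Qed.

Lemma smooth_ei f i : smooth_on U f -> smooth_on U ('D_(ei R i) f).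
Proof. by move=> sf k; have [_ /(_ i)[]] := sf k.+1. Qed.

Lemma smooth_derive f v : smooth_on U f -> smooth_on U ('D_v f).
Proof.
move=> sf; have := @smooth_sum _ (index_enum 'I_m) predT
  (fun i x => v 0 i * 'D_(ei R i) f x) _.
move=> /(_ _)/smooth_on_eq; apply.
  by move=> x Ux; rewrite derive_dirE//; exact: smooth_differentiable.
by move=> i; apply: smoothM; [exact: smooth_cst|exact: smooth_ei].
Qed.

Lemma derive_sum_fun (I : finType) (F : I -> 'rV[R]_m -> R) x v :
  (forall i, derivable (F i) x v) ->
  'D_v (fun y => \sum_i F i y) x = \sum_i 'D_v (F i) x.
Proof.
move=> dF.
suff : forall r, is_derive x v (fun y => \sum_(i <- r) F i y) (\sum_(i <- r) 'D_v (F i) x).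
  by move=> /(_ (index_enum I))[].
elim=> [|i r IH].
  rewrite big_nil (_ : (fun _ => _) = cst 0); first exact: is_derive_cst.
  by apply/funext => y; rewrite big_nil.
rewrite big_cons (_ : (fun _ => _) = F i + (fun y => \sum_(i <- r) F i y)).
  by apply: is_deriveD; exact: derivableP.
by apply/funext => y; rewrite big_cons.
Qed.

Lemma derive_shift_row (V : normedModType R) (f : 'rV[R]_m -> V) w x v :
  derivable f (x + w) v ->
  is_derive x v (fun y => f (y + w)) ('D_v f (x + w)).
Proof.
move=> df.
have E : (fun h : R => h^-1 *: (f ((h *: v + x) + w) - f (x + w))) =
         (fun h : R => h^-1 *: (f (h *: v + (x + w)) - f (x + w))).
  by apply/funext => h; rewrite addrA.
apply: DeriveDef; first by rewrite /derivable/= E.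
by rewrite /derive/= E.
Qed.

(** The second difference of [f] is a first difference along [u] of y -> f (y + t v) - f y. The mean
    value theorem is applied to it, and then along [v] to the derivative it produces. *)
Lemma double_MVT f x u v (t : R) :
  (forall y, U y -> derivable f y u) ->
  (forall y, U y -> derivable ('D_u f) y v) ->
  (forall a b : R, `|a| <= `|t| -> `|b| <= `|t| -> U (x + a *: u + b *: v)) ->
  exists a b : R, [/\ `|a| <= `|t|, `|b| <= `|t| &
    f (x + t *: u + t *: v) - f (x + t *: u) - (f (x + t *: v) - f x) =
    t * (t * 'D_v ('D_u f) (x + a *: u + b *: v))].
Proof.
move=> df ddf inU; pose g y := f (y + t *: v) - f y.
have inU0 a : `|a| <= `|t| -> U (x + a *: u).
  by move=> ha; have := inU a 0 ha; rewrite scale0r addr0 normr0; apply.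
have dg a : `|a| <= `|t| -> is_derive (x + a *: u) u g
    ('D_u f (x + a *: u + t *: v) - 'D_u f (x + a *: u)).
  move=> ha; apply: is_deriveB; first by apply/derive_shift_row/df/inU.
  by apply/derivableP/df/inU0.
have [a ha|a ha E] := @MVT_line R m g x u t; first by have [] := dg a ha.
have [b hb|b hb E'] := @MVT_line R m ('D_u f) (x + a *: u) v t.
  by apply/ddf/inU.
exists a, b; split => //; move: E; have [_ ->] := dg a ha.
by rewrite E'.
Qed.

(** The second difference over a parallelogram is symmetric in its two sides, so the two mixed
    derivatives take a common value at two points close to [x]; continuity of both concludes. *)
Lemma schwarz f x u v : smooth_on U f -> U x ->
  'D_u ('D_v f) x = 'D_v ('D_u f) x.
Proof.
move=> sf Ux; apply/eqP; rewrite -subr_eq0 -normr_le0; apply/ler_addgt0Pl => e e0.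
rewrite addr0.
have cc w w' : {for x, continuous ('D_w ('D_w' f))}.
  by apply: smooth_continuous Ux; do 2!apply: smooth_derive.
have e20 : 0 < e / 2 by rewrite divr_gt0.
have /cvgrPdist_le /(_ _ e20) /nbhs_ballP[r1 /= r10 h1] := cc u v.
have /cvgrPdist_le /(_ _ e20) /nbhs_ballP[r2 /= r20 h2] := cc v u.
have /nbhs_ballP[r0 /= r00 h0] : nbhs x U by exact: open_nbhs_nbhs.
pose r := Num.min r0 (Num.min r1 r2).
have r_gt0 : 0 < r by rewrite !lt_min r00 r10.
(* This size keeps the parallelogram inside the ball of radius [r]; the summand 1 covers
   [u = v = 0]. *)
pose t := r / (2 * (`|u| + `|v| + 1)).
have den0 : 0 < `|u| + `|v| + 1 by rewrite ltr_wpDl// addr_ge0.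
have t0 : 0 < t by rewrite divr_gt0// mulr_gt0.
have inb w w' (a b : R) : `|w| + `|w'| = `|u| + `|v| -> `|a| <= `|t| -> `|b| <= `|t| ->
    ball x r (x + a *: w + b *: w').
  move=> ww ha hb; rewrite -ball_normE /ball_/= -addrA opprD addrA subrr sub0r normrN.
  rewrite (le_lt_trans (ler_normD _ _))// !normrZ.
  rewrite (@le_lt_trans _ _ (t * (`|u| + `|v|)))//.
    rewrite -ww mulrDr -(gtr0_norm t0); apply: lerD; exact: ler_wpM2r.
  rewrite /t mulrAC ltr_pdivrMr ?mulr_gt0// ltr_pM2l//; lra.
have rr0 y : ball x r y -> U y by move=> by_; apply: h0; apply: le_ball by_; rewrite ge_min lexx.
have rr1 y : ball x r y -> ball x r1 y by apply: le_ball; rewrite !ge_min lexx orbT.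
have rr2 y : ball x r y -> ball x r2 y by apply: le_ball; rewrite !ge_min lexx !orbT.
have dd w y : U y -> derivable f y w by exact: smooth_derivable.
have ddd w w' y : U y -> derivable ('D_w f) y w'.
  by apply: smooth_derivable; exact: smooth_derive.
have [a b ha hb|a [b [ha hb E]]] := @double_MVT f x u v t (dd _) (ddd _ _).
  exact/rr0/inb.
have [a' b' ha' hb'|a' [b' [ha' hb' E']]] := @double_MVT f x v u t (dd _) (ddd _ _).
  by apply/rr0/inb; rewrite // addrC.
have : 'D_v ('D_u f) (x + a *: u + b *: v) = 'D_u ('D_v f) (x + a' *: v + b' *: u).
  apply: (mulfI (lt0r_neq0 t0)); apply: (mulfI (lt0r_neq0 t0)).
  apply: (etrans (esym E) (etrans _ E')); rewrite (addrAC x).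
  move: (f _) (f _) (f _) => *; ring.
have := h1 _ (rr1 _ (inb v u a' b' (addrC _ _) ha' hb')).
have := h2 _ (rr2 _ (inb u v a b erefl ha hb)).
move: ('D_v ('D_u f) x) ('D_u ('D_v f) x) => p q.
move: ('D_v ('D_u f) _) ('D_u ('D_v f) _) => p' q' /= h h' pq.
rewrite pq in h; rewrite (splitr e); apply: le_trans (lerD h' h).
rewrite (distrC p); apply: le_trans (ler_normD _ _).
by rewrite addrA subrK.
Qed.

End SmoothAlgebra.

(** * Matrix-valued smooth functions and the chain rule *)

Section SmoothMatrix.
Variables (R : realType) (m : nat) (U : set 'rV[R]_m).
Hypothesis oU : open U.

(** Smoothness is taken entrywise so that the scalar calculus applies directly; [smooth_on_mx]
    derives it from [smooth_on]. *)
Definition smooth_mx (W : set 'rV[R]_m) p q (X : 'rV[R]_m -> 'M[R]_(p, q)) : Prop :=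
  forall i j, smooth_on W (fun y => X y i j).

Lemma Ck_on_entry k p q (X : 'rV[R]_m -> 'M[R]_(p, q)) i j :
  Ck_on k U X -> Ck_on k U (fun y => X y i j).
Proof.
elim: k X => [|k IH] X /=.
  move=> cX x xU; apply: (@continuous_comp _ _ _ X (fun M : 'M[R]_(p, q) => M i j)).
    exact: cX.
  exact: coord_continuous.
move=> [cX DX]; split.
  move=> x xU; apply: (@continuous_comp _ _ _ X (fun M : 'M[R]_(p, q) => M i j)).
    exact: cX.
  exact: coord_continuous.
move=> l; have [dX cD] := DX l; split.
  by move=> x Ux; have /derivable_mxP := dX x Ux; apply.
apply: (Ck_on_eq oU _ (IH _ cD)) => x Ux.
by rewrite derive_mx ?mxE//; exact: dX.
Qed.

Lemma smooth_on_mx p q (X : 'rV[R]_m -> 'M[R]_(p, q)) :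
  smooth_on U X -> smooth_mx U X.
Proof. by move=> sX i j k; apply: Ck_on_entry. Qed.

Section Entries.
Variables (p q : nat).
Implicit Types (X Y : 'rV[R]_m -> 'M[R]_(p, q)) (x v : 'rV[R]_m).

Lemma smooth_mx_derivable X x v : smooth_mx U X -> U x -> derivable X x v.
Proof.
move=> sX Ux; apply/derivable_mxP => i j; exact: (smooth_derivable oU (sX i j) Ux).
Qed.

Lemma derive_mxE X x v i j : smooth_mx U X -> U x ->
  ('D_v X x) i j = 'D_v (fun y => X y i j) x.
Proof. by move=> sX Ux; rewrite derive_mx ?mxE//; exact: smooth_mx_derivable. Qed.

Lemma smooth_mx_eq X Y : (forall x, U x -> X x = Y x) ->
  smooth_mx U X -> smooth_mx U Y.
Proof. by move=> XY sX i j; apply: (smooth_on_eq oU _ (sX i j)) => x Ux; rewrite XY. Qed.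

Lemma smooth_mx_derive X v : smooth_mx U X -> smooth_mx U ('D_v X).
Proof.
move=> sX i j; apply: (smooth_on_eq oU _ (smooth_derive oU v (sX i j))) => x Ux.
by rewrite derive_mxE.
Qed.

Lemma smooth_mx_cst (A : 'M[R]_(p, q)) : smooth_mx U (fun=> A).
Proof. by move=> i j; exact: smooth_cst. Qed.

Lemma smooth_mxD X Y : smooth_mx U X -> smooth_mx U Y ->
  smooth_mx U (fun x => X x + Y x).
Proof.
move=> sX sY i j; apply: (smooth_on_eq oU _ (smoothD oU (sX i j) (sY i j))) => x _.
by rewrite !mxE.
Qed.

Lemma smooth_mxN X : smooth_mx U X -> smooth_mx U (fun x => - X x).
Proof.
move=> sX i j; apply: (smooth_on_eq oU _ (smoothN oU (sX i j))) => x _.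
by rewrite !mxE.
Qed.

Lemma smooth_mxB X Y : smooth_mx U X -> smooth_mx U Y ->
  smooth_mx U (fun x => X x - Y x).
Proof. by move=> sX sY; apply: smooth_mxD => //; exact: smooth_mxN. Qed.

Lemma smooth_mxZ (a : 'rV[R]_m -> R) X : smooth_on U a -> smooth_mx U X ->
  smooth_mx U (fun x => a x *: X x).
Proof.
move=> sa sX i j; apply: (smooth_on_eq oU _ (smoothM oU sa (sX i j))) => x _.
by rewrite !mxE.
Qed.

Lemma derive_mxD X Y x v : smooth_mx U X -> smooth_mx U Y -> U x ->
  'D_v (fun y => X y + Y y) x = 'D_v X x + 'D_v Y x.
Proof. by move=> sX sY Ux; rewrite deriveD//; exact: smooth_mx_derivable. Qed.

Lemma schwarz_mx X x u v : smooth_mx U X -> U x ->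
  'D_u ('D_v X) x = 'D_v ('D_u X) x.
Proof.
move=> sX Ux; apply/matrixP => i j.
have E a b : ('D_a ('D_b X) x) i j = 'D_a ('D_b (fun y => X y i j)) x.
  rewrite derive_mxE; [|exact: smooth_mx_derive|exact: Ux].
  by apply: (derive_eq_on oU) => // y Uy; rewrite derive_mxE.
exact: (etrans (E u v) (etrans (schwarz oU u v (sX i j) Ux) (esym (E v u)))).
Qed.

End Entries.

Lemma smooth_mulmx p q r (X : 'rV[R]_m -> 'M[R]_(p, q)) (Y : 'rV[R]_m -> 'M[R]_(q, r)) :
  smooth_mx U X -> smooth_mx U Y -> smooth_mx U (fun x => X x *m Y x).
Proof.
move=> sX sY i j.
apply: (smooth_on_eq oU _ (smooth_sum oU (index_enum 'I_q) predT
  (fun k => smoothM oU (sX i k) (sY k j)))) => x _.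
by rewrite mxE.
Qed.

Lemma derive_mulmx p q r (X : 'rV[R]_m -> 'M[R]_(p, q))
    (Y : 'rV[R]_m -> 'M[R]_(q, r)) (x v : 'rV[R]_m) :
  smooth_mx U X -> smooth_mx U Y -> U x ->
  'D_v (fun y => X y *m Y y) x = 'D_v X x *m Y x + X x *m 'D_v Y x.
Proof.
move=> sX sY Ux; apply/matrixP => i j.
rewrite derive_mxE//; last exact: smooth_mulmx.
rewrite (_ : (fun y => _) = (fun y => \sum_k X y i k * Y y k j)); last first.
  by apply/funext => y; rewrite mxE.
have dX k : derivable (fun y => X y i k) x v by exact: (smooth_derivable oU (sX i k) Ux).
have dY k : derivable (fun y => Y y k j) x v by exact: (smooth_derivable oU (sY k j) Ux).
rewrite derive_sum_fun; last by move=> k; exact: derivableM.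
rewrite !mxE -big_split/=; apply: eq_bigr => k _; rewrite !derive_mxE// deriveM//.
by rewrite addrC [_ *: 'D_v (fun y => X y i k) x]mulrC.
Qed.

Lemma smooth_det p (A : 'rV[R]_m -> 'M[R]_p) : smooth_mx U A ->
  smooth_on U (fun x => \det (A x)).
Proof.
move=> sA; apply: smooth_sum => // s; apply: smoothM => //; first exact: smooth_cst.
by apply: smooth_prod => // i; exact: sA.
Qed.

(** By Cramer's rule the inverse is the adjugate over the determinant, both polynomial in the
    entries. *)
Lemma smooth_invmx p (A : 'rV[R]_m -> 'M[R]_p) :
  (forall x, U x -> A x \in unitmx) -> smooth_mx U A ->
  smooth_mx U (fun x => invmx (A x)).
Proof.
move=> uA sA.
have : smooth_mx U (fun x => (\det (A x))^-1 *: \adj (A x)).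
  apply: smooth_mxZ.
    apply: smoothV => //; last exact: smooth_det.
    by move=> x Ux; have := uA x Ux; rewrite unitmxE unitfE.
  move=> i j.
  apply: (smooth_on_eq oU _ (smoothM oU (smooth_cst oU ((-1) ^+ (j + i)))
    (smooth_det (A := fun x => row' j (col' i (A x))) _))) => [x _|i' j'].
    by rewrite mxE.
  apply: (smooth_on_eq oU _ (sA (lift j i') (lift i j'))) => x _.
  by rewrite !mxE.
by apply: smooth_mx_eq => x Ux; rewrite /invmx uA.
Qed.

Lemma derive_invmx p (A : 'rV[R]_m -> 'M[R]_p) (x v : 'rV[R]_m) :
  (forall y, U y -> A y \in unitmx) -> smooth_mx U A -> U x ->
  'D_v (fun y => invmx (A y)) x = - (invmx (A x) *m 'D_v A x *m invmx (A x)).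
Proof.
move=> uA sA Ux; have sI := smooth_invmx uA sA.
have := derive_mulmx v sA sI Ux.
rewrite (@derive_eq_on _ _ _ oU _ _ (fun=> 1%:M)) => [|y Uy|//]; last by rewrite mulmxV ?uA.
rewrite derive_cst => /(congr1 (mulmx (invmx (A x)))).
rewrite mulmx0 mulmxDr !mulmxA mulVmx ?uA// mul1mx => /eqP.
by rewrite eq_sym addrC addr_eq0 => /eqP.
Qed.

Lemma smooth_mxtrace p (A : 'rV[R]_m -> 'M[R]_p) : smooth_mx U A ->
  smooth_on U (fun x => \tr (A x)).
Proof. by move=> sA; apply: smooth_sum => // i; exact: sA. Qed.

Lemma derive_mxtrace p (A : 'rV[R]_m -> 'M[R]_p) (x v : 'rV[R]_m) :
  smooth_mx U A -> U x -> 'D_v (fun y => \tr (A y)) x = \tr ('D_v A x).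
Proof.
move=> sA Ux; rewrite derive_sum_fun; last by move=> i; exact: (smooth_derivable oU _ Ux).
by apply: eq_bigr => i _; rewrite derive_mxE.
Qed.

Lemma row_differentiable p (X : 'rV[R]_m -> 'rV[R]_p) (x : 'rV[R]_m) :
  smooth_mx U X -> U x -> differentiable X x.
Proof.
move=> sX Ux; rewrite (_ : X = \sum_(j < p) (fun y => X y 0 j *: ei R j)).
  apply: differentiable_sum => j; apply: differentiableZl.
  exact: (smooth_differentiable oU (sX 0 j) Ux).
by apply/funext => y; rewrite fct_sumE [LHS]row_sum_ei.
Qed.

Lemma derive_dir_linear_row p (X : 'rV[R]_m -> 'rV[R]_p) x : smooth_mx U X -> U x ->
  linear (fun v => 'D_v X x).
Proof.
move=> sX Ux a u v; have dX := row_differentiable sX Ux.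
by rewrite derive_dirD// derive_dirZ.
Qed.

Lemma derive_compE p (V : normedModType R) (F : 'rV[R]_m -> 'rV[R]_p)
    (f : 'rV[R]_p -> V) (x v : 'rV[R]_m) :
  differentiable F x -> differentiable f (F x) ->
  'D_v (fun y => f (F y)) x = 'D_('D_v F x) f (F x).
Proof.
move=> dF df; rewrite !deriveE//; last exact: differentiable_comp.
by rewrite diff_comp.
Qed.

(** Induction on [k] with [f] generalized: a partial derivative of the composite is a sum of
    products of a derivative of [F] and a composite ('D_j f) o F, with ['D_j f] again smooth. *)
Lemma Ck_on_comp p k (F : 'rV[R]_m -> 'rV[R]_p) (W : set 'rV[R]_p) (f : 'rV[R]_p -> R) :
  open W -> (forall x, U x -> W (F x)) -> smooth_mx U F -> smooth_on W f ->
  Ck_on k U (fun x => f (F x)).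
Proof.
move=> oW UW sF; elim: k f => [|k IH] f sf.
  move=> x xU; have Ux : U x by rewrite inE in xU.
  apply: (@continuous_comp _ _ _ F f); last exact: (smooth_continuous sf (UW _ Ux)).
  exact/differentiable_continuous/row_differentiable.
split.
  move=> x xU; have Ux : U x by rewrite inE in xU.
  apply: (@continuous_comp _ _ _ F f).
    exact/differentiable_continuous/row_differentiable.
  exact: (smooth_continuous sf (UW _ Ux)).
have dF x : U x -> differentiable F x by exact: row_differentiable.
have df x : U x -> differentiable f (F x).
  by move=> /UW; exact: smooth_differentiable.
move=> i; split.
  by move=> x Ux; apply/diff_derivable/differentiable_comp; [exact: dF|exact: df].
have S j : Ck_on k U (fun x => ('D_(ei R i) F x) 0 j * 'D_(ei R j) f (F x)).
  apply: (Ck_onM oU); first exact: (smooth_mx_derive _ sF).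
  by exact: (IH ('D_(ei R j) f) (smooth_ei j sf)).
apply: (Ck_on_eq oU _ (Ck_on_sum oU (index_enum 'I_p) predT S)) => x Ux.
rewrite (derive_compE _ (dF x Ux) (df x Ux)).
by rewrite (derive_dirE _ (df x Ux)).
Qed.

Lemma smooth_comp p (F : 'rV[R]_m -> 'rV[R]_p) (W : set 'rV[R]_p) (f : 'rV[R]_p -> R) :
  open W -> (forall x, U x -> W (F x)) -> smooth_mx U F -> smooth_on W f ->
  smooth_on U (fun x => f (F x)).
Proof. by move=> oW UW sF sf k; exact: (Ck_on_comp k oW UW sF sf). Qed.

End SmoothMatrix.

(** * Leibniz rules for families of linear maps *)

Section LinearFamily.
Variables (R : realType) (m p : nat) (U : set 'rV[R]_m).
Hypothesis oU : open U.
Variable (X : 'rV[R]_m -> 'rV[R]_p).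
Hypothesis sX : smooth_mx U X.

Lemma lin_rowE (V : lmodType R) (L : 'rV[R]_p -> V) u : linear L ->
  L u = \sum_j u 0 j *: L (ei R j).
Proof.
move=> lL; pose H := GRing.isLinear.Build R _ V _ L lL.
pose f : {linear 'rV[R]_p -> V} := HB.pack L H.
by rewrite {1}(row_sum_ei u) -[L]/(f : _ -> _) linear_sum; apply: eq_bigr => j _; rewrite linearZ.
Qed.

Section Scalar.
Variable (L : 'rV[R]_m -> 'rV[R]_p -> R).
Hypothesis lL : forall y, U y -> linear (L y).
Hypothesis sL : forall v, smooth_on U (fun y => L y v).

Lemma smooth_lin : smooth_on U (fun y => L y (X y)).
Proof.
apply: (smooth_on_eq oU _ (smooth_sum oU (index_enum 'I_p) predT
  (fun j => smoothM oU (sX 0 j) (sL (ei R j))))) => y Uy.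
by rewrite (lin_rowE (X y) (lL Uy)).
Qed.

(** Expanding [X y] in the standard basis reduces this to the product rule. One term differentiates
    the family with its argument frozen, the other differentiates the argument; the covariant
    Leibniz rules for metric, connection, curvature and forms all come from this. *)
Lemma derive_lin x w : U x ->
  'D_w (fun y => L y (X y)) x = 'D_w (fun y => L y (X x)) x + L x ('D_w X x).
Proof.
move=> Ux.
have E Y y : U y -> L y Y = \sum_j Y 0 j * L y (ei R j).
  by move=> Uy; rewrite (lin_rowE Y (lL Uy)).
rewrite (derive_eq_on oU (g := fun y => \sum_j X y 0 j * L y (ei R j)))//; last first.
  by move=> y Uy; exact: E.
rewrite (derive_eq_on (f := fun y => L y (X x)) oU
  (g := fun y => \sum_j X x 0 j * L y (ei R j)))//; last by move=> y Uy; exact: E.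
have dX j : derivable (fun y => X y 0 j) x w by exact: (smooth_derivable oU _ Ux).
have dL j : derivable (fun y => L y (ei R j)) x w by exact: (smooth_derivable oU _ Ux).
rewrite !derive_sum_fun; last 2 first.
- by move=> j; apply: derivableM => //; exact: derivable_cst.
- by move=> j; apply: derivableM.
rewrite E// -big_split/=; apply: eq_bigr => j _.
have dC : derivable (fun=> X x 0 j) x w by exact: derivable_cst.
rewrite (deriveM (dX j) (dL j)) (deriveM dC (dL j)) derive_cst scaler0 addr0 (derive_mxE oU)//.
by congr (_ + _); rewrite [LHS]mulrC.
Qed.

End Scalar.

Section Vector.
Variables (q : nat) (L : 'rV[R]_m -> 'rV[R]_p -> 'rV[R]_q).
Hypothesis lL : forall y, U y -> linear (L y).
Hypothesis sL : forall v, smooth_mx U (fun y => L y v).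

Let lLj j y : U y -> linear (fun v => L y v 0 j).
Proof. by move=> Uy a u v; rewrite lL// !mxE. Qed.

Lemma smooth_lin_row : smooth_mx U (fun y => L y (X y)).
Proof.
move=> i j; rewrite ord1; apply: (@smooth_lin (fun y v => L y v 0 j)).
  exact: lLj.
by move=> v; exact: sL.
Qed.

Lemma derive_lin_row x w : U x ->
  'D_w (fun y => L y (X y)) x = 'D_w (fun y => L y (X x)) x + L x ('D_w X x).
Proof.
move=> Ux; apply/rowP => j.
rewrite (derive_mxE oU _ _ _ smooth_lin_row)// mxE (derive_mxE oU)//.
by rewrite (@derive_lin (fun y v => L y v 0 j))// => [y|v]; [exact: lLj|exact: sL].
Qed.

End Vector.
End LinearFamily.

(** * Levi-Civita connection and curvature in a chart *)

Section LinearPred.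
Variables (R : realType) (V W : lmodType R) (f : V -> W).
Hypothesis lf : linear f.

(** Linearity is a hypothesis on a bare function instead of a bundled structure, because maps such
    as [christoffel g x u] are known to be linear only for [x] in the domain of the metric. *)
Lemma linear_predD u v : f (u + v) = f u + f v.
Proof. by have := lf 1 u v; rewrite !scale1r. Qed.

Lemma linear_pred0 : f 0 = 0.
Proof. by have := lf (-1) 0 0; rewrite !scaleN1r oppr0 addr0 addNr. Qed.

Lemma linear_predZ a u : f (a *: u) = a *: f u.
Proof. by have := lf a u 0; rewrite !addr0 linear_pred0 addr0. Qed.

Lemma linear_predN u : f (- u) = - f u.
Proof. by rewrite -scaleN1r linear_predZ scaleN1r. Qed.

Lemma linear_predB u v : f (u - v) = f u - f v.
Proof. by rewrite linear_predD linear_predN. Qed.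

Lemma linear_pred_sum (I : Type) (r : seq I) (P : pred I) (F : I -> V) :
  f (\sum_(i <- r | P i) F i) = \sum_(i <- r | P i) f (F i).
Proof.
elim: r => [|i r IH]; first by rewrite !big_nil linear_pred0.
by rewrite !big_cons; case: (P i); rewrite // linear_predD IH.
Qed.
End LinearPred.

Section LinearPredOps.
Variables (R : realType) (V W Z : lmodType R).

Lemma linear_pred_ext (f h : V -> W) : f =1 h -> linear f -> linear h.
Proof. by move=> fh lf a u v; rewrite -!fh lf. Qed.

Lemma linear_pred_add (f h : V -> W) : linear f -> linear h ->
  linear (fun u => f u + h u).
Proof. by move=> lf lh a u v; rewrite lf lh scalerDr addrACA. Qed.

Lemma linear_pred_opp (f : V -> W) : linear f -> linear (fun u => - f u).
Proof. by move=> lf a u v; rewrite lf opprD scalerN. Qed.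

Lemma linear_pred_sub (f h : V -> W) : linear f -> linear h ->
  linear (fun u => f u - h u).
Proof. by move=> lf lh; apply: linear_pred_add => //; exact: linear_pred_opp. Qed.

Lemma linear_pred_comp (f : W -> Z) (h : V -> W) : linear f -> linear h ->
  linear (fun u => f (h u)).
Proof. by move=> lf lh a u v; rewrite lh lf. Qed.
End LinearPredOps.

Section InnerProduct.
Variables (R : realType) (m : nat) (G : 'M[R]_m).
Implicit Types u v : 'rV[R]_m.

Lemma ip_linl v : linear (fun u => ip G u v).
Proof. by move=> a u w; rewrite /ip !mulmxDl -!scalemxAl !mxE. Qed.

Lemma ip_linr u : linear (ip G u).
Proof. by move=> a v w; rewrite /ip linearD linearZ/= mulmxDr -scalemxAr !mxE. Qed.

Lemma ipDl u v w : ip G (u + v) w = ip G u w + ip G v w.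
Proof. exact: (linear_predD (ip_linl w)). Qed.

Lemma ipDr u v w : ip G w (u + v) = ip G w u + ip G w v.
Proof. exact: (linear_predD (ip_linr w)). Qed.

Lemma ipNl u w : ip G (- u) w = - ip G u w.
Proof. exact: (linear_predN (ip_linl w)). Qed.

Lemma ipNr u w : ip G w (- u) = - ip G w u.
Proof. exact: (linear_predN (ip_linr w)). Qed.

Lemma ipZl a u w : ip G (a *: u) w = a * ip G u w.
Proof. exact: (linear_predZ (ip_linl w)). Qed.

Lemma ipZr a u w : ip G w (a *: u) = a * ip G w u.
Proof. exact: (linear_predZ (ip_linr w)). Qed.

Lemma ip0l w : ip G 0 w = 0.
Proof. exact: (linear_pred0 (ip_linl w)). Qed.

Definition ipE := (ipDl, ipDr, ipNl, ipNr, ipZl, ipZr).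

Lemma ip_ei i j : ip G (ei R i) (ei R j) = G i j.
Proof. by rewrite /ip -rowE trmx_delta -colE !mxE. Qed.

Lemma ipC u v : G^T = G -> ip G u v = ip G v u.
Proof.
move=> GT; rewrite /ip.
have -> : (u *m G *m v^T) 0 0 = (u *m G *m v^T)^T 0 0 by rewrite [RHS]mxE.
by rewrite !trmx_mul trmxK GT mulmxA.
Qed.

Hypothesis posG : forall u, u != 0 -> 0 < ip G u u.

Lemma posdef_unitmx : G \in unitmx.
Proof.
rewrite -row_free_unit; apply: inj_row_free => v vG; apply/eqP.
apply: contraT => /posG; rewrite /ip vG mul0mx mxE ltxx //.
Qed.

Lemma ip_inj u v : (forall w, ip G u w = ip G v w) -> u = v.
Proof.
move=> uv; apply/eqP; rewrite -subr_eq0; apply: contraT => /posG.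
by rewrite ipDl ipNl uv subrr ltxx.
Qed.
End InnerProduct.

Lemma row_addE (R : realType) p (A B : 'rV[R]_p) i j : (A + B) i j = A i j + B i j.
Proof. by rewrite mxE. Qed.

Lemma row_oppE (R : realType) p (A : 'rV[R]_p) i j : (- A) i j = - A i j.
Proof. by rewrite mxE. Qed.

Lemma row_scaleE (R : realType) p a (A : 'rV[R]_p) i j : (a *: A) i j = a * A i j.
Proof. by rewrite mxE. Qed.

Lemma row_zeroE (R : realType) p i j : (0 : 'rV[R]_p) i j = 0.
Proof. by rewrite mxE. Qed.

Definition rowopE := (row_addE, row_oppE, row_scaleE, row_zeroE).

(* The atoms are generalized first: otherwise unification unfolds them. *)
Ltac row_ring :=
  repeat match goal with
  | |- context[@derive ?R ?V ?W ?f ?x ?v] => generalize (@derive R V W f x v)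
  | |- context[@christoffel ?R ?m ?g ?x ?u ?v] => generalize (@christoffel R m g x u v)
  | |- context[@Rm_at ?R ?m ?g ?x ?u ?v ?w] => generalize (@Rm_at R m g x u v w)
  | |- context[@covd_Rm_at ?R ?m ?g ?x ?t ?u ?v ?w] =>
      generalize (@covd_Rm_at R m g x t u v w)
  end;
  intros; apply/rowP => ?; rewrite !rowopE; ring.

Section LinearFamilyDerivative.
Variables (R : realType) (m p : nat) (U : set 'rV[R]_m).
Hypothesis oU : open U.

Lemma derive_fam_linear (L : 'rV[R]_m -> 'rV[R]_p -> R) x w :
  (forall y, U y -> linear (L y)) -> (forall v, smooth_on U (fun y => L y v)) ->
  U x -> linear (fun v => 'D_w (fun y => L y v) x).
Proof.
move=> lL sL Ux a u v.
rewrite (derive_eq_on oU (g := fun y => a * L y u + L y v))//; last first.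
  by move=> y Uy; rewrite lL.
have du u' : derivable (fun y => L y u') x w by exact: (smooth_derivable oU (sL u') Ux).
by rewrite deriveD; [rewrite deriveZ|exact: derivableZ|exact: du].
Qed.

Lemma derive_fam_linear_row q (L : 'rV[R]_m -> 'rV[R]_p -> 'rV[R]_q) x w :
  (forall y, U y -> linear (L y)) -> (forall v, smooth_mx U (fun y => L y v)) ->
  U x -> linear (fun v => 'D_w (fun y => L y v) x).
Proof.
move=> lL sL Ux a u v.
rewrite (derive_eq_on oU (g := fun y => a *: L y u + L y v))//; last first.
  by move=> y Uy; rewrite lL.
have du u' : derivable (fun y => L y u') x w by exact: (smooth_mx_derivable oU (sL u') Ux).
by rewrite deriveD; [rewrite deriveZ|exact: derivableZ|exact: du].
Qed.

Section Bilinear.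
Variable q : nat.
Variables (X : 'rV[R]_m -> 'rV[R]_p) (Y : 'rV[R]_m -> 'rV[R]_q).
Hypotheses (sX : smooth_mx U X) (sY : smooth_mx U Y).

Lemma smooth_bilin (B : 'rV[R]_m -> 'rV[R]_p -> 'rV[R]_q -> R) :
  (forall y v, U y -> linear (fun u => B y u v)) ->
  (forall y u, U y -> linear (B y u)) ->
  (forall u v, smooth_on U (fun y => B y u v)) ->
  smooth_on U (fun y => B y (X y) (Y y)).
Proof.
move=> l1 l2 sB; apply: (smooth_lin oU sX (L := fun y u => B y u (Y y))).
  by move=> y Uy; exact: l1.
by move=> u; apply: (smooth_lin oU sY (L := fun y v => B y u v)) => // y; exact: l2.
Qed.

Lemma derive_bilin (B : 'rV[R]_m -> 'rV[R]_p -> 'rV[R]_q -> R) x w :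
  (forall y v, U y -> linear (fun u => B y u v)) ->
  (forall y u, U y -> linear (B y u)) ->
  (forall u v, smooth_on U (fun y => B y u v)) -> U x ->
  'D_w (fun y => B y (X y) (Y y)) x =
  'D_w (fun y => B y (X x) (Y x)) x + B x ('D_w X x) (Y x) + B x (X x) ('D_w Y x).
Proof.
move=> l1 l2 sB Ux.
rewrite (derive_lin oU sX (L := fun y u => B y u (Y y)))//; last 2 first.
- by move=> y Uy; exact: l1.
- by move=> u; apply: (smooth_lin oU sY (L := fun y v => B y u v)) => // y; exact: l2.
rewrite (derive_lin oU sY (L := fun y v => B y (X x) v))//; last by move=> y; exact: l2.
by rewrite addrAC.
Qed.

Lemma smooth_bilin_row r (B : 'rV[R]_m -> 'rV[R]_p -> 'rV[R]_q -> 'rV[R]_r) :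
  (forall y v, U y -> linear (fun u => B y u v)) ->
  (forall y u, U y -> linear (B y u)) ->
  (forall u v, smooth_mx U (fun y => B y u v)) ->
  smooth_mx U (fun y => B y (X y) (Y y)).
Proof.
move=> l1 l2 sB; apply: (smooth_lin_row oU sX (L := fun y u => B y u (Y y))).
  by move=> y Uy; exact: l1.
by move=> u; apply: (smooth_lin_row oU sY (L := fun y v => B y u v)) => // y; exact: l2.
Qed.

Lemma derive_bilin_row r (B : 'rV[R]_m -> 'rV[R]_p -> 'rV[R]_q -> 'rV[R]_r) x w :
  (forall y v, U y -> linear (fun u => B y u v)) ->
  (forall y u, U y -> linear (B y u)) ->
  (forall u v, smooth_mx U (fun y => B y u v)) -> U x ->
  'D_w (fun y => B y (X y) (Y y)) x =
  'D_w (fun y => B y (X x) (Y x)) x + B x ('D_w X x) (Y x) + B x (X x) ('D_w Y x).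
Proof.
move=> l1 l2 sB Ux.
rewrite (derive_lin_row oU sX (L := fun y u => B y u (Y y)))//; last 2 first.
- by move=> y Uy; exact: l1.
- by move=> u; apply: (smooth_lin_row oU sY (L := fun y v => B y u v)) => // y; exact: l2.
rewrite (derive_lin_row oU sY (L := fun y v => B y (X x) v))//; last by move=> y; exact: l2.
by rewrite addrAC.
Qed.
End Bilinear.
End LinearFamilyDerivative.

(** It serves both for the ambient metric in a chart and for the induced metric on the hypersurface,
    so that connection and curvature are studied once. *)
Record metric_on (R : realType) (m : nat) (W : set 'rV[R]_m)
    (g : 'rV[R]_m -> 'M[R]_m) : Prop := MetricOn {
  metric_open : open W;
  metric_smooth : smooth_mx W g;
  metric_sym : forall x, W x -> (g x)^T = g x;
  metric_pos : forall x u, W x -> u != 0 -> 0 < ip (g x) u u }.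

Section LeviCivita.
Variables (R : realType) (m : nat) (W : set 'rV[R]_m) (g : 'rV[R]_m -> 'M[R]_m).
Hypothesis hg : metric_on W g.
Let oW := metric_open hg.
Let sg := metric_smooth hg.
Let symg := metric_sym hg.
Let posg := metric_pos hg.
Implicit Types (x u v w z t : 'rV[R]_m).

Lemma smooth_ip u v : smooth_on W (fun y => ip (g y) u v).
Proof.
apply: (smooth_mulmx oW (smooth_mulmx oW (smooth_mx_cst oW u) sg)
  (smooth_mx_cst oW v^T)).
Qed.

Lemma derive_ip_linl x w v : W x -> linear (fun u => 'D_w (fun y => ip (g y) u v) x).
Proof.
move=> Wx; apply: (derive_fam_linear oW (L := fun y u => ip (g y) u v)) => //.
- by move=> y _; exact: ip_linl.
- by move=> u; exact: smooth_ip.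
Qed.

Lemma derive_ip_linr x w u : W x -> linear (fun v => 'D_w (fun y => ip (g y) u v) x).
Proof.
move=> Wx; apply: (derive_fam_linear oW (L := fun y v => ip (g y) u v)) => //.
- by move=> y _; exact: ip_linr.
- by move=> v; exact: smooth_ip.
Qed.

(** [christoffel] imposes the Koszul formula on basis vectors [z] only. The right-hand side is
    linear in [z], also in the direction of differentiation since the metric is differentiable, so
    the formula extends to all [z]. *)
Lemma koszul x u v z : W x -> ip (g x) (christoffel g x u v) z =
  2^-1 * ('D_u (fun y => ip (g y) v z) x + 'D_v (fun y => ip (g y) u z) x
          - 'D_z (fun y => ip (g y) u v) x).
Proof.
move=> Wx; rewrite /ip /christoffel mulmxKV; last exact: (posdef_unitmx (fun u => posg Wx)).
set K := fun z => 2^-1 * ('D_u (fun y => ip (g y) v z) x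
  + 'D_v (fun y => ip (g y) u z) x - 'D_z (fun y => ip (g y) u v) x).
have lK : linear K.
  move=> a w w'; rewrite /K (derive_ip_linr u v Wx) (derive_ip_linr v u Wx).
  rewrite (derive_dir_linear oW (smooth_ip u v) Wx).
  by rewrite /GRing.scale/=; ring.
rewrite -[RHS]/(K z) (lin_rowE z lK) mxE; apply: eq_bigr => k _.
by rewrite !mxE mulrC.
Qed.

Lemma christoffelC x u v : W x -> christoffel g x u v = christoffel g x v u.
Proof.
move=> Wx; apply: (ip_inj (fun u => posg Wx)) => z; rewrite !koszul//.
rewrite (derive_eq_on oW (f := fun y => ip (g y) u v) (g := fun y => ip (g y) v u))//.
  by ring.
by move=> y Wy; rewrite ipC// symg.
Qed.

Lemma christoffel_linr x u : W x -> linear (christoffel g x u).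
Proof.
move=> Wx a v w; apply: (ip_inj (fun u => posg Wx)) => z.
rewrite ipDl ipZl !koszul//.
rewrite (derive_ip_linl u z Wx) (derive_ip_linr z u Wx).
rewrite (derive_dir_linear oW (smooth_ip u z) Wx).
by rewrite /GRing.scale/=; ring.
Qed.

Lemma christoffel_linl x v : W x -> linear (fun u => christoffel g x u v).
Proof.
move=> Wx a u w; rewrite christoffelC// (christoffel_linr v Wx).
by rewrite !(christoffelC v).
Qed.

Lemma smooth_christoffel u v : smooth_mx W (fun y => christoffel g y u v).
Proof.
apply: (smooth_mulmx oW); last first.
  by apply: smooth_invmx => // y Wy; exact: (posdef_unitmx (fun u => posg Wy)).
move=> i k; rewrite (_ : (fun y => _) = fun y => 2^-1 * ('D_u (fun y => ip (g y) v (ei R k)) y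
   + 'D_v (fun y => ip (g y) u (ei R k)) y - 'D_(ei R k) (fun y => ip (g y) u v) y)).
  apply: (smoothM oW); first exact: smooth_cst.
  apply: (smoothB oW); last exact/smooth_derive/smooth_ip.
  by apply: (smoothD oW); exact/smooth_derive/smooth_ip.
by apply/funext => y; rewrite mxE.
Qed.

Lemma metric_compat_cst x w u v : W x -> 'D_w (fun y => ip (g y) u v) x =
  ip (g x) (christoffel g x w u) v + ip (g x) u (christoffel g x w v).
Proof.
move=> Wx; rewrite (ipC u _ (symg Wx)) !koszul//.
rewrite (derive_eq_on oW (f := fun y => ip (g y) v u) (g := fun y => ip (g y) u v))//.
  by field.
by move=> y Wy; rewrite ipC// symg.
Qed.

End LeviCivita.

(** * The curvature tensor, its covariant derivative and its symmetries *)

Section Curvature.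
Variables (R : realType) (m : nat) (W : set 'rV[R]_m) (g : 'rV[R]_m -> 'M[R]_m).
Hypothesis hg : metric_on W g.
Let oW := metric_open hg.
Let symg := metric_sym hg.
Let posg := metric_pos hg.
Implicit Types (x u v w z t : 'rV[R]_m) (X Y Z : 'rV[R]_m -> 'rV[R]_m).
Local Notation Gam := (christoffel g).

Lemma chrDr x u v w : W x -> Gam x w (u + v) = Gam x w u + Gam x w v.
Proof. by move=> Wx; exact: (linear_predD (christoffel_linr hg w Wx)). Qed.

Lemma chrBl x u v w : W x -> Gam x (u - v) w = Gam x u w - Gam x v w.
Proof. by move=> Wx; exact: (linear_predB (christoffel_linl hg w Wx)). Qed.

Lemma chr0l x w : W x -> Gam x 0 w = 0.
Proof. by move=> Wx; exact: (linear_pred0 (christoffel_linl hg w Wx)). Qed.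

Lemma smooth_chr X Y : smooth_mx W X -> smooth_mx W Y ->
  smooth_mx W (fun y => Gam y (X y) (Y y)).
Proof.
move=> sX sY; apply: (smooth_bilin_row oW sX sY (B := Gam)).
- by move=> y v Wy; exact: (christoffel_linl hg).
- by move=> y v Wy; exact: (christoffel_linr hg).
- by move=> u v; exact: smooth_christoffel hg u v.
Qed.

Lemma derive_chr X Y x t : smooth_mx W X -> smooth_mx W Y -> W x ->
  'D_t (fun y => Gam y (X y) (Y y)) x =
  'D_t (fun y => Gam y (X x) (Y x)) x + Gam x ('D_t X x) (Y x) + Gam x (X x) ('D_t Y x).
Proof.
move=> sX sY; apply: (derive_bilin_row oW sX sY (B := Gam)).
- by move=> y v Wy; exact: (christoffel_linl hg).
- by move=> y v Wy; exact: (christoffel_linr hg).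
- by move=> u v; exact: smooth_christoffel hg u v.
Qed.

Lemma covd_cst u v : covd g (cst u) (cst v) = fun y => Gam y u v.
Proof. by apply/funext => y; rewrite /covd derive_cst add0r. Qed.

Lemma Rm_atE x u v w : W x -> Rm_at g x u v w =
  'D_u (fun y => Gam y v w) x + Gam x u (Gam x v w)
  - 'D_v (fun y => Gam y u w) x - Gam x v (Gam x u w).
Proof.
move=> Wx; rewrite /Rm_at /Rm.
have -> : covd g (cst v) (cst w) = fun y => Gam y v w := covd_cst v w.
have -> : covd g (cst u) (cst w) = fun y => Gam y u w := covd_cst u w.
have -> : covd g (bracket (cst u) (cst v)) (cst w) x = 0.
  have E : bracket (cst u) (cst v) x = 0 by rewrite /bracket !derive_cst subr0.
  by rewrite /covd derive_cst E add0r chr0l.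
by rewrite subr0 {1}/covd {1}/covd opprD addrA.
Qed.

Lemma smooth_derive_along X Z : smooth_mx W X -> smooth_mx W Z ->
  smooth_mx W (fun y => 'D_(X y) Z y).
Proof.
move=> sX sZ; apply: (smooth_lin_row oW sX (L := fun y v => 'D_v Z y)).
  by move=> y; exact: (derive_dir_linear_row oW sZ).
by move=> v; exact: smooth_mx_derive.
Qed.

Lemma covd_covd X Y Z x : smooth_mx W X -> smooth_mx W Y -> smooth_mx W Z -> W x ->
  covd g X (covd g Y Z) x =
  'D_(X x) ('D_(Y x) Z) x + 'D_('D_(X x) Y x) Z x
  + ('D_(X x) (fun y => Gam y (Y x) (Z x)) x + Gam x ('D_(X x) Y x) (Z x)
     + Gam x (Y x) ('D_(X x) Z x))
  + Gam x (X x) ('D_(Y x) Z x + Gam x (Y x) (Z x)).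
Proof.
move=> sX sY sZ Wx; rewrite {1}/covd; congr (_ + _).
rewrite /covd (derive_mxD oW)//; [|exact: smooth_derive_along|exact: smooth_chr].
rewrite derive_chr//; congr (_ + _).
apply: (derive_lin_row oW sY (L := fun y v => 'D_v Z y)) => //.
  by move=> y; exact: (derive_dir_linear_row oW sZ).
by move=> v; exact: smooth_mx_derive.
Qed.

(** [covd_Rm] feeds the non-constant fields y -> Gam y t u into [Rm], so evaluating it requires
    tensoriality. Second derivatives of [Z] cancel by Schwarz, and derivatives of [X] and [Y] cancel
    against the bracket. *)
Lemma Rm_tensorial X Y Z x : smooth_mx W X -> smooth_mx W Y -> smooth_mx W Z ->
  W x -> Rm g X Y Z x = Rm_at g x (X x) (Y x) (Z x).
Proof.
move=> sX sY sZ Wx; rewrite Rm_atE// /Rm !covd_covd// {1}/covd/bracket.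
rewrite (linear_predB (derive_dir_linear_row oW sZ Wx)) !chrDr// chrBl//.
move: (schwarz_mx oW (X x) (Y x) sZ Wx).
generalize (christoffel g) => G0 ->; row_ring.
Qed.

Lemma covd_Rm_atE x t u v w : W x -> covd_Rm_at g x t u v w =
  'D_t (fun y => Rm_at g y u v w) x + Gam x t (Rm_at g x u v w)
  - Rm_at g x (Gam x t u) v w - Rm_at g x u (Gam x t v) w
  - Rm_at g x u v (Gam x t w).
Proof.
move=> Wx; rewrite /covd_Rm_at /covd_Rm !covd_cst.
have sG a : smooth_mx W (fun y => Gam y t a) by exact: smooth_christoffel hg t a.
by rewrite !Rm_tensorial//; exact: smooth_mx_cst.
Qed.

Lemma smooth_Rm_at u v w : smooth_mx W (fun y => Rm_at g y u v w).
Proof.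
apply: (smooth_mx_eq oW (X := fun y => 'D_u (fun y => Gam y v w) y + Gam y u (Gam y v w)
  - 'D_v (fun y => Gam y u w) y - Gam y v (Gam y u w))).
  by move=> y Wy; rewrite Rm_atE.
have sc a b : smooth_mx W (fun y => Gam y a b) by exact: smooth_christoffel hg a b.
have scc a b c : smooth_mx W (fun y => Gam y a (Gam y b c)).
  by apply: smooth_chr => //; exact: smooth_mx_cst.
apply: (smooth_mxB oW) => //; apply: (smooth_mxB oW); last exact: smooth_mx_derive.
by apply: (smooth_mxD oW) => //; exact: smooth_mx_derive.
Qed.

Lemma Rm_at_anti x u v w : W x -> Rm_at g x u v w = - Rm_at g x v u w.
Proof. by move=> Wx; rewrite !Rm_atE//; row_ring. Qed.

Lemma derive_chr_linr x t u : W x -> linear (fun v => 'D_t (fun y => Gam y u v) x).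
Proof.
move=> Wx; apply: (derive_fam_linear_row oW (L := fun y v => Gam y u v)) => //.
- by move=> y Wy; exact: (christoffel_linr hg).
- by move=> v; exact: smooth_christoffel hg u v.
Qed.

Lemma derive_chr_linl x t v : W x -> linear (fun u => 'D_t (fun y => Gam y u v) x).
Proof.
move=> Wx; apply: (derive_fam_linear_row oW (L := fun y u => Gam y u v)) => //.
- by move=> y Wy; exact: (christoffel_linl hg).
- by move=> u; exact: smooth_christoffel hg u v.
Qed.

Lemma Rm_at_lin3 x u v : W x -> linear (Rm_at g x u v).
Proof.
move=> Wx; have lG b := christoffel_linr hg b Wx.
apply: (linear_pred_ext (fun w => esym (Rm_atE u v w Wx))).
apply: linear_pred_sub; last exact: (linear_pred_comp (lG v) (lG u)).
apply: linear_pred_sub; last exact: derive_chr_linr.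
apply: linear_pred_add; first exact: derive_chr_linr.
exact: (linear_pred_comp (lG u) (lG v)).
Qed.

Lemma Rm_at_lin1 x v w : W x -> linear (fun u => Rm_at g x u v w).
Proof.
move=> Wx; have lG b := christoffel_linl hg b Wx.
apply: (linear_pred_ext (fun u => esym (Rm_atE u v w Wx))).
apply: linear_pred_sub; last exact: (linear_pred_comp (christoffel_linr hg v Wx) (lG w)).
apply: linear_pred_sub; last exact: derive_chr_linl.
apply: linear_pred_add; last exact: lG.
exact: (derive_dir_linear_row oW (smooth_christoffel hg v w) Wx).
Qed.

Lemma Rm_at_lin2 x u w : W x -> linear (fun v => Rm_at g x u v w).
Proof.
move=> Wx; apply: (linear_pred_ext (fun v => esym (Rm_at_anti u v w Wx))).
exact/linear_pred_opp/Rm_at_lin1.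
Qed.

(** Since the connection is torsion free, every term of the cyclic sum occurs twice with opposite
    signs. *)
Lemma Rm_at_bianchi x u v w : W x ->
  Rm_at g x u v w + Rm_at g x v w u + Rm_at g x w u v = 0.
Proof.
move=> Wx; rewrite !Rm_atE//.
have S t a b : 'D_t (fun y => Gam y a b) x = 'D_t (fun y => Gam y b a) x.
  by apply: (derive_eq_on oW _ _ Wx) => y Wy; exact: (christoffelC hg).
have C a b : Gam x a b = Gam x b a by exact: (christoffelC hg a b Wx).
move: S C; generalize (christoffel g) => G0 S C.
rewrite (C w v) (C w u) (C v u) (S u w v) (S v w u) (S w v u); row_ring.
Qed.

(** The second derivatives of <w, z> along [u] and [v] commute. Expanded by metric compatibility,
    the terms symmetric in [u] and [v] cancel, and what remains is the two curvature terms. *)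
Lemma Rm_at_skew x u v w z : W x ->
  ip (g x) (Rm_at g x u v w) z = - ip (g x) w (Rm_at g x u v z).
Proof.
move=> Wx; rewrite !Rm_atE//.
have sG b c : smooth_mx W (fun y => Gam y b c) by exact: (smooth_christoffel hg b c).
have mc a b c y : W y -> 'D_a (fun y => ip (g y) b c) y =
    ip (g y) (Gam y a b) c + ip (g y) b (Gam y a c).
  by move=> Wy; exact: (metric_compat_cst hg a b c Wy).
move: sG mc; generalize (christoffel g) => G0 sG mc.
have D a b c d : 'D_a (fun y => ip (g y) (G0 y b c) d) x =
    ip (g x) (G0 x a (G0 x b c)) d + ip (g x) (G0 x b c) (G0 x a d)
    + ip (g x) ('D_a (fun y => G0 y b c) x) d.
  rewrite (derive_lin oW (sG b c) (L := fun y u => ip (g y) u d))//.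
  - by rewrite mc.
  - by move=> y _; exact: ip_linl.
  - by move=> e; exact: (smooth_ip hg e d).
have S b c d : smooth_on W (fun y => ip (g y) (G0 y b c) d).
  apply: (smooth_lin oW (sG b c) (L := fun y u => ip (g y) u d)).
  - by move=> y _; exact: ip_linl.
  - by move=> e; exact: (smooth_ip hg e d).
have E a b : 'D_a ('D_b (fun y => ip (g y) w z)) x =
    (ip (g x) ('D_a (fun y => G0 y b w) x + G0 x a (G0 x b w)) z
     + ip (g x) ('D_a (fun y => G0 y b z) x + G0 x a (G0 x b z)) w)
    + (ip (g x) (G0 x b w) (G0 x a z) + ip (g x) (G0 x b z) (G0 x a w)).
  rewrite (derive_eq_on oW (g := fun y =>
    ip (g y) (G0 y b w) z + ip (g y) (G0 y b z) w))//; last first.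
    by move=> y Wy; rewrite mc// (ipC w _ (symg Wy)).
  have dS c d : derivable (fun y => ip (g y) (G0 y b c) d) x a.
    exact: (smooth_derivable oW (S b c d) Wx).
  rewrite (deriveD (dS w z) (dS z w)) (D a b w z) (D a b z w) !ipDl; ring.
move: (etrans (esym (E u v)) (etrans (schwarz oW u v (smooth_ip hg w z) Wx) (E v u))).
rewrite (ipC w _ (symg Wx)); clear -Wx symg.
move: (G0 x u (G0 x v w)) (G0 x u (G0 x v z)) (G0 x v (G0 x u w)) (G0 x v (G0 x u z)).
move: ('D_u _ x) ('D_u _ x) ('D_v _ x) ('D_v _ x).
move: (G0 x u w) (G0 x u z) (G0 x v w) (G0 x v z) => a1 a2 a3 a4 b1 b2 b3 b4 c1 c2 c3 c4.
rewrite !ipDl !ipNl (ipC a3 a2 (symg Wx)) (ipC a4 a1 (symg Wx)); lra.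
Qed.

End Curvature.

(** * Connection along a map *)

Section Pullback.
Variables (R : realType) (k m : nat).
Variables (W : set 'rV[R]_m) (g : 'rV[R]_m -> 'M[R]_m).
Hypothesis hg : metric_on W g.
Variables (U : set 'rV[R]_k) (F : 'rV[R]_k -> 'rV[R]_m).
Hypothesis oU : open U.
Hypothesis sF : smooth_mx U F.
Hypothesis UW : forall x, U x -> W (F x).
Let oW := metric_open hg.
Implicit Types (x t : 'rV[R]_k) (A B C : 'rV[R]_k -> 'rV[R]_m).
Local Notation Gam := (christoffel g).
Local Notation dF t x := ('D_t F x).

(** The covariant derivative of a field along [F]: [A] is defined on the source and need not come
    from a field on the target, as with the unit normal and the vectors ['D_v F]. *)
Definition cvd u (A : 'rV[R]_k -> 'rV[R]_m) : 'rV[R]_k -> 'rV[R]_m :=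
  fun y => 'D_u A y + Gam (F y) ('D_u F y) (A y).

Lemma smooth_mx_comp p q (f : 'rV[R]_m -> 'M[R]_(p, q)) :
  smooth_mx W f -> smooth_mx U (fun y => f (F y)).
Proof.
by move=> sf i j; exact: (smooth_comp oU oW UW sF (sf i j)).
Qed.

Lemma derive_comp_scalar (f : 'rV[R]_m -> R) x t : smooth_on W f -> U x ->
  'D_t (fun y => f (F y)) x = 'D_(dF t x) f (F x).
Proof.
move=> sf Ux; exact: (derive_compE t (row_differentiable oU sF Ux)
  (smooth_differentiable oW sf (UW Ux))).
Qed.

Lemma derive_comp_row p (f : 'rV[R]_m -> 'rV[R]_p) x t : smooth_mx W f -> U x ->
  'D_t (fun y => f (F y)) x = 'D_(dF t x) f (F x).
Proof.
move=> sf Ux; exact: (derive_compE t (row_differentiable oU sF Ux)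
  (row_differentiable oW sf (UW Ux))).
Qed.

Section Bilinear.
Variables (p q r : nat) (A : 'rV[R]_k -> 'rV[R]_p) (B : 'rV[R]_k -> 'rV[R]_q).
Hypotheses (sA : smooth_mx U A) (sB : smooth_mx U B).

Lemma smooth_pb_bilin (L : 'rV[R]_m -> 'rV[R]_p -> 'rV[R]_q -> R) :
  (forall z b, W z -> linear (fun a => L z a b)) ->
  (forall z a, W z -> linear (L z a)) ->
  (forall a b, smooth_on W (fun z => L z a b)) ->
  smooth_on U (fun y => L (F y) (A y) (B y)).
Proof.
move=> l1 l2 sL; apply: (smooth_bilin oU sA sB (B := fun y => L (F y))).
- by move=> y b Uy; apply: l1; exact: UW.
- by move=> y a Uy; apply: l2; exact: UW.
- by move=> a b; exact: (smooth_comp oU oW UW sF (sL a b)).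
Qed.

Lemma derive_pb_bilin (L : 'rV[R]_m -> 'rV[R]_p -> 'rV[R]_q -> R) x t :
  (forall z b, W z -> linear (fun a => L z a b)) ->
  (forall z a, W z -> linear (L z a)) ->
  (forall a b, smooth_on W (fun z => L z a b)) -> U x ->
  'D_t (fun y => L (F y) (A y) (B y)) x =
  'D_('D_t F x) (fun z => L z (A x) (B x)) (F x)
  + L (F x) ('D_t A x) (B x) + L (F x) (A x) ('D_t B x).
Proof.
move=> l1 l2 sL Ux; rewrite (derive_bilin oU sA sB (B := fun y => L (F y))).
- by rewrite (derive_comp_scalar _ (sL (A x) (B x)) Ux).
- by move=> y b Uy; apply: l1; exact: UW.
- by move=> y a Uy; apply: l2; exact: UW.
- by move=> a b; exact: (smooth_comp oU oW UW sF (sL a b)).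
- exact: Ux.
Qed.

Lemma smooth_pb_bilin_row (L : 'rV[R]_m -> 'rV[R]_p -> 'rV[R]_q -> 'rV[R]_r) :
  (forall z b, W z -> linear (fun a => L z a b)) ->
  (forall z a, W z -> linear (L z a)) ->
  (forall a b, smooth_mx W (fun z => L z a b)) ->
  smooth_mx U (fun y => L (F y) (A y) (B y)).
Proof.
move=> l1 l2 sL; apply: (smooth_bilin_row oU sA sB (B := fun y => L (F y))).
- by move=> y b Uy; apply: l1; exact: UW.
- by move=> y a Uy; apply: l2; exact: UW.
- by move=> a b; exact: (smooth_mx_comp (sL a b)).
Qed.

Lemma derive_pb_bilin_row (L : 'rV[R]_m -> 'rV[R]_p -> 'rV[R]_q -> 'rV[R]_r) x t :
  (forall z b, W z -> linear (fun a => L z a b)) ->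
  (forall z a, W z -> linear (L z a)) ->
  (forall a b, smooth_mx W (fun z => L z a b)) -> U x ->
  'D_t (fun y => L (F y) (A y) (B y)) x =
  'D_('D_t F x) (fun z => L z (A x) (B x)) (F x)
  + L (F x) ('D_t A x) (B x) + L (F x) (A x) ('D_t B x).
Proof.
move=> l1 l2 sL Ux; rewrite (derive_bilin_row oU sA sB (B := fun y => L (F y))).
- by rewrite (derive_comp_row _ (sL (A x) (B x)) Ux).
- by move=> y b Uy; apply: l1; exact: UW.
- by move=> y a Uy; apply: l2; exact: UW.
- by move=> a b; exact: (smooth_mx_comp (sL a b)).
- exact: Ux.
Qed.
End Bilinear.

Section Trilinear.
Variables (p : nat) (A B C : 'rV[R]_k -> 'rV[R]_m).
Hypotheses (sA : smooth_mx U A) (sB : smooth_mx U B) (sC : smooth_mx U C).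
Variable L : 'rV[R]_m -> 'rV[R]_m -> 'rV[R]_m -> 'rV[R]_m -> 'rV[R]_p.
Hypotheses (l1 : forall z b c, W z -> linear (fun a => L z a b c))
  (l2 : forall z a c, W z -> linear (fun b => L z a b c))
  (l3 : forall z a b, W z -> linear (L z a b))
  (sL : forall a b c, smooth_mx W (fun z => L z a b c)).

Let s23 a : smooth_mx U (fun y => L (F y) a (B y) (C y)).
Proof.
by apply: (smooth_pb_bilin_row sB sC (L := fun z b c => L z a b c)) => [z c|z b|b c];
  [exact: l2|exact: l3|exact: sL].
Qed.

Lemma smooth_pb_trilin : smooth_mx U (fun y => L (F y) (A y) (B y) (C y)).
Proof.
apply: (smooth_lin_row oU sA (L := fun y a => L (F y) a (B y) (C y))); last exact: s23.
by move=> y Uy; apply: l1; exact: UW.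
Qed.

Lemma derive_pb_trilin x t : U x ->
  'D_t (fun y => L (F y) (A y) (B y) (C y)) x =
  'D_('D_t F x) (fun z => L z (A x) (B x) (C x)) (F x)
  + L (F x) ('D_t A x) (B x) (C x) + L (F x) (A x) ('D_t B x) (C x)
  + L (F x) (A x) (B x) ('D_t C x).
Proof.
move=> Ux; rewrite (derive_lin_row oU sA (L := fun y a => L (F y) a (B y) (C y))).
- rewrite (derive_pb_bilin_row sB sC (L := fun z b c => L z (A x) b c)).
  + by rewrite -!addrA; congr (_ + _); rewrite addrA addrC.
  + by move=> z c; exact: l2.
  + by move=> z b; exact: l3.
  + by move=> b c; exact: sL.
  + exact: Ux.
- by move=> y Uy; apply: l1; exact: UW.
- exact: s23.
- exact: Ux.
Qed.
End Trilinear.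

Lemma smooth_pb_chr A B : smooth_mx U A -> smooth_mx U B ->
  smooth_mx U (fun y => Gam (F y) (A y) (B y)).
Proof.
move=> sA sB; exact: (smooth_pb_bilin_row sA sB
  (fun z b Wz => christoffel_linl hg b Wz) (fun z a Wz => christoffel_linr hg a Wz)
  (smooth_christoffel hg)).
Qed.

Lemma derive_pb_chr A B x t : smooth_mx U A -> smooth_mx U B -> U x ->
  'D_t (fun y => Gam (F y) (A y) (B y)) x =
  'D_(dF t x) (fun z => Gam z (A x) (B x)) (F x)
  + Gam (F x) ('D_t A x) (B x) + Gam (F x) (A x) ('D_t B x).
Proof.
move=> sA sB Ux; exact: (derive_pb_bilin_row sA sB t
  (fun z b Wz => christoffel_linl hg b Wz) (fun z a Wz => christoffel_linr hg a Wz)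
  (smooth_christoffel hg) Ux).
Qed.

Lemma smooth_cvd u A : smooth_mx U A -> smooth_mx U (cvd u A).
Proof.
move=> sA; apply: (smooth_mxD oU); first exact: smooth_mx_derive.
by apply: smooth_pb_chr => //; exact: smooth_mx_derive.
Qed.

Lemma smooth_pb_ip A B : smooth_mx U A -> smooth_mx U B ->
  smooth_on U (fun y => ip (g (F y)) (A y) (B y)).
Proof.
move=> sA sB; exact: (smooth_pb_bilin sA sB (L := fun z => ip (g z))
  (fun z b _ => ip_linl (g z) b) (fun z a _ => ip_linr (g z) a) (smooth_ip hg)).
Qed.

Lemma cvd_ip A B x t : smooth_mx U A -> smooth_mx U B -> U x ->
  'D_t (fun y => ip (g (F y)) (A y) (B y)) x =
  ip (g (F x)) (cvd t A x) (B x) + ip (g (F x)) (A x) (cvd t B x).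
Proof.
move=> sA sB Ux.
rewrite (derive_pb_bilin sA sB t (L := fun z => ip (g z))
  (fun z b _ => ip_linl (g z) b) (fun z a _ => ip_linr (g z) a) (smooth_ip hg) Ux).
rewrite (metric_compat_cst hg _ _ _ (UW Ux)) /cvd ipDl ipDr.
generalize (christoffel g (F x) (dF t x)) ('D_t A x) ('D_t B x) => G0 a b; ring.
Qed.

Lemma cvd_torsion u v x : U x -> cvd u ('D_v F) x = cvd v ('D_u F) x.
Proof.
move=> Ux; exact: (f_equal2 +%R (schwarz_mx oU u v sF Ux)
  (christoffelC hg ('D_u F x) ('D_v F x) (UW Ux))).
Qed.

(** The constant directions [u] and [v] commute, so there is no bracket term; the second derivatives
    of [A] and of [F] cancel by Schwarz. *)
Lemma cvd_curvature u v A x : smooth_mx U A -> U x ->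
  cvd u (cvd v A) x - cvd v (cvd u A) x = Rm_at g (F x) (dF u x) (dF v x) (A x).
Proof.
move=> sA Ux; have Wx := UW Ux.
have E a b : cvd a (cvd b A) x = 'D_a ('D_b A) x
    + ('D_(dF a x) (fun z => Gam z (dF b x) (A x)) (F x)
       + Gam (F x) ('D_a ('D_b F) x) (A x) + Gam (F x) (dF b x) ('D_a A x))
    + (Gam (F x) (dF a x) ('D_b A x) + Gam (F x) (dF a x) (Gam (F x) (dF b x) (A x))).
  have sb : smooth_mx U ('D_b F) by exact: smooth_mx_derive.
  rewrite -(derive_pb_chr a sb sA Ux) -(chrDr hg _ _ _ Wx).
  by rewrite -(derive_mxD oU _ (smooth_mx_derive oU b sA) (smooth_pb_chr sb sA) Ux).
rewrite (E u v) (E v u) (Rm_atE hg _ _ _ Wx).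
move: (schwarz_mx oU u v sA Ux) (schwarz_mx oU u v sF Ux).
generalize (christoffel g) => G0 -> ->; row_ring.
Qed.

Lemma smooth_pb_Rm A B C : smooth_mx U A -> smooth_mx U B -> smooth_mx U C ->
  smooth_mx U (fun y => Rm_at g (F y) (A y) (B y) (C y)).
Proof.
move=> sA sB sC; exact: (smooth_pb_trilin sA sB sC
  (fun z b c Wz => Rm_at_lin1 hg b c Wz) (fun z a c Wz => Rm_at_lin2 hg a c Wz)
  (fun z a b Wz => Rm_at_lin3 hg a b Wz) (smooth_Rm_at hg)).
Qed.

Lemma cvd_Rm t A B C x : smooth_mx U A -> smooth_mx U B -> smooth_mx U C -> U x ->
  cvd t (fun y => Rm_at g (F y) (A y) (B y) (C y)) x =
  covd_Rm_at g (F x) (dF t x) (A x) (B x) (C x)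
  + Rm_at g (F x) (cvd t A x) (B x) (C x)
  + Rm_at g (F x) (A x) (cvd t B x) (C x)
  + Rm_at g (F x) (A x) (B x) (cvd t C x).
Proof.
move=> sA sB sC Ux; have Wx := UW Ux; rewrite (covd_Rm_atE hg _ _ _ _ Wx) {1}/cvd.
rewrite (derive_pb_trilin sA sB sC
  (fun z b c Wz => Rm_at_lin1 hg b c Wz) (fun z a c Wz => Rm_at_lin2 hg a c Wz)
  (fun z a b Wz => Rm_at_lin3 hg a b Wz) (smooth_Rm_at hg) t Ux) /cvd.
have L1 := linear_predD (Rm_at_lin1 hg (B x) (C x) Wx).
have L2 := linear_predD (Rm_at_lin2 hg (A x) (C x) Wx).
have L3 := linear_predD (Rm_at_lin3 hg (A x) (B x) Wx).
move: L1 L2 L3; generalize ('D_t A x) ('D_t B x) ('D_t C x).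
generalize (Rm_at g (F x)) => Rx; generalize (christoffel g (F x) (dF t x)) => Gx.
generalize ('D_(dF t x) (fun z => Rm_at g z (A x) (B x) (C x)) (F x)) => D0 a b c L1 L2 L3.
rewrite L1 L2 L3; row_ring.
Qed.

End Pullback.

(** * Covariant derivatives of bilinear forms *)

Section BilinearForms.
Variables (R : realType) (n : nat) (U : set 'rV[R]_n) (G : 'rV[R]_n -> 'M[R]_n).
Hypothesis hG : metric_on U G.
Let oU := metric_open hG.
Let uG x (Ux : U x) := posdef_unitmx (fun u => metric_pos hG Ux).
Implicit Types (x y u v a b : 'rV[R]_n).
Local Notation Gam := (christoffel G).
Local Notation form := ('rV[R]_n -> 'rV[R]_n -> 'rV[R]_n -> R).

Record smooth_form (B : form) : Prop := SmoothForm {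
  form_linl : forall y v, U y -> linear (fun u => B y u v);
  form_linr : forall y u, U y -> linear (B y u);
  form_smooth : forall u v, smooth_on U (fun y => B y u v) }.

Definition covb (B : form) a : form := fun y u v =>
  'D_a (fun z => B z u v) y - B y (Gam y a u) v - B y u (Gam y a v).

Lemma smooth_form_ap (B : form) X Y : smooth_form B -> smooth_mx U X -> smooth_mx U Y ->
  smooth_on U (fun y => B y (X y) (Y y)).
Proof.
by move=> sB sX sY; exact: (smooth_bilin oU sX sY (form_linl sB) (form_linr sB)
  (form_smooth sB)).
Qed.

Lemma derive_form_ap (B : form) X Y x a : smooth_form B -> smooth_mx U X ->
  smooth_mx U Y -> U x ->
  'D_a (fun y => B y (X y) (Y y)) x =
  'D_a (fun y => B y (X x) (Y x)) x + B x ('D_a X x) (Y x) + B x (X x) ('D_a Y x).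
Proof.
by move=> sB sX sY Ux; exact: (derive_bilin oU sX sY a (form_linl sB) (form_linr sB)
  (form_smooth sB) Ux).
Qed.

Lemma smooth_gam a u : smooth_mx U (fun y => Gam y a u).
Proof. exact: (smooth_christoffel hG a u). Qed.

Lemma smooth_covb (B : form) a : smooth_form B -> smooth_form (covb B a).
Proof.
move=> sB; have [lB rB ssB] := sB; split.
- move=> y v Uy; apply: linear_pred_sub; last exact: lB.
  apply: linear_pred_sub.
    by apply: (derive_fam_linear oU (L := fun y u => B y u v)) => // z; exact: lB.
  exact: (linear_pred_comp (lB y v Uy) (christoffel_linr hG a Uy)).
- move=> y u Uy; apply: linear_pred_sub; last first.
    exact: (linear_pred_comp (rB y u Uy) (christoffel_linr hG a Uy)).
  apply: linear_pred_sub; last exact: rB.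
  by apply: (derive_fam_linear oU (L := fun y v => B y u v)) => // z; exact: rB.
- move=> u v; apply: (smoothB oU); last first.
    by apply: smooth_form_ap => //; [exact: smooth_mx_cst|exact: smooth_gam].
  apply: (smoothB oU); first exact: smooth_derive.
  by apply: smooth_form_ap => //; [exact: smooth_gam|exact: smooth_mx_cst].
Qed.

Lemma covb_sym (B : form) a x u v : (forall y u v, U y -> B y u v = B y v u) -> U x ->
  covb B a x u v = covb B a x v u.
Proof.
move=> BB Ux; rewrite /covb; generalize (christoffel G) => G0.
rewrite (BB x (G0 x a u) v Ux) (BB x u (G0 x a v) Ux).
rewrite (derive_eq_on oU _ (fun y Uy => BB y u v Uy) Ux).
by rewrite addrAC.
Qed.

Lemma covb_metric a x u v : U x -> covb (fun y => ip (G y)) a x u v = 0.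
Proof.
move=> Ux; rewrite /covb (metric_compat_cst hG _ _ _ Ux) -addrA -opprD subrr //.
Qed.

(* The two directions of differentiation come before the arguments of [B]. *)
Definition covb2 (B : form) a b : form := fun y u v =>
  covb (covb B b) a y u v - covb B (Gam y a b) y u v.

Lemma covb2_sym (B : form) a b x u v : (forall y u v, U y -> B y u v = B y v u) ->
  U x -> covb2 B a b x u v = covb2 B a b x v u.
Proof.
move=> BB Ux; exact: (f_equal2 (fun p q => p - q)
  (covb_sym a u v (fun y u v Uy => covb_sym b u v BB Uy) Ux)
  (covb_sym (Gam x a b) u v BB Ux)).
Qed.

Lemma ricci_identity (B : form) x a b u v : smooth_form B -> U x ->
  covb2 B a b x u v - covb2 B b a x u v =
  - B x (Rm_at G x a b u) v - B x u (Rm_at G x a b v).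
Proof.
move=> sB Ux; have [lB rB ssB] := sB.
rewrite /covb2 (christoffelC hG b a Ux).
(* For arbitrary directions, the sums in parentheses are symmetric in [c] and [d] and drop out of
   the commutator. The remaining derivatives of Christoffel terms and their quadratic companions
   assemble into the curvature. *)
have E c d : covb (covb B d) c x u v =
    'D_c ('D_d (fun y => B y u v)) x
    - ('D_c (fun y => B y (Gam x d u) v) x + 'D_d (fun y => B y (Gam x c u) v) x)
    - ('D_c (fun y => B y u (Gam x d v)) x + 'D_d (fun y => B y u (Gam x c v)) x)
    - B x ('D_c (fun y => Gam y d u) x) v - B x u ('D_c (fun y => Gam y d v) x)
    + B x (Gam x d (Gam x c u)) v + B x u (Gam x d (Gam x c v))
    + (B x (Gam x c u) (Gam x d v) + B x (Gam x d u) (Gam x c v)).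
  rewrite {1}/covb.
  have -> : 'D_c (fun z => covb B d z u v) x =
    'D_c ('D_d (fun y => B y u v)) x
    - ('D_c (fun y => B y (Gam x d u) v) x + B x ('D_c (fun y => Gam y d u) x) v)
    - ('D_c (fun y => B y u (Gam x d v)) x + B x u ('D_c (fun y => Gam y d v) x)).
    have sc w : smooth_mx U (cst w : 'rV[R]_n -> 'rV[R]_n) by exact: smooth_mx_cst.
    have s1 : smooth_on U (fun y => B y (Gam y d u) v).
      by apply: (smooth_form_ap sB _ (sc v)); exact: smooth_gam.
    have s2 : smooth_on U (fun y => B y u (Gam y d v)).
      by apply: (smooth_form_ap sB (sc u)); exact: smooth_gam.
    have d0 := smooth_derivable oU (v := c) (smooth_derive oU d (ssB u v)) Ux.
    have d1 := smooth_derivable oU (v := c) s1 Ux.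
    have d2 := smooth_derivable oU (v := c) s2 Ux.
    rewrite /covb (deriveB (derivableB d0 d1) d2) (deriveB d0 d1).
    rewrite (derive_form_ap c sB (smooth_gam d u) (sc v) Ux).
    rewrite (derive_form_ap c sB (sc u) (smooth_gam d v) Ux) !derive_cst.
    by rewrite (linear_pred0 (rB x _ Ux)) (linear_pred0 (lB x _ Ux)) !addr0.
  rewrite /covb; clear; generalize (christoffel G) => G0.
  move: ('D_c _ x) ('D_c _ x) ('D_c _ x) ('D_d _ x) ('D_d _ x) => d1 d2 d3 d4 d5.
  ring.
rewrite (E a b) (E b a) (Rm_atE hG _ _ _ Ux) (Rm_atE hG _ _ _ Ux).
rewrite !(linear_predB (lB x v Ux)) !(linear_predD (lB x v Ux)).
rewrite !(linear_predB (rB x u Ux)) !(linear_predD (rB x u Ux)).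
rewrite (schwarz oU a b (ssB u v) Ux).
clear; generalize (christoffel G) => G0.
move: ('D_b ('D_a _) x) ('D_a _ x) ('D_a _ x) ('D_a _ x) ('D_a _ x).
move: ('D_b _ x) ('D_b _ x) ('D_b _ x) ('D_b _ x) => *.
ring.
Qed.

Definition form_mx (B : form) y : 'M[R]_n := \matrix_(i, j) B y (ei R i) (ei R j).

Lemma smooth_form_mx (B : form) : smooth_form B -> smooth_mx U (form_mx B).
Proof.
move=> sB i j; apply: (smooth_on_eq oU _ (form_smooth sB (ei R i) (ei R j))) => y _.
by rewrite mxE.
Qed.

Lemma form_mx_metric y : form_mx (fun y => ip (G y)) y = G y.
Proof. by apply/matrixP => i j; rewrite mxE ip_ei. Qed.

(** Row i is the derivative of the i-th coordinate field, so that covariant differentiation of a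
    form with matrix B reads DB - C B - B C^T. *)
Definition chr_mx a y : 'M[R]_n := \matrix_(i, j) Gam y a (ei R i) 0 j.

Lemma form_mx_covb (B : form) a x : smooth_form B -> U x ->
  form_mx (covb B a) x =
  'D_a (form_mx B) x - chr_mx a x *m form_mx B x - form_mx B x *m (chr_mx a x)^T.
Proof.
move=> sB Ux; apply/matrixP => i j; rewrite mxE /covb.
rewrite [in RHS]mxE [in X in _ = X + _]mxE; congr (_ + _ + _).
- rewrite (derive_mxE oU _ _ _ (smooth_form_mx sB) Ux).
  by apply: (derive_eq_on oU _ _ Ux) => y _; rewrite mxE.
- rewrite !mxE (lin_rowE (Gam x a (ei R i)) (form_linl sB (ei R j) Ux)).
  by congr (- _); apply: eq_bigr => k _; rewrite !mxE.
- rewrite !mxE (lin_rowE (Gam x a (ei R j)) (form_linr sB (ei R i) Ux)).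
  by congr (- _); apply: eq_bigr => k _; rewrite !mxE mulrC.
Qed.

(** The Hilbert-Schmidt product of symmetric forms. Written with matrices it makes sense and can be
    differentiated at every point of [U] without a choice of frame; [pairing_frame] gives its value
    in a frame. *)
Definition pairing (B B' : form) y : R :=
  \tr (form_mx B y *m invmx (G y) *m form_mx B' y *m invmx (G y)).

Lemma smooth_form_metric : smooth_form (fun y => ip (G y)).
Proof.
by split=> [y v _|y u _|u v]; [exact: ip_linl|exact: ip_linr|exact: (smooth_ip hG)].
Qed.

Lemma derive_metric_mx a x : U x ->
  'D_a G x = chr_mx a x *m G x + G x *m (chr_mx a x)^T.
Proof.
move=> Ux; have := form_mx_covb a smooth_form_metric Ux; rewrite (form_mx_metric x).
have -> : form_mx (covb (fun y => ip (G y)) a) x = 0.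
  by apply/matrixP => i j; rewrite !mxE covb_metric.
rewrite (_ : form_mx (fun y => ip (G y)) = G); last first.
  by apply/funext => y; exact: form_mx_metric.
by move/eqP; rewrite eq_sym -addrA -opprD subr_eq0 => /eqP.
Qed.

Lemma derive_pairing (B B' : form) a x : smooth_form B -> smooth_form B' -> U x ->
  'D_a (pairing B B') x = pairing (covb B a) B' x + pairing B (covb B' a) x.
Proof.
move=> sB sB' Ux; have sI := smooth_invmx oU uG (metric_smooth hG).
have sb := smooth_form_mx sB; have sb' := smooth_form_mx sB'.
rewrite /pairing (derive_mxtrace oU); last exact: Ux; last first.
  by do 3!apply: (smooth_mulmx oU) => //.
rewrite (derive_mulmx oU _ (smooth_mulmx oU (smooth_mulmx oU sb sI) sb') sI Ux).
rewrite (derive_mulmx oU _ (smooth_mulmx oU sb sI) sb' Ux).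
rewrite (derive_mulmx oU _ sb sI Ux).
rewrite (derive_invmx oU _ uG (metric_smooth hG) Ux) (derive_metric_mx a Ux).
rewrite !form_mx_covb//.
have IG := mulVmx (uG Ux); have GI := mulmxV (uG Ux).
move: IG GI ('D_a (form_mx B) x) ('D_a (form_mx B') x).
move: (form_mx B x) (form_mx B' x) (chr_mx a x) => b b' C; move: (invmx (G x)) => I.
move: (G x) => G0 IG GI db db'.
(* The metric being parallel, the derivative of G^-1 is -(G^-1 C + C^T G^-1), and these terms cancel
   the connection terms of the two forms under the trace. *)
have -> : I *m (C *m G0 + G0 *m C^T) *m I = I *m C + C^T *m I.
  by rewrite mulmxDr mulmxDl !mulmxA IG mul1mx -[in X in X + _]mulmxA GI mulmx1.
rewrite !(mulmxDl, mulmxDr, mulmxBl, mulmxBr, mulmxN, mulNmx, opprD).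
have trN M : \tr (- M : 'M[R]_n) = - \tr M by exact: linearN.
rewrite !mxtraceD !trN.
rewrite -!mulmxA (mxtrace_mulC C) -!mulmxA.
move: (\tr _) (\tr _) (\tr _) (\tr _) (\tr _) (\tr _) => *.
ring.
Qed.

Lemma pairingC (B B' : form) y : pairing B B' y = pairing B' B y.
Proof. by rewrite /pairing -mulmxA mxtrace_mulC !mulmxA. Qed.

Definition form_trace (B : form) y : R := \tr (form_mx B y *m invmx (G y)).

Lemma form_traceE (B : form) y : U y -> form_trace B y = pairing B (fun y => ip (G y)) y.
Proof.
move=> Uy; rewrite /pairing form_mx_metric /form_trace; congr (\tr (_ *m _)).
by rewrite -(mulmxA _ _ (G y)) mulVmx ?uG// mulmx1.
Qed.

(** The trace is the pairing with the metric, whose covariant derivative vanishes. *)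
Lemma derive_form_trace (B : form) a x : smooth_form B -> U x ->
  'D_a (form_trace B) x = form_trace (covb B a) x.
Proof.
move=> sB Ux; rewrite (derive_eq_on oU _ (fun y Uy => form_traceE B Uy) Ux).
rewrite (derive_pairing a sB smooth_form_metric Ux) -(form_traceE _ Ux) /pairing.
have -> : form_mx (covb (fun y => ip (G y)) a) x = 0.
  by apply/matrixP => i j; rewrite !mxE covb_metric.
by rewrite mulmx0 mul0mx mxtrace0 addr0.
Qed.

Lemma covb_trace0 (B : form) a x (c : R) : smooth_form B ->
  (forall y, U y -> form_trace B y = c) -> U x -> form_trace (covb B a) x = 0.
Proof.
move=> sB tc Ux; rewrite -derive_form_trace//.
by rewrite (derive_eq_on oU (g := fun=> c) _ tc Ux) derive_cst.
Qed.

(** * Traces and pairings in an orthonormal frame *)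

Section Frame.
Variables (x : 'rV[R]_n) (e : 'I_n -> 'rV[R]_n).
Hypothesis Ux : U x.
Hypothesis eON : orthonormal_basis G x e.
Let E : 'M[R]_n := \matrix_i e i.

Lemma frame_form (S : 'M[R]_n) i j : (E *m S *m E^T) i j = ip S (e i) (e j).
Proof.
rewrite /ip -[in RHS](rowK e i) -[in RHS](rowK e j) -/E tr_row -row_mul.
rewrite [LHS]mxE [RHS]mxE; apply: eq_bigr => k _.
by rewrite [X in _ = X * _]mxE [X in _ = _ * X]mxE.
Qed.

Lemma frame_orthonormal : E *m G x *m E^T = 1%:M.
Proof. by apply/matrixP => i j; rewrite frame_form eON mxE. Qed.

(** Orthonormality reads E G E^T = 1 for the matrix E with rows [e i]; inverting it turns every
    occurrence of G^-1 under a trace into a sum over the frame. *)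
Lemma invmx_frame : invmx (G x) = E^T *m E.
Proof.
have uE : E *m G x \in unitmx by case/mulmx1_unit: frame_orthonormal.
have EGE := mulmx1C frame_orthonormal.
by rewrite -[RHS]mulmx1 -(mulmxV (uG Ux)) !mulmxA -[E^T *m E *m _]mulmxA EGE mul1mx.
Qed.

Lemma frame_expand w : w = \sum_j ip (G x) w (e j) *: e j.
Proof.
rewrite -[LHS](mulmxK (uG Ux)) invmx_frame mulmxA.
rewrite mulmx_sum_row; apply: eq_bigr => j _; rewrite rowK; congr (_ *: _).
by rewrite /ip mxE [RHS]mxE; apply: eq_bigr => k _; rewrite !mxE.
Qed.

Lemma tr_frame (S : 'M[R]_n) : \tr (S *m invmx (G x)) = \sum_i ip S (e i) (e i).
Proof.
rewrite invmx_frame mulmxA mxtrace_mulC mulmxA.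
by apply: eq_bigr => i _; rewrite frame_form.
Qed.

Lemma form_mx_ip (B : form) u v : smooth_form B -> ip (form_mx B x) u v = B x u v.
Proof.
move=> sB; rewrite (lin_rowE u (ip_linl _ v)) (lin_rowE u (form_linl sB v Ux)).
apply: eq_bigr => i _; congr (_ *: _).
rewrite (lin_rowE v (ip_linr _ _)) (lin_rowE v (form_linr sB _ Ux)).
by apply: eq_bigr => j _; rewrite ip_ei mxE.
Qed.

Lemma pairing_frame (B B' : form) : smooth_form B -> smooth_form B' ->
  pairing B B' x = \sum_i \sum_j B x (e i) (e j) * B' x (e j) (e i).
Proof.
move=> sB sB'; rewrite /pairing invmx_frame !mulmxA mxtrace_mulC !mulmxA.
have -> : E *m form_mx B x *m E^T *m E *m form_mx B' x *m E^T =
    (E *m form_mx B x *m E^T) *m (E *m form_mx B' x *m E^T) by rewrite !mulmxA.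
apply: eq_bigr => i _; rewrite mxE; apply: eq_bigr => j _.
by rewrite !frame_form !form_mx_ip.
Qed.

Lemma form_trace_frame (B : form) : smooth_form B ->
  form_trace B x = \sum_i B x (e i) (e i).
Proof.
by move=> sB; rewrite /form_trace tr_frame; apply: eq_bigr => i _; rewrite form_mx_ip.
Qed.

End Frame.

End BilinearForms.

(** * The equations of Gauss, Codazzi and Weingarten *)

Lemma derive_ip_chr (R : realType) m (W : set 'rV[R]_m) g (hg : metric_on W g)
    (x a b c d : 'rV[R]_m) : W x ->
  'D_a (fun y => ip (g y) (christoffel g y b c) d) x =
  ip (g x) ('D_a (fun y => christoffel g y b c) x
            + christoffel g x a (christoffel g x b c)) d
  + ip (g x) (christoffel g x b c) (christoffel g x a d).
Proof.
move=> Wx.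
rewrite (derive_lin (metric_open hg) (smooth_christoffel hg b c)
  (L := fun y u => ip (g y) u d)).
- rewrite (metric_compat_cst hg _ _ _ Wx) ipDl.
  by rewrite addrC addrA.
- by move=> y _; exact: ip_linl.
- by move=> e; exact: (smooth_ip hg e d).
- exact: Wx.
Qed.

(** The local data in one pair of charts; [chart_hypersurface_on] extracts it from a global
    immersion with unit normal. *)
Record hypersurface_on (R : realType) (n : nat) (W : set 'rV[R]_n.+1)
    (g : 'rV[R]_n.+1 -> 'M[R]_n.+1) (U : set 'rV[R]_n)
    (F nu : 'rV[R]_n -> 'rV[R]_n.+1) : Prop := HypersurfaceOn {
  hyp_metric : metric_on W g;
  hyp_open : open U;
  hyp_smooth : smooth_mx U F;
  hyp_maps : forall x, U x -> W (F x);
  hyp_immersion : forall x (u : 'rV[R]_n), U x -> u != 0 -> 'D_u F x != 0;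
  hyp_normal_smooth : smooth_mx U nu;
  hyp_unit : forall x, U x -> ip (g (F x)) (nu x) (nu x) = 1;
  hyp_normal : forall x (u : 'rV[R]_n), U x -> ip (g (F x)) ('D_u F x) (nu x) = 0 }.

Section Hypersurface.
Variables (R : realType) (n : nat).
Variables (W : set 'rV[R]_n.+1) (g : 'rV[R]_n.+1 -> 'M[R]_n.+1).
Variables (U : set 'rV[R]_n) (F nu : 'rV[R]_n -> 'rV[R]_n.+1).
Hypothesis hS : hypersurface_on W g U F nu.
Let hg := hyp_metric hS.
Let oU := hyp_open hS.
Let sF := hyp_smooth hS.
Let UW := hyp_maps hS.
Let imm := hyp_immersion hS.
Let snu := hyp_normal_smooth hS.
Let nu1 := hyp_unit hS.
Let nuF := hyp_normal hS.
Let posg x (Ux : U x) := fun u => @metric_pos _ _ _ _ hg (F x) u (UW Ux).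
Let symg x (Ux : U x) := metric_sym hg (UW Ux).
Let G := induced_metric g F.
Implicit Types (x u v w z a : 'rV[R]_n).
Local Notation cvd := (cvd g F).
Local Notation Gam := (christoffel G).

Lemma ip_induced x u v : U x -> ip (G x) u v = ip (g (F x)) ('D_u F x) ('D_v F x).
Proof.
move=> Ux; have ldF := derive_dir_linear_row oU sF Ux.
have l1 (w : 'rV[R]_n.+1) := linear_pred_comp (ip_linl (g (F x)) w) ldF.
have l2 (w : 'rV[R]_n.+1) := linear_pred_comp (ip_linr (g (F x)) w) ldF.
rewrite (lin_rowE u (ip_linl _ v)) (lin_rowE u (l1 ('D_v F x))).
apply: eq_bigr => i _; congr (_ *: _).
rewrite (lin_rowE v (ip_linr _ _)) (lin_rowE v (l2 _)).
by apply: eq_bigr => j _; rewrite ip_ei mxE.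
Qed.

Lemma induced_metric_on : metric_on U G.
Proof.
split=> //.
- move=> i j; apply: (smooth_on_eq oU (f := fun y =>
    ip (g (F y)) ('D_(ei R i) F y) ('D_(ei R j) F y))).
    by move=> y _; rewrite mxE.
  by apply: (smooth_pb_ip hg oU sF UW); exact: smooth_mx_derive.
- by move=> x Ux; apply/matrixP => i j; rewrite mxE [LHS]mxE [RHS]mxE; exact: (ipC _ _ (symg Ux)).
- by move=> x u Ux u0; rewrite ip_induced//; exact/(posg Ux)/imm.
Qed.

Let hG := induced_metric_on.

(** The rows [nu x] and ['D_(ei R i) F x] form a square matrix. In a vanishing combination the
    coefficient of the normal is zero by pairing with [nu x], and the tangential ones by the
    immersion property, so the matrix is invertible. *)
Lemma tangent_normal_span x X : U x -> exists u (c : R), X = 'D_u F x + c *: nu x.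
Proof.
move=> Ux; pose J : 'M[R]_(n, n.+1) := \matrix_(i, j) 'D_(ei R i) F x 0 j.
pose B : 'M[R]_(1 + n) := col_mx (nu x) J.
have JE u : u *m J = 'D_u F x.
  rewrite [RHS](lin_rowE u (derive_dir_linear_row oU sF Ux)); apply/rowP => j.
  by rewrite mxE summxE; apply: eq_bigr => i _; rewrite !mxE.
have BE c : c *m B = 'D_(rsubmx c) F x + c 0 0 *: nu x.
  rewrite -{1}(hsubmxK c) mul_row_col JE addrC; congr (_ + _).
  rewrite [lsubmx c]mx11_scalar mul_scalar_mx; congr (_ *: _).
  by rewrite mxE; congr (c _ _); exact: val_inj.
have uB : B \in unitmx.
  rewrite -row_free_unit; apply: inj_row_free => c; rewrite BE => E.
  have c0 : c 0 0 = 0.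
    have := congr1 (fun X => ip (g (F x)) X (nu x)) E.
    by rewrite /= ipDl ipZl nuF// nu1// ip0l add0r mulr1.
  have c'0 : rsubmx c = 0.
    apply/eqP; apply: contraT => /(imm Ux).
    by move: E; rewrite c0 scale0r addr0 => ->; rewrite eqxx.
  rewrite -(hsubmxK c) c'0 [lsubmx c]mx11_scalar mxE.
  rewrite (_ : lshift n 0 = 0); last exact: val_inj.
  by rewrite c0 raddf0 row_mx0.
exists (rsubmx (X *m invmx B : 'rV_(1 + n))), ((X *m invmx B) 0 0).
by rewrite -(BE (X *m invmx B)) mulmxKV.
Qed.

Lemma tangent_normal_inj x X Y : U x ->
  (forall u, ip (g (F x)) X ('D_u F x) = ip (g (F x)) Y ('D_u F x)) ->
  ip (g (F x)) X (nu x) = ip (g (F x)) Y (nu x) -> X = Y.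
Proof.
move=> Ux XT XN; apply: (ip_inj (posg Ux)) => Z.
by have [u [c ->]] := tangent_normal_span Z Ux; rewrite !ipDr !ipZr XT XN.
Qed.

Definition sff : 'rV[R]_n -> 'rV[R]_n -> 'rV[R]_n -> R :=
  fun y u v => ip (g (F y)) (cvd u ('D_v F) y) (nu y).

Lemma second_form_mx : second_form g F nu = form_mx sff.
Proof. by apply/funext => y; apply/matrixP => i j; rewrite !mxE. Qed.

Lemma cvd_dir_linear (A : 'rV[R]_n -> 'rV[R]_n.+1) x : smooth_mx U A -> U x ->
  linear (fun u => cvd u A x).
Proof.
move=> sA Ux; apply: linear_pred_add.
  move=> a u v; have dA := row_differentiable oU sA Ux.
  by rewrite derive_dirD// derive_dirZ.
exact: (linear_pred_comp (christoffel_linl hg (A x) (UW Ux)) (derive_dir_linear_row oU sF Ux)).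
Qed.

Lemma sff_sym x u v : U x -> sff x u v = sff x v u.
Proof. by move=> Ux; rewrite /sff (cvd_torsion hg oU sF UW). Qed.

Lemma smooth_sff : smooth_form U sff.
Proof.
have l1 y v : U y -> linear (fun u => sff y u v).
  move=> Uy; apply: (linear_pred_comp (ip_linl (g (F y)) (nu y))).
  by apply: cvd_dir_linear => //; exact: smooth_mx_derive.
split; first exact: l1.
  by move=> y u Uy; apply: (linear_pred_ext (fun v => sff_sym v u Uy)); exact: (l1 y u Uy).
move=> u v; apply: (smooth_pb_ip hg oU sF UW _ snu).
by apply: (smooth_cvd hg oU sF UW); exact: smooth_mx_derive.
Qed.

(** The tangential part satisfies the Koszul formula of the induced metric: the trilinear quantity
    [k] is symmetric in its first two slots because the ambient connection has no torsion. *)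
Lemma cvd_dF_tangent x u v w : U x ->
  ip (g (F x)) (cvd u ('D_v F) x) ('D_w F x) = ip (G x) (Gam x u v) w.
Proof.
move=> Ux; rewrite (koszul hG _ _ _ Ux).
have sD b : smooth_mx U ('D_b F) by exact: smooth_mx_derive.
pose k a b c := ip (g (F x)) (cvd a ('D_b F) x) ('D_c F x).
have kC a b c : k a b c = k b a c by rewrite /k (cvd_torsion hg oU sF UW _ _ Ux).
have E a b c : 'D_a (fun y => ip (G y) b c) x = k a b c + k a c b.
  rewrite (derive_eq_on oU (g := fun y => ip (g (F y)) ('D_b F y) ('D_c F y)) _ _ Ux).
    by rewrite (cvd_ip hg oU sF UW _ (sD b) (sD c) Ux) (ipC ('D_b F x) _ (symg Ux)).
  by move=> y Uy; rewrite ip_induced.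
rewrite (E u v w) (E v u w) (E w u v) -[LHS]/(k u v w).
rewrite (kC v u w) (kC w u v) (kC w v u); move: (k u v w) (k u w v) (k v w u) => p q r.
by field.
Qed.

Lemma gauss_formula x u v : U x ->
  cvd u ('D_v F) x = 'D_(Gam x u v) F x + sff x u v *: nu x.
Proof.
move=> Ux; apply: (tangent_normal_inj Ux) => [w|].
  rewrite (cvd_dF_tangent u v w Ux) [RHS]ipDl ipZl (ipC (nu x) _ (symg Ux)).
  by rewrite (nuF w Ux) mulr0 addr0 (ip_induced _ _ Ux).
rewrite [RHS]ipDl ipZl (nuF _ Ux) (nu1 Ux) mulr1 add0r //.
Qed.

(** The shape operator applied to [u], obtained from the form [sff] by raising an index. *)
Definition shape_vec x u : 'rV[R]_n := (\row_j sff x u (ei R j)) *m invmx (G x).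

Lemma shape_vecP x u w : U x -> ip (G x) (shape_vec x u) w = sff x u w.
Proof.
move=> Ux; rewrite /ip /shape_vec mulmxKV; last first.
  exact: (posdef_unitmx (fun u => metric_pos hG Ux)).
rewrite (lin_rowE w (form_linr smooth_sff u Ux)) mxE; apply: eq_bigr => k _.
by rewrite !mxE mulrC.
Qed.

(** The Codazzi defect as a 3-tensor on the hypersurface. The point is the last argument, so that
    the function of the point can be differentiated. *)
Definition ncurv (u v w : 'rV[R]_n) y : R :=
  ip (g (F y)) (Rm_at g (F y) ('D_u F y) ('D_v F y) ('D_w F y)) (nu y).

(* The connections and the second fundamental form are kept abstract here, since
   unification would otherwise unfold them down to limits. *)
Section Abstract.
Variable cv : 'rV[R]_n -> ('rV[R]_n -> 'rV[R]_n.+1) -> 'rV[R]_n -> 'rV[R]_n.+1.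
Variables (Ga : 'rV[R]_n -> 'rV[R]_n -> 'rV[R]_n -> 'rV[R]_n).
Variable h : 'rV[R]_n -> 'rV[R]_n -> 'rV[R]_n -> R.
Hypotheses (cvE : cv = cvd) (GaE : Ga = Gam) (hE : h = sff).

Let sD b : smooth_mx U ('D_b F).
Proof. exact: smooth_mx_derive. Qed.

Let cv_ip A B x t : smooth_mx U A -> smooth_mx U B -> U x ->
  'D_t (fun y => ip (g (F y)) (A y) (B y)) x =
  ip (g (F x)) (cv t A x) (B x) + ip (g (F x)) (A x) (cv t B x).
Proof. by rewrite cvE; exact: (cvd_ip hg oU sF UW t). Qed.

Let scv u A : smooth_mx U A -> smooth_mx U (cv u A).
Proof. by rewrite cvE; exact: (smooth_cvd hg oU sF UW u). Qed.

Let cv_curvature u v A x : smooth_mx U A -> U x ->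
  cv u (cv v A) x - cv v (cv u A) x = Rm_at g (F x) ('D_u F x) ('D_v F x) (A x).
Proof. by rewrite cvE; exact: (cvd_curvature hg oU sF UW u v). Qed.

Let cv_Rm t A B C x : smooth_mx U A -> smooth_mx U B -> smooth_mx U C -> U x ->
  cv t (fun y => Rm_at g (F y) (A y) (B y) (C y)) x =
  covd_Rm_at g (F x) ('D_t F x) (A x) (B x) (C x)
  + Rm_at g (F x) (cv t A x) (B x) (C x)
  + Rm_at g (F x) (A x) (cv t B x) (C x)
  + Rm_at g (F x) (A x) (B x) (cv t C x).
Proof. by rewrite cvE; exact: (cvd_Rm hg oU sF UW t). Qed.

Let hP y u v : ip (g (F y)) (cv u ('D_v F) y) (nu y) = h y u v.
Proof. by rewrite hE cvE. Qed.

Let h_sym x u v : U x -> h x u v = h x v u.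
Proof. by rewrite hE; exact: sff_sym. Qed.

Let h_smooth : smooth_form U h.
Proof. by rewrite hE; exact: smooth_sff. Qed.

Let Ga_sym x u v : U x -> Ga x u v = Ga x v u.
Proof. by rewrite GaE; exact: (christoffelC hG). Qed.

Let gauss x u v : U x -> cv u ('D_v F) x = 'D_(Ga x u v) F x + h x u v *: nu x.
Proof. by rewrite cvE GaE hE; exact: gauss_formula. Qed.

Let gauss_tangent x u v w : U x ->
  ip (g (F x)) (cv u ('D_v F) x) ('D_w F x) = ip (G x) (Ga x u v) w.
Proof. by rewrite cvE GaE; exact: cvd_dF_tangent. Qed.

Let shP x u w : U x -> ip (G x) (shape_vec x u) w = h x u w.
Proof. by rewrite hE; exact: shape_vecP. Qed.

Let nuF' x u : U x -> ip (g (F x)) (nu x) ('D_u F x) = 0.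
Proof. by move=> Ux; rewrite (ipC _ _ (symg Ux)); exact: nuF. Qed.

Let dip_Ga x a b c d : U x -> 'D_a (fun y => ip (G y) (Ga y b c) d) x =
  ip (G x) ('D_a (fun y => Ga y b c) x + Ga x a (Ga x b c)) d
  + ip (G x) (Ga x b c) (Ga x a d).
Proof. by rewrite GaE; exact: (derive_ip_chr hG a b c d). Qed.

Let RmG x u v w : U x -> Rm_at G x u v w =
  'D_u (fun y => Ga y v w) x + Ga x u (Ga x v w)
  - 'D_v (fun y => Ga y u w) x - Ga x v (Ga x u w).
Proof. by rewrite GaE; exact: (Rm_atE hG). Qed.

(** Differentiating <nu, dF w> = 0 gives the tangential part of the derivative of [nu], and
    differentiating <nu, nu> = 1 shows that the normal part vanishes. *)
Lemma weingarten x u : U x -> cv u nu x = - 'D_(shape_vec x u) F x.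
Proof.
move=> Ux; apply: (tangent_normal_inj Ux) => [w|].
  have := cv_ip u snu (sD w) Ux.
  rewrite (derive_eq_on oU (g := fun=> (0 : R)) _ (fun y Uy => nuF' w Uy) Ux).
  rewrite derive_cst ipNl -(ip_induced _ _ Ux) (shP _ _ Ux).
  rewrite (ipC _ (cv u ('D_w F) x) (symg Ux)) hP.
  by move=> /esym/eqP; rewrite addr_eq0 => /eqP.
have := cv_ip u snu snu Ux.
rewrite (derive_eq_on oU (g := fun=> (1 : R)) _ nu1 Ux).
rewrite derive_cst ipNl (nuF _ Ux) oppr0 (ipC (nu x) _ (symg Ux)) => /esym/eqP.
by rewrite -mulr2n mulrn_eq0/= => /eqP.
Qed.

(** This and [cv2_tangent] split the second derivative of dF w into its two components.
    Antisymmetrized in [u] and [v], they become the Codazzi and the Gauss equation. *)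
Lemma cv2_normal x u v w : U x ->
  ip (g (F x)) (cv u (cv v ('D_w F)) x) (nu x) =
  'D_u (fun y => h y v w) x + h x u (Ga x v w).
Proof.
move=> Ux; have := cv_ip u (scv v (sD w)) snu Ux.
rewrite (derive_eq_on oU _ (fun y _ => hP y v w) Ux) => ->.
rewrite (weingarten u Ux) (gauss v w Ux) ipNr ipDl ipZl.
rewrite (nuF' _ Ux) mulr0 addr0 -(ip_induced _ _ Ux).
by rewrite (ipC _ (shape_vec x u) (metric_sym hG Ux)) (shP _ _ Ux) subrK.
Qed.

Lemma cv2_tangent x u v w z : U x ->
  ip (g (F x)) (cv u (cv v ('D_w F)) x) ('D_z F x) =
  ip (G x) ('D_u (fun y => Ga y v w) x + Ga x u (Ga x v w)) z
  - h x v w * h x u z.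
Proof.
move=> Ux; have := cv_ip u (scv v (sD w)) (sD z) Ux.
rewrite (derive_eq_on oU _ (fun y Uy => gauss_tangent v w z Uy) Ux).
rewrite (dip_Ga u v w z Ux) [in X in _ = _ + X](gauss v w Ux).
rewrite [X in _ = _ + X]ipDl ipZl (ipC _ (cv u _ x) (symg Ux)).
rewrite (gauss_tangent u z _ Ux) (ipC (nu x) _ (symg Ux)) hP.
rewrite (ipC (Ga x u z) _ (metric_sym hG Ux)).
move: ('D_u _ x + _) (cv u _ x) (ip (G x) (Ga x v w) _) => p q r E; lra.
Qed.

Lemma gauss_equation x u v w z : U x ->
  ip (g (F x)) (Rm_at g (F x) ('D_u F x) ('D_v F x) ('D_w F x)) ('D_z F x) =
  ip (G x) (Rm_at G x u v w) z - h x v w * h x u z + h x u w * h x v z.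
Proof.
move=> Ux; rewrite -(cv_curvature u v (sD w) Ux) ipDl ipNl.
rewrite (cv2_tangent u v w z Ux) (cv2_tangent v u w z Ux) (RmG _ _ _ Ux).
move: (Ga x u _) (Ga x v _) ('D_u _ x) ('D_v _ x) => a b c d.
rewrite !ipDl !ipNl; ring.
Qed.

Lemma codazzi x u v w : U x ->
  covb G h u x v w - covb G h v x u w = ncurv u v w x.
Proof.
move=> Ux; rewrite /ncurv -(cv_curvature u v (sD w) Ux) ipDl ipNl.
rewrite (cv2_normal u v w Ux) (cv2_normal v u w Ux) /covb -GaE.
rewrite (Ga_sym v u Ux) (h_sym u (Ga x v w) Ux) (h_sym v (Ga x u w) Ux).
move: ('D_u _ x) ('D_v _ x) => p q; ring.
Qed.

(** The left-hand side is the intrinsic covariant derivative of [ncurv]. By the Gauss formula,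
    differentiating an argument dF u leaves a multiple of [nu] besides its tangential part, and by
    Weingarten differentiating [nu] gives the last term. *)
Lemma derive_ncurv x a u v w : U x ->
  'D_a (ncurv u v w) x
  - ncurv (Ga x a u) v w x - ncurv u (Ga x a v) w x - ncurv u v (Ga x a w) x =
  ip (g (F x)) (covd_Rm_at g (F x) ('D_a F x) ('D_u F x) ('D_v F x) ('D_w F x)) (nu x)
  + h x a u * ip (g (F x)) (Rm_at g (F x) (nu x) ('D_v F x) ('D_w F x)) (nu x)
  + h x a v * ip (g (F x)) (Rm_at g (F x) ('D_u F x) (nu x) ('D_w F x)) (nu x)
  + h x a w * ip (g (F x)) (Rm_at g (F x) ('D_u F x) ('D_v F x) (nu x)) (nu x)
  - ip (g (F x)) (Rm_at g (F x) ('D_u F x) ('D_v F x) ('D_w F x)) ('D_(shape_vec x a) F x).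
Proof.
move=> Ux; have Wx := UW Ux.
have sR := smooth_pb_Rm hg oU sF UW (sD u) (sD v) (sD w).
have dE := cv_ip a sR snu Ux.
rewrite (cv_Rm a (sD u) (sD v) (sD w) Ux) (weingarten _ Ux) in dE.
rewrite (gauss a u Ux) (gauss a v Ux) (gauss a w Ux) in dE.
move: dE; rewrite -[(fun y => ip _ _ _)]/(ncurv u v w) => ->.
rewrite /ncurv.
move: (Rm_at_lin1 hg ('D_v F x) ('D_w F x) Wx).
move: (Rm_at_lin2 hg ('D_u F x) ('D_w F x) Wx).
move: (Rm_at_lin3 hg ('D_u F x) ('D_v F x) Wx).
move: (h x a u) (h x a v) (h x a w).
move: (covd_Rm_at _ _ _ _ _ _) => cR.
move: ('D_(Ga x a u) F x) ('D_(Ga x a v) F x) ('D_(Ga x a w) F x).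
move: ('D_(shape_vec x a) F x).
move: ('D_u F x) ('D_v F x) ('D_w F x) => Xu Xv Xw Xs Yu Yv Yw cu cv' cw.
generalize (Rm_at g (F x)) => Rx l3 l2 l1.
rewrite (linear_predD l1) (linear_predD l2) (linear_predD l3).
rewrite (linear_predZ l1) (linear_predZ l2) (linear_predZ l3).
rewrite !ipDl !ipZl ipNr; ring.
Qed.

(** The Codazzi equation differentiated on constant vectors; the Christoffel corrections on the
    right are the Codazzi equation again, with one argument replaced. *)
Lemma codazzi_derive x a u v w : U x ->
  covb2 G h a u x v w - covb2 G h a v x u w =
  'D_a (ncurv u v w) x
  - ncurv (Ga x a u) v w x - ncurv u (Ga x a v) w x - ncurv u v (Ga x a w) x.
Proof.
move=> Ux.
have sT b c d : smooth_on U (fun y => covb G h b y c d).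
  exact: (form_smooth (smooth_covb hG b h_smooth)).
rewrite -(codazzi (Ga x a u) v w Ux) -(codazzi u (Ga x a v) w Ux).
rewrite -(codazzi u v (Ga x a w) Ux).
rewrite -(derive_eq_on oU _ (fun y Uy => codazzi u v w Uy) Ux).
rewrite (deriveB (smooth_derivable oU (v := a) (sT u v w) Ux)
  (smooth_derivable oU (v := a) (sT v u w) Ux)).
rewrite /covb2 -GaE; have cE B b : covb G B b x = fun u v =>
  'D_b (fun z => B z u v) x - B x (Ga x b u) v - B x u (Ga x b v) by rewrite GaE.
rewrite (cE (covb G h u)) (cE (covb G h v)).
move: (covb G h) => T; move: ('D_a _ x) ('D_a _ x) => p q; ring.
Qed.

End Abstract.

End Hypersurface.

(** * Simultaneous diagonalization *)

Section Spectral.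
Variable R : realType.

(** The first-order condition at a maximum of the Rayleigh quotient. *)
Lemma quadratic_ge0_lin0 (b q : R) : 0 <= q ->
  (forall t : R, 0 <= t * b *+ 2 + t ^+ 2 * q) -> b = 0.
Proof.
move=> q0 H; have q1 : 0 < q + 1 by rewrite ltr_wpDl.
(* Nearly the minimizer -b/q; adding 1 to the denominator admits q = 0. *)
have := H (- b / (q + 1)).
have -> : - b / (q + 1) * b *+ 2 + (- b / (q + 1)) ^+ 2 * q =
    - (b ^+ 2 * ((q + 2) / (q + 1) ^+ 2)).
  by rewrite mulr2n; field; rewrite gt_eqF.
rewrite oppr_ge0 pmulr_lle0; last by rewrite divr_gt0// ?exprn_gt0// ltr_wpDl.
by move=> b2; apply/eqP; rewrite -sqrf_eq0 eq_le b2 sqr_ge0.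
Qed.

Lemma ip1_ge0 n (u : 'rV[R]_n) : 0 <= ip 1%:M u u.
Proof. by rewrite /ip mulmx1 mxE; apply: sumr_ge0 => i _; rewrite mxE -expr2 sqr_ge0. Qed.

Lemma ip1_entry n (u : 'rV[R]_n) i : (u 0 i) ^+ 2 <= ip 1%:M u u.
Proof.
rewrite /ip mulmx1 mxE (bigD1 i)//= mxE -expr2 lerDl.
by apply: sumr_ge0 => j _; rewrite mxE -expr2 sqr_ge0.
Qed.

Lemma ip1_eq0 n (u : 'rV[R]_n) : ip 1%:M u u = 0 -> u = 0.
Proof.
move=> u0; apply/rowP => i; rewrite mxE; apply/eqP; rewrite -sqrf_eq0 eq_le sqr_ge0.
by rewrite andbT -u0 ip1_entry.
Qed.

Lemma continuous_ip n (A : 'M[R]_n) : continuous (fun u : 'rV[R]_n => ip A u u).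
Proof.
have -> : (fun u : 'rV[R]_n => ip A u u) =
    fun u => \sum_j \sum_i (u 0 i * u 0 j) * A i j.
  apply/funext => u; rewrite /ip mxE; apply: eq_bigr => j _.
  by rewrite mxE mulr_suml; apply: eq_bigr => i _; rewrite [_^T _ _]mxE mulrAC.
move=> x; apply: continuous_sum => j _; apply: continuous_sum => i _.
have ci (l : 'I_n) : {for x, continuous (fun u : 'rV[R]_n => u 0 l)}.
  exact: coord_continuous.
exact: (continuousM (continuousM (ci i) (ci j)) (@cst_continuous _ _ (A i j) x)).
Qed.

Lemma sphere_compact n : compact [set u : 'rV[R]_n | ip 1%:M u u = 1].
Proof.
apply: bounded_closed_compact.
  exists 1; split => // M M1 u /= u1; apply/norm_rowP; first by rewrite (le_trans ler01) ?ltW.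
  move=> j; apply: le_trans (ltW M1).
  rewrite -(@ler_pXn2r _ 2) ?nnegrE// expr1n -normrX ger0_norm ?sqr_ge0//.
  by rewrite -u1 ip1_entry.
apply: (@closed_comp _ _ (fun u : 'rV[R]_n => ip 1%:M u u) [set 1]); last exact: closed_eq.
by move=> u _; exact: continuous_ip.
Qed.

(** A maximizer of the quadratic form on the compact unit sphere is an eigenvector, its eigenvalue
    being the maximum. *)
Lemma symmetric_eigenvector n (A : 'M[R]_n.+1) : A^T = A ->
  exists (v : 'rV[R]_n.+1) (l : R), ip 1%:M v v = 1 /\ v *m A = l *: v.
Proof.
move=> symA; have sym1 : (1%:M : 'M[R]_n.+1)^T = 1%:M by rewrite trmx1.
have [||c cS cmax] := @EVT_max_rV R n.+1 (fun u => ip A u u) _ _ (@sphere_compact n.+1).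
- by exists (ei R 0); rewrite /= ip_ei mxE.
- exact/continuous_subspaceT/continuous_ip.
have c1 : ip 1%:M c c = 1 by move: cS; rewrite inE.
pose l := ip A c c; exists c, l; split => //.
have bound w : ip A w w <= l * ip 1%:M w w.
  have [->|w0] := eqVneq w 0; first by rewrite !ip0l mulr0.
  have ww : 0 < ip 1%:M w w.
    rewrite lt_neqAle ip1_ge0 andbT eq_sym; apply: contra w0 => /eqP/ip1_eq0->.
    exact: eqxx.
  have s0 : 0 < Num.sqrt (ip 1%:M w w) by rewrite sqrtr_gt0.
  move: s0 (sqr_sqrtr (ltW ww)); move: (Num.sqrt _) => s s0 s2.
  have inS : ip 1%:M (s^-1 *: w) (s^-1 *: w) = 1.
    by rewrite ipZl ipZr -s2; field; rewrite gt_eqF.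
  have := cmax _ (mem_set inS); rewrite ipZl ipZr -/l -s2 => H.
  rewrite mulrC -ler_pdivrMl ?exprn_gt0//.
  by rewrite expr2 invfM -mulrA.
apply: (ip_inj (G := 1%:M)) => [u u0|w].
  rewrite lt_neqAle ip1_ge0 andbT eq_sym; apply: contra u0 => /eqP/ip1_eq0->.
  exact: eqxx.
have E : ip 1%:M (c *m A) w = ip A c w by rewrite /ip mulmx1.
rewrite E ipZl; apply/eqP; rewrite -subr_eq0 -oppr_eq0 opprB; apply/eqP.
apply: (@quadratic_ge0_lin0 _ (l * ip 1%:M w w - ip A w w)); first by rewrite subr_ge0.
move=> t; have := bound (c + t *: w); rewrite !ipE (ipC w c symA) (ipC w c sym1) c1 -/l.
rewrite -subr_ge0; congr (_ <= _); rewrite mulr2n; ring.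
Qed.

Lemma orthogonal_completion n (v : 'rV[R]_n.+1) : ip 1%:M v v = 1 ->
  exists Q : 'M[R]_n.+1, Q *m Q^T = 1%:M /\ row 0 Q = v.
Proof.
move=> v1; have [->|ve] := eqVneq v (ei R 0).
  by exists 1%:M; rewrite trmx1 mulmx1 row1.
(* The Householder reflection exchanging [v] and the first basis vector. *)
pose w := v - ei R 0; pose s := ip 1%:M w w.
have s0 : s != 0.
  by apply: contra ve => /eqP/ip1_eq0/eqP; rewrite subr_eq0.
have ww : w *m w^T = s%:M by rewrite [LHS]mx11_scalar /s /ip mulmx1.
exists (1%:M - (2 / s) *: (w^T *m w)); split.
  have -> : (1%:M - (2 / s) *: (w^T *m w))^T = 1%:M - (2 / s) *: (w^T *m w).
    apply/matrixP => i j; rewrite !mxE (eq_sym j); congr (_ - _ * _).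
    by apply: eq_bigr => k _; rewrite !mxE mulrC.
  have NN : w^T *m w *m (w^T *m w) = s *: (w^T *m w).
    by rewrite mulmxA -(mulmxA w^T w) ww mul_mx_scalar -scalemxAl.
  move: NN; move: (w^T *m w) => N NN.
  rewrite mulmxBl mul1mx mulmxBr mulmx1 -scalemxAl -scalemxAr NN !scalerA.
  rewrite (_ : 2 / s * (2 / s) * s = 2 / s + 2 / s); last by field.
  by rewrite scalerDl opprB addrK subrK.
rewrite rowE mulmxBr mulmx1 -scalemxAr mulmxA -/(ei R 0).
have ew : ei R 0 *m w^T = (- (s / 2))%:M.
  rewrite [LHS]mx11_scalar; congr _%:M.
  have -> : (ei R 0 *m w^T) 0 0 = ip 1%:M (ei R 0) w by rewrite /ip mulmx1.
  rewrite /s /w !ipE v1 (ipC v _ (trmx1 _ _)) ip_ei mxE/=.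
  by field.
rewrite ew mul_scalar_mx scalerA (_ : 2 / s * - (s / 2) = -1); last by field.
by rewrite scaleN1r opprK addrC subrK.
Qed.

(** Induction by deflation: in an orthonormal basis starting with a unit eigenvector the matrix is
    block diagonal, by symmetry, and the lower block is treated by the induction hypothesis. *)
Theorem symmetric_spectral n (A : 'M[R]_n) : A^T = A ->
  exists P : 'M[R]_n, P *m P^T = 1%:M /\ is_diag_mx (P *m A *m P^T).
Proof.
elim: n A => [|n IH] A symA.
  exists 1%:M; split; first by rewrite trmx1 mulmx1.
  by apply/is_diag_mxP => -[].
have [v [l [v1 vA]]] := symmetric_eigenvector symA.
have [Q [QQ Q0]] := orthogonal_completion v1.
pose B : 'M[R]_(1 + n) := Q *m A *m Q^T.
have symB : B^T = B by rewrite /B !trmx_mul trmxK symA mulmxA.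
have row0B : row 0 B = l *: ei R 0.
  have QQ' := mulmx1C QQ.
  rewrite /B !row_mul Q0 vA -scalemxAl -Q0 -row_mul QQ row1 //.
have urB : ursubmx B = 0.
  apply/matrixP => i j; rewrite !mxE.
  have := congr1 (fun r : 'rV_(1 + n) => r 0 (rshift 1 j)) row0B.
  rewrite mxE !mxE ord1 => E.
  by rewrite (_ : lshift n 0 = 0) ?E ?mulr0//; exact: val_inj.
have dlB : dlsubmx B = 0 by rewrite -[B]symB -trmx_ursub urB trmx0.
have symD : (drsubmx B)^T = drsubmx B by rewrite trmx_drsub symB.
have [P [PP dP]] := IH _ symD.
pose P1 : 'M[R]_(1 + n) := block_mx 1%:M 0 0 P.
have P1T : P1^T = block_mx 1%:M 0 0 P^T by rewrite /P1 tr_block_mx trmx1 !trmx0.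
pose Q1 : 'M[R]_(1 + n) := Q; pose A1 : 'M[R]_(1 + n) := A.
have H1 : P1 *m Q1 *m (P1 *m Q1)^T = 1%:M.
  rewrite trmx_mul mulmxA -(mulmxA P1) (_ : Q1 *m Q1^T = 1%:M) ?mulmx1 ?P1T//.
  rewrite mulmx_block !mulmx0 !mul0mx !mulmx1 !addr0 add0r PP.
  by rewrite -scalar_mx_block.
have H2 : is_diag_mx (P1 *m Q1 *m A1 *m (P1 *m Q1)^T).
  rewrite trmx_mul !mulmxA -(mulmxA P1) -(mulmxA P1).
  rewrite (_ : Q1 *m A1 *m Q1^T = B)// -[B]submxK urB dlB P1T.
  rewrite !mulmx_block !mulmx0 !mul0mx !mulmx1 !mul1mx !addr0 !add0r.
  rewrite is_diag_block_mx// ?mul0mx !eqxx/= dP !andbT; apply/is_diag_mxP => i j.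
  by rewrite !ord1 eqxx.
by exists (P1 *m Q1); split; [exact: H1|exact: H2].
Qed.

Lemma diag_normalization n (d : 'M[R]_n) : is_diag_mx d -> (forall i, 0 < d i i) ->
  exists D : 'M[R]_n, D *m d *m D^T = 1%:M.
Proof.
move=> /is_diag_mxP dP d0; exists (diag_mx (\row_i (Num.sqrt (d i i))^-1)).
rewrite tr_diag_mx; apply/matrixP => i j; rewrite mul_mx_diag mxE mul_diag_mx !mxE.
have [<-|ij] := eqVneq i j; last by rewrite (dP i j ij) mulr0 mul0r.
have := d0 i; rewrite -sqrtr_gt0; move: (sqr_sqrtr (ltW (d0 i))).
move: (Num.sqrt _) => s <- s0; rewrite mulr1n; by field; rewrite gt_eqF.
Qed.

(** [G] is first brought to the identity by diagonalizing and rescaling. The transported [A] is then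
    diagonalized by an orthogonal matrix, which preserves the identity. *)
Lemma simultaneous_diagonalization n (G A : 'M[R]_n) :
  G^T = G -> (forall u, u != 0 -> 0 < ip G u u) -> A^T = A ->
  exists E : 'M[R]_n, E *m G *m E^T = 1%:M /\ is_diag_mx (E *m A *m E^T).
Proof.
move=> symG posG symA; have [P [PP dP]] := symmetric_spectral symG.
pose d := P *m G *m P^T.
have d0 i : 0 < d i i.
  have -> : d i i = ip G (row i P) (row i P).
    by rewrite /ip tr_row -row_mul !mxE; apply: eq_bigr => k _; rewrite !mxE.
  apply: posG; apply/eqP => r0.
  have := congr1 (fun M : 'M[R]_n => M i i) PP.
  have -> : (P *m P^T) i i = (row i P *m P^T) 0 i by rewrite -row_mul [RHS]mxE.
  by rewrite r0 mul0mx !mxE eqxx => /eqP; rewrite eq_sym oner_eq0.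
have [D D1] := diag_normalization dP d0.
have [|P' [PP' dP']] := @symmetric_spectral n (D *m P *m A *m (D *m P)^T).
  by rewrite !trmx_mul !trmxK symA !mulmxA.
exists (P' *m (D *m P)); split; last by move: dP'; rewrite !trmx_mul !mulmxA.
rewrite !trmx_mul !mulmxA.
rewrite [X in X = _](_ : _ = P' *m (D *m d *m D^T) *m P'^T); last by rewrite /d !mulmxA.
by rewrite D1 mulmx1.
Qed.

End Spectral.

(** * Inequalities for finite sums *)

Section FiniteSums.
Variable R : realType.

Lemma cauchy_schwarz_sum (I : finType) (P : pred I) (x y : I -> R) :
  (\sum_(i | P i) x i * y i) ^+ 2 <=
  (\sum_(i | P i) x i ^+ 2) * (\sum_(i | P i) y i ^+ 2).
Proof.
set A := \sum_(i | P i) x i ^+ 2; set B := \sum_(i | P i) x i * y i.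
set C := \sum_(i | P i) y i ^+ 2.
have A0 : 0 <= A by apply: sumr_ge0 => i _; exact: sqr_ge0.
have C0 : 0 <= C by apply: sumr_ge0 => i _; exact: sqr_ge0.
have H b c : 0 <= c ^+ 2 * A - 2 * b * c * B + b ^+ 2 * C.
  have -> : c ^+ 2 * A - 2 * b * c * B + b ^+ 2 * C =
      \sum_(i | P i) (c * x i - b * y i) ^+ 2.
    rewrite !mulr_sumr -sumrB -big_split/=.
    by apply: eq_bigr => i _; ring.
  by apply: sumr_ge0 => i _; exact: sqr_ge0.
(* Evaluating the nonnegative quadratic form at (B, C) avoids a division; the factor C is cancelled
   afterwards when it is positive. *)
have {}H : 0 <= C * (A * C - B ^+ 2).
  by have := H B C; move: A B C {C0 A0 H} => A B C; congr (_ <= _); ring.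
move: C0; rewrite le_eqVlt => /predU1P[C0|C0]; last by rewrite -subr_ge0 -(pmulr_rge0 _ C0).
have y0 i : P i -> y i = 0.
  move=> Pi; apply/eqP; rewrite -sqrf_eq0.
  have /eqP := esym C0; rewrite /C psumr_eq0; last by move=> j _; exact: sqr_ge0.
  by move=> /allP/(_ i); rewrite mem_index_enum Pi/= => ->.
have -> : B = 0 by rewrite /B big1// => i Pi; rewrite y0 ?mulr0.
by rewrite expr0n/= -C0 mulr0.
Qed.

Lemma sum_ge_term (I : finType) (F : I -> R) i :
  (forall j, 0 <= F j) -> F i <= \sum_j F j.
Proof. by move=> F0; rewrite (bigD1 i)//= lerDl; apply: sumr_ge0. Qed.

Variable n : nat.
Hypothesis n2 : (2 <= n)%N.
Implicit Types (t mu : 'I_n -> R).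
Let n_gt0 : 0 < n%:R :> R. Proof. by rewrite ltr0n (ltn_trans _ n2). Qed.

Let n1_gt0 : 0 < n%:R - 1 :> R. Proof. by rewrite subr_gt0 ltr1n. Qed.

Lemma sum_off_card (j : 'I_n) : \sum_(i | i != j) (1 : R) = n%:R - 1.
Proof.
have := sumr_const (predT : pred 'I_n) (1 : R); rewrite cardT size_enum_ord => <-.
rewrite [in RHS](bigD1 j)//= addrAC subrr add0r.
by apply: eq_bigl.
Qed.

(** The entry is minus the sum of the others, to which Cauchy-Schwarz against the constant 1
    applies. *)
Lemma traceless_entry_sqr t j : \sum_i t i = 0 ->
  t j ^+ 2 <= (n%:R - 1) * \sum_(i | i != j) t i ^+ 2.
Proof.
move=> t0; have -> : t j = - \sum_(i | i != j) 1 * t i.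
  move: t0; rewrite (bigD1 j)//= => /eqP; rewrite addr_eq0 => /eqP ->.
  by congr (- _); apply: eq_bigr => i _; rewrite mul1r.
rewrite sqrrN; apply: le_trans (cauchy_schwarz_sum _ _ _) _.
by under eq_bigr do rewrite expr1n; rewrite sum_off_card.
Qed.

Lemma traceless_off_norm t j : \sum_i t i = 0 ->
  \sum_i t i ^+ 2 <= n%:R * \sum_(i | i != j) t i ^+ 2.
Proof.
move=> t0; rewrite (bigD1 j)//=; have := traceless_entry_sqr j t0.
move: (\sum_(_ | _) _) => s; lra.
Qed.

(** With s = phi / sqrt (n (n - 1)), [traceless_entry_sqr] gives mu_i >= -(n - 1) s, so (mu_i + (n -
    1) s) (mu_i - s)^2 is nonnegative; the bound is the sum of these cubics, expanded. *)
Lemma okumura mu (phi : R) : \sum_i mu i = 0 -> 0 <= phi ->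
  \sum_i mu i ^+ 2 = phi ^+ 2 ->
  - ((n%:R - 2) / Num.sqrt (n%:R * (n%:R - 1)) * phi ^+ 3) <= \sum_i mu i ^+ 3.
Proof.
move=> mu0 phi0 mu2; set q := Num.sqrt _.
have q2 : q ^+ 2 = n%:R * (n%:R - 1) by rewrite sqr_sqrtr// mulr_ge0// ltW.
have q0 : 0 < q by rewrite sqrtr_gt0 mulr_gt0.
have [s sE] : exists s, s = phi / q by exists (phi / q).
have s0 : 0 <= s by rewrite sE divr_ge0// ltW.
have sphi : phi ^+ 2 = n%:R * (n%:R - 1) * s ^+ 2.
  by rewrite -q2 sE; field; rewrite gt_eqF.
have lb i : - ((n%:R - 1) * s) <= mu i.
  rewrite lerNl; apply: le_trans (ler_norm _) _; rewrite normrN.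
  have ns0 : 0 <= (n%:R - 1) * s by rewrite mulr_ge0// ltW.
  rewrite -ler_sqr ?nnegrE// real_normK ?num_real//.
  have := traceless_entry_sqr i mu0.
  have : mu i ^+ 2 + \sum_(j | j != i) mu j ^+ 2 = n%:R * (n%:R - 1) * s ^+ 2.
    by rewrite -sphi -mu2 [RHS](bigD1 i).
  rewrite exprMn; move: (\sum_(_ | _) _) (mu i ^+ 2) => S m E1 E2.
  have {}E1 : S = n%:R * (n%:R - 1) * s ^+ 2 - m by lra.
  by rewrite -(ler_pM2l n_gt0); rewrite E1 in E2; lra.
(* Equality holds for the extremal spectrum: [- (n - 1) s] once and [s] otherwise. *)
have H : 0 <= \sum_i (mu i + (n%:R - 1) * s) * (mu i - s) ^+ 2.
  apply: sumr_ge0 => i _; apply: mulr_ge0; last exact: sqr_ge0.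
  by rewrite -lerBlDr sub0r.
have E : \sum_i (mu i + (n%:R - 1) * s) * (mu i - s) ^+ 2 =
  \sum_i mu i ^+ 3 + (n%:R - 3) * s * \sum_i mu i ^+ 2
  + (s ^+ 2 - 2 * (n%:R - 1) * s ^+ 2) * \sum_i mu i + n%:R * (n%:R - 1) * s ^+ 3.
  have -> : n%:R * (n%:R - 1) * s ^+ 3 = \sum_(i < n) (n%:R - 1) * s ^+ 3.
    by rewrite sumr_const card_ord -[RHS]mulr_natl mulrA.
  rewrite !mulr_sumr -!big_split/=; apply: eq_bigr => i _; ring.
rewrite E mu0 mu2 mulr0 addr0 in H.
have -> : (n%:R - 2) / q * phi ^+ 3 = (n%:R - 2) * s * phi ^+ 2.
  by rewrite sE; field; rewrite gt_eqF.
have E2 : n%:R * (n%:R - 1) * s ^+ 3 = s * phi ^+ 2 by rewrite sphi; ring.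
rewrite E2 in H; rewrite lerNl; lra.
Qed.

(** The difference of the two sides is (eps x + (1 + eps) c)^2 / (eps (1 + eps)). This is how [eps]
    enters: it trades part of the gradient term against the Codazzi defect. *)
Lemma weighted_square_ge (eps x c : R) : 0 < eps ->
  x ^+ 2 / (1 + eps) - c ^+ 2 / eps <= (x + c) ^+ 2.
Proof.
move=> e0; have e1 : 0 < 1 + eps by rewrite addr_gt0.
rewrite -subr_ge0.
have -> : (x + c) ^+ 2 - (x ^+ 2 / (1 + eps) - c ^+ 2 / eps) =
    (eps * x + (1 + eps) * c) ^+ 2 / (eps * (1 + eps)).
  by field; rewrite !gt_eqF.
by rewrite divr_ge0 ?sqr_ge0// mulr_ge0// ltW.
Qed.

(** Besides the diagonal, row [a] and column [a] are kept; off the diagonal they are disjoint and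
    have equal entries, hence the factor 2. *)
Lemma off_diagonal_sum (S : 'I_n -> 'I_n -> R) (a : 'I_n) : (forall i j, S i j = S j i) ->
  \sum_i S i i ^+ 2 + 2 * \sum_(j | j != a) S a j ^+ 2 <= \sum_i \sum_j S i j ^+ 2.
Proof.
move=> Ssym.
have -> : \sum_i \sum_j S i j ^+ 2 =
    \sum_i S i i ^+ 2 + \sum_i \sum_(j | j != i) S i j ^+ 2.
  by rewrite -big_split/=; apply: eq_bigr => i _; rewrite (bigD1 i).
rewrite lerD2l [leRHS](bigD1 a)//= mulr_natl mulr2n lerD2l.
apply: ler_sum => i ia; rewrite Ssym (bigD1 a) 1?eq_sym//= lerDl.
by apply: sumr_ge0 => j _; exact: sqr_ge0.
Qed.

(* Refined Kato inequality; [c] is the defect in the Codazzi equation. *)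
Lemma kato (T : 'I_n -> 'I_n -> 'I_n -> R) (c : 'I_n -> 'I_n -> R) (eps kappa : R) :
  0 < eps -> (forall a i j, T a i j = T a j i) -> (forall a, \sum_i T a i i = 0) ->
  (forall a j, a != j -> T a j a = T j a a + c a j) ->
  (forall a j, a != j -> `|c a j| <= kappa / 2) ->
  (1 + 2 / (n%:R * (1 + eps))) * \sum_a \sum_i T a i i ^+ 2
  - n%:R * (n%:R - 1) / (2 * eps) * kappa ^+ 2 <=
  \sum_a \sum_i \sum_j T a i j ^+ 2.
Proof.
move=> e0 Tsym T0 Tc cb; have e1 : 0 < 1 + eps by rewrite addr_gt0.
have c2 a j : a != j -> c a j ^+ 2 <= kappa ^+ 2 / 4.
  move=> /cb h; rewrite -real_normK ?num_real//.
  have -> : kappa ^+ 2 / 4 = (kappa / 2) ^+ 2 by field.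
  by rewrite ler_sqr ?nnegrE// (le_trans _ h).
have step1 : \sum_a \sum_i T a i i ^+ 2 + 2 * \sum_a \sum_(j | j != a) T a a j ^+ 2 <=
    \sum_a \sum_i \sum_j T a i j ^+ 2.
  rewrite mulr_sumr -big_split/=; apply: ler_sum => a _.
  by apply: off_diagonal_sum => i j; exact: Tsym.
(* Symmetry and Codazzi give T_aaj = T_aja = T_jaa + c_aj, which turns mixed entries into diagonal
   entries of the derivative along e_j. *)
have step2 : (1 + eps)^-1 * \sum_j \sum_(a | a != j) T j a a ^+ 2
    - n%:R * (n%:R - 1) * (kappa ^+ 2 / 4 / eps) <=
    \sum_a \sum_(j | j != a) T a a j ^+ 2.
  have -> : \sum_a \sum_(j | j != a) T a a j ^+ 2 =
      \sum_j \sum_(a | a != j) (T j a a + c a j) ^+ 2.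
    rewrite (exchange_big_dep predT)//=; apply: eq_bigr => j _.
    by apply: eq_big => [a|a ja]; rewrite 1?eq_sym// Tsym Tc// eq_sym.
  have -> : n%:R * (n%:R - 1) * (kappa ^+ 2 / 4 / eps) =
      \sum_(j < n) \sum_(a | a != j) (kappa ^+ 2 / 4 / eps).
    rewrite (eq_bigr (fun=> (n%:R - 1) * (kappa ^+ 2 / 4 / eps))).
      by rewrite sumr_const card_ord -[RHS]mulr_natl mulrA.
    move=> j _; rewrite -(sum_off_card j) mulr_suml.
    by apply: eq_bigr => a _; rewrite mul1r.
  rewrite mulr_sumr -sumrB; apply: ler_sum => j _.
  rewrite mulr_sumr -sumrB; apply: ler_sum => a aj.
  apply: le_trans (weighted_square_ge (T j a a) (c a j) e0).
  rewrite mulrC lerB// ler_pM2r ?invr_gt0//; exact: c2.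
(* The previous step misses the entries T_jjj. Tracelessness bounds each by the other diagonal
   entries, at the cost of the factor 1/n. *)
have step3 : (n%:R)^-1 * \sum_a \sum_i T a i i ^+ 2 <=
    \sum_j \sum_(a | a != j) T j a a ^+ 2.
  rewrite mulr_sumr; apply: ler_sum => a _; rewrite ler_pdivrMl//.
  exact: (traceless_off_norm a (T0 a)).
have step4 : (1 + eps)^-1 * ((n%:R)^-1 * \sum_a \sum_i T a i i ^+ 2) <=
    (1 + eps)^-1 * \sum_j \sum_(a | a != j) T j a a ^+ 2.
  by rewrite ler_pM2l ?invr_gt0.
have -> : (1 + 2 / (n%:R * (1 + eps))) * \sum_a \sum_i T a i i ^+ 2 =
  \sum_a \sum_i T a i i ^+ 2
  + 2 * ((1 + eps)^-1 * ((n%:R)^-1 * \sum_a \sum_i T a i i ^+ 2)).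
  by field; rewrite !gt_eqF.
have -> : n%:R * (n%:R - 1) / (2 * eps) * kappa ^+ 2 =
    2 * (n%:R * (n%:R - 1) * (kappa ^+ 2 / 4 / eps)).
  by field; rewrite gt_eqF.
lra.
Qed.

(* The reaction terms of Simons' identity, in a frame diagonalizing the shape
   operator: [K a i] are tangential and [r i] normal sectional curvatures. *)
Lemma simons_reaction_bound (lam mu r : 'I_n -> R) (K D N : 'I_n -> 'I_n -> R)
    (H phi K1 K2 K' : R) :
  0 <= H -> 0 <= phi -> (forall i, lam i = mu i + H) -> \sum_i mu i = 0 ->
  \sum_i mu i ^+ 2 = phi ^+ 2 ->
  (forall a i, a != i -> K2 <= K a i) -> (forall a i, K a i = K i a) ->
  (forall i, K2 <= r i <= K1) ->
  (forall a, \sum_i N a i = 0) ->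
  (forall a i, N a i = N i a + (lam i - lam a) * (2 * K a i + lam a * lam i)
     + (lam a * r i - lam i * r a) + D a i) ->
  - (2 * n%:R * K' * phi) <= \sum_a \sum_i mu i * D a i ->
  - phi ^+ 4 - n%:R * (n%:R - 2) * H / Num.sqrt (n%:R * (n%:R - 1)) * phi ^+ 3
  + n%:R * (H ^+ 2 + (K2 - K1) * H / 2 + 2 * K2 - K1) * phi ^+ 2
  - 2 * n%:R * K' * phi + n%:R ^+ 2 * H * (K2 - K1) / 2 <=
  \sum_a \sum_i lam i * N a i.
Proof.
move=> H0 phi0 lamE mu0 mu2 Klb Ksym rb N0 NE Db.
have dsum (F : 'I_n -> R) (G : 'I_n -> R) :
    \sum_(a < n) \sum_(i < n) F a * G i = (\sum_a F a) * (\sum_i G i).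
  by rewrite mulr_suml; apply: eq_bigr => a _; rewrite mulr_sumr.
have csum (F : 'I_n -> R) : \sum_(a < n) \sum_i F i = n%:R * \sum_i F i.
  by rewrite sumr_const card_ord mulr_natl.
have csum' (F : 'I_n -> R) : \sum_(a < n) \sum_(i < n) F a = n%:R * \sum_i F i.
  by rewrite exchange_big csum.
have E1 : \sum_a \sum_i lam i * N a i = \sum_a \sum_i mu i * N a i.
  apply: eq_bigr => a _; rewrite (eq_bigr (fun i => mu i * N a i + H * N a i)).
    by rewrite big_split/= -mulr_sumr N0 mulr0 addr0.
  by move=> i _; rewrite lamE mulrDl.
(* This vanishing sum is subtracted for free, so that only the antisymmetric difference N_ai - N_ia
   matters. *)
have E0 : \sum_a \sum_i mu i * N i a = 0.
  rewrite exchange_big big1// => i _.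
  by rewrite -mulr_sumr N0 mulr0.
have E2 : \sum_a \sum_i mu i * N a i =
    \sum_a \sum_i (mu i - mu a) ^+ 2 * K a i
    + \sum_a \sum_i mu i * (lam i - lam a) * (lam a * lam i)
    + \sum_a \sum_i mu i * (lam a * r i - lam i * r a)
    + \sum_a \sum_i mu i * D a i.
  rewrite -[LHS]subr0 -[X in _ - X = _]E0.
  (* Symmetrizing in (a, i), possible because [K] is symmetric, turns 2 mu_i (mu_i - mu_a) into the
     square (mu_i - mu_a)^2, so that a lower bound on [K] can be used. *)
  have -> : \sum_a \sum_i (mu i - mu a) ^+ 2 * K a i =
      \sum_a \sum_i 2 * mu i * (mu i - mu a) * K a i.
    have -> : \sum_a \sum_i (mu i - mu a) ^+ 2 * K a i =
        \sum_a \sum_i mu i * (mu i - mu a) * K a i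
        + \sum_a \sum_i mu a * (mu a - mu i) * K a i.
      rewrite -big_split/=; apply: eq_bigr => a _; rewrite -big_split/=.
      by apply: eq_bigr => i _; ring.
    rewrite [X in _ + X]exchange_big/= -big_split/=; apply: eq_bigr => a _.
    rewrite -big_split/=; apply: eq_bigr => i _; rewrite (Ksym i a); ring.
  rewrite -sumrB -!big_split/=; apply: eq_bigr => a _.
  rewrite -sumrB -!big_split/=; apply: eq_bigr => i _.
  by rewrite NE !lamE; ring.
(* As the mu_i sum to 0, the squares (mu_i - mu_a)^2 add up to 2 n phi^2. The diagonal terms, where
   [K] is not controlled, vanish. *)
have B1 : 2 * n%:R * K2 * phi ^+ 2 <= \sum_a \sum_i (mu i - mu a) ^+ 2 * K a i.
  have -> : 2 * n%:R * K2 * phi ^+ 2 = \sum_a \sum_i (mu i - mu a) ^+ 2 * K2.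
    have -> : \sum_a \sum_i (mu i - mu a) ^+ 2 * K2 =
      \sum_(a < n) \sum_i mu i ^+ 2 * K2 + \sum_a \sum_(i < n) mu a ^+ 2 * K2
      - \sum_a \sum_i (2 * K2 * mu a) * mu i.
      rewrite -big_split/= -sumrB; apply: eq_bigr => a _.
      rewrite -big_split/= -sumrB; apply: eq_bigr => i _; ring.
    by rewrite csum csum' dsum mu0 mulr0 subr0 -mulr_suml mu2; ring.
  apply: ler_sum => a _; apply: ler_sum => i _.
  have [->|ai] := eqVneq a i; first by rewrite subrr expr0n !mul0r.
  by apply: ler_wpM2l; [exact: sqr_ge0|exact: Klb].
have E3 : \sum_a \sum_i mu i * (lam i - lam a) * (lam a * lam i) =
    n%:R * H * \sum_i mu i ^+ 3 + n%:R * H ^+ 2 * phi ^+ 2 - phi ^+ 4.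
  have -> : \sum_a \sum_i mu i * (lam i - lam a) * (lam a * lam i) =
    \sum_a \sum_i mu a * (mu i ^+ 3 + 2 * H * mu i ^+ 2 + H ^+ 2 * mu i)
    + \sum_(a < n) \sum_i (H * mu i ^+ 3 + 2 * H ^+ 2 * mu i ^+ 2 + H ^+ 3 * mu i)
    - \sum_a \sum_i (mu a ^+ 2 + 2 * H * mu a) * (mu i ^+ 2 + H * mu i)
    - \sum_(a < n) \sum_i (H ^+ 2 * mu i ^+ 2 + H ^+ 3 * mu i).
    rewrite -big_split/= -!sumrB; apply: eq_bigr => a _.
    rewrite -big_split/= -!sumrB; apply: eq_bigr => i _; rewrite !lamE; ring.
  rewrite !dsum !csum !big_split/= -!mulr_sumr mu0 mu2; ring.
(* Tracelessness reduces the double sum to n H times the sum of mu_i r_i, minus phi^2 times the sum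
   of the r_a; the latter is at most n K1. *)
have B4 : n%:R * H * ((K2 - K1) / 2) * (phi ^+ 2 + n%:R) - n%:R * K1 * phi ^+ 2 <=
    \sum_a \sum_i mu i * (lam a * r i - lam i * r a).
  have -> : \sum_a \sum_i mu i * (lam a * r i - lam i * r a) =
    \sum_a \sum_i mu a * (mu i * r i) + \sum_(a < n) \sum_i H * (mu i * r i)
    - \sum_a \sum_i r a * (mu i ^+ 2 + H * mu i).
    rewrite -big_split/= -!sumrB; apply: eq_bigr => a _.
    rewrite -big_split/= -!sumrB; apply: eq_bigr => i _; rewrite !lamE; ring.
  rewrite (dsum mu) csum (dsum r) big_split/= -!mulr_sumr mu0 mu2 mul0r add0r mulr0 addr0.
  have sr : \sum_i r i <= n%:R * K1.
    have -> : n%:R * K1 = \sum_(i < n) K1 by rewrite sumr_const card_ord mulr_natl.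
    by apply: ler_sum => i _; have /andP[] := rb i.
  (* Subtracting the midpoint from r_i changes nothing since the mu_i sum to 0, and leaves a factor
     of size at most (K1 - K2) / 2. Then |m| <= m^2 + 1 is used, by cases on the sign of m. *)
  have smr : (K2 - K1) / 2 * (phi ^+ 2 + n%:R) <= \sum_i mu i * r i.
    have -> : \sum_i mu i * r i = \sum_i mu i * (r i - (K1 + K2) / 2).
      rewrite [RHS](eq_bigr (fun i => mu i * r i - mu i * ((K1 + K2) / 2))).
        by rewrite sumrB -mulr_suml mu0 mul0r subr0.
      by move=> i _; rewrite mulrBr.
    have -> : (K2 - K1) / 2 * (phi ^+ 2 + n%:R) =
        \sum_i (K2 - K1) / 2 * (mu i ^+ 2 + 1).
      by rewrite -mulr_sumr big_split/= mu2 sumr_const card_ord.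
    apply: ler_sum => i _; have /andP[r2 r1] := rb i.
    have k0 : 0 <= K1 - K2 by lra.
    move: (mu i) => m; have [m0|m0] := leP 0 m.
      have p1 : 0 <= m * (r i - K2) by rewrite mulr_ge0// subr_ge0.
      have p2 : 0 <= (K1 - K2) * (m ^+ 2 - m + 1) by rewrite mulr_ge0//; nra.
      lra.
    have p1 : 0 <= - m * (K1 - r i) by rewrite mulr_ge0 ?subr_ge0// oppr_ge0 ltW.
    have p2 : 0 <= (K1 - K2) * (m ^+ 2 + m + 1) by rewrite mulr_ge0//; nra.
    lra.
  have h1 := ler_wpM2l (mulr_ge0 (ltW n_gt0) H0) smr.
  have h2 := ler_wpM2r (sqr_ge0 phi) sr.
  move: h1 h2; move: (\sum_i mu i * r i) (\sum_i r i) => p q; nra.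
have B5 := ler_wpM2l (mulr_ge0 (ltW n_gt0) H0) (okumura mu0 phi0 mu2).
rewrite E1 E2 E3; move: B1 B4 B5 Db; clear.
have -> : n%:R * (n%:R - 2) * H / Num.sqrt (n%:R * (n%:R - 1)) * phi ^+ 3 =
  n%:R * H * ((n%:R - 2) / Num.sqrt (n%:R * (n%:R - 1)) * phi ^+ 3) by ring.
move: (_ / Num.sqrt _ * _) => o b1 b4 b5 db; rewrite mulrN in b5; lra.
Qed.

End FiniteSums.

(** * The inequality of Simons type *)

Section CurvatureBounds.
Variables (R : realType) (m : nat) (W : set 'rV[R]_m) (g : 'rV[R]_m -> 'M[R]_m).
Hypothesis hg : metric_on W g.
Variables (z : 'rV[R]_m) (K1 K2 : R).
Hypothesis Wz : W z.
Hypothesis hsec : forall u v, free [:: u; v] -> K2 <= sec g z u v <= K1.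
Let symg := metric_sym hg Wz.

Lemma orthogonal_free (u v : 'rV[R]_m) :
  ip (g z) u u = 1 -> ip (g z) u v = 0 -> 0 < ip (g z) v v -> free [:: u; v].
Proof.
move=> uu uv vv; rewrite free_cons span_seq1 seq1_free; apply/andP; split.
  apply/negP => /vlineP[k uk]; move: uv; rewrite uk ipZl => /eqP.
  rewrite mulf_eq0 (gt_eqF vv) orbF => /eqP k0.
  by move: uu; rewrite uk k0 scale0r ip0l => /eqP; rewrite eq_sym oner_eq0.
by apply: contraTneq vv => ->; rewrite ip0l ltxx.
Qed.

Lemma sec_orthogonal (u v : 'rV[R]_m) :
  ip (g z) u u = 1 -> ip (g z) u v = 0 -> 0 < ip (g z) v v ->
  K2 * ip (g z) v v <= ip (g z) (Rm_at g z u v v) u <= K1 * ip (g z) v v.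
Proof.
move=> uu uv vv; have := hsec (orthogonal_free uu uv vv).
by rewrite /sec uu uv expr0n subr0 mul1r ler_pdivlMr// ler_pdivrMr.
Qed.

(* Polarization of the sectional curvature bound. *)
Lemma mixed_curvature_bound (a u v : 'rV[R]_m) :
  ip (g z) a a = 1 -> ip (g z) u u = 1 -> ip (g z) v v = 1 ->
  ip (g z) a u = 0 -> ip (g z) a v = 0 -> ip (g z) u v = 0 ->
  `|ip (g z) (Rm_at g z a u a) v| <= (K1 - K2) / 2.
Proof.
move=> aa uu vv au av uv.
have vu : ip (g z) v u = 0 by rewrite ipC.
have pp : ip (g z) (u + v) (u + v) = 2 by rewrite !ipE uu vv uv vu; ring.
have qq : ip (g z) (u - v) (u - v) = 2 by rewrite !ipE uu vv uv vu; ring.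
have /andP[p2 p1] : K2 * 2 <= ip (g z) (Rm_at g z a (u + v) (u + v)) a <= K1 * 2.
  have := @sec_orthogonal a (u + v) aa; rewrite pp ipDr au av addr0; exact.
have /andP[q2 q1] : K2 * 2 <= ip (g z) (Rm_at g z a (u - v) (u - v)) a <= K1 * 2.
  have := @sec_orthogonal a (u - v) aa; rewrite qq ipDr ipNr au av subr0; exact.
have bi := Rm_at_bianchi hg a v u Wz.
have sk p q r s := Rm_at_skew hg p q r s Wz; have an p q r := Rm_at_anti hg p q r Wz.
have l2 := Rm_at_lin2 hg a _ Wz; have l3 := Rm_at_lin3 hg a _ Wz.
move: bi sk an l2 l3 p1 p2 q1 q2 symg; clear.
generalize (Rm_at g z) (g z) => Rz G0 bi sk an l2 l3 p1 p2 q1 q2 symG.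
have B := congr1 (fun w => ip G0 w a) bi.
rewrite /= !ipDl ip0l (an u a v) ipNl in B.
(* By skewness <R(v,u)a, a> = 0, so Bianchi makes <R(a,u)v, a> symmetric in u and v. The difference
   of the curvature terms for u + v and u - v is then 4 <R(a,u)v, a>, and each of them lies between
   2 K2 and 2 K1. *)
have S : ip G0 (Rz v u a) a = 0 by have := sk v u a a; rewrite (ipC a _ symG); lra.
have S2 := sk a u a v; rewrite (ipC a _ symG) in S2.
rewrite (linear_predD (l2 (u + v))) (linear_predD (l3 u)) (linear_predD (l3 v)) !ipE in p1 p2.
rewrite (linear_predB (l2 (u - v))) (linear_predB (l3 u)) (linear_predB (l3 v)) !ipE in q1 q2.
by rewrite S2 normrN ler_norml; apply/andP; split; lra.
Qed.
End CurvatureBounds.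

(** * Simons' identity in a principal frame *)

Section SimonsIdentity.
Variables (R : realType) (n : nat).
Variables (W : set 'rV[R]_n.+1) (g : 'rV[R]_n.+1 -> 'M[R]_n.+1).
Variables (U : set 'rV[R]_n) (F nu : 'rV[R]_n -> 'rV[R]_n.+1).
Hypothesis hS : hypersurface_on W g U F nu.
Let hg := hyp_metric hS.
Let UW := hyp_maps hS.
Let G := induced_metric g F.
Let hG : metric_on U G := induced_metric_on hS.
Let h := sff g F nu.
Let sh : smooth_form U h := smooth_sff hS.

Let hsym y u v : U y -> h y u v = h y v u.
Proof. exact: (sff_sym hS). Qed.

Lemma principal_frame x : U x -> exists e : 'I_n -> 'rV[R]_n,
  orthonormal_basis G x e /\ forall i j, i != j -> h x (e i) (e j) = 0.
Proof.
move=> Ux; have symh : (form_mx h x)^T = form_mx h x.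
  apply/matrixP => i j; rewrite mxE [LHS]mxE [RHS]mxE.
  exact: hsym.
have [E [EG /is_diag_mxP Eh]] := simultaneous_diagonalization (metric_sym hG Ux)
  (fun u => metric_pos hG Ux) symh.
pose e i := row i E; have eE : \matrix_i e i = E.
  by apply/row_matrixP => i; rewrite rowK.
exists e; split=> [i j|i j ij].
  by rewrite -(frame_form e) eE EG mxE.
by rewrite -(form_mx_ip Ux _ _ sh) -(frame_form e) eE Eh.
Qed.

Variables (x : 'rV[R]_n) (e : 'I_n -> 'rV[R]_n).
Hypothesis Ux : U x.
Hypothesis eON : orthonormal_basis G x e.
Hypothesis hdiag : forall i j, i != j -> h x (e i) (e j) = 0.

Lemma h_eigen w i : h x w (e i) = h x (e i) (e i) * ip (G x) w (e i).
Proof.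
rewrite {1}(frame_expand hG Ux eON w) (linear_pred_sum (form_linl sh (e i) Ux)).
rewrite (bigD1 i)//= big1 ?addr0 => [|j ji].
  by rewrite (linear_predZ (form_linl sh (e i) Ux)) mulrC.
by rewrite (linear_predZ (form_linl sh (e i) Ux)) hdiag// scaler0.
Qed.

Lemma h_eigenr w i : h x (e i) w = h x (e i) (e i) * ip (G x) w (e i).
Proof. by rewrite -h_eigen (hsym _ _ Ux). Qed.

Lemma shape_vec_frame i : shape_vec g F nu x (e i) = h x (e i) (e i) *: e i.
Proof.
apply: (ip_inj (fun u => metric_pos hG Ux)) => w.
rewrite (shape_vecP hS _ _ Ux) ipZl.
by rewrite (ipC (e i) w (metric_sym hG Ux)); exact: h_eigenr.
Qed.

Local Notation X i := ('D_(e i) F x).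
Local Notation Rz := (Rm_at g (F x)).
Local Notation "<| a , b |>" := (ip (g (F x)) a b).

Definition tan_sec a i : R := <| Rz (X a) (X i) (X i), X a |>.
Definition nor_sec i : R := <| Rz (nu x) (X i) (X i), nu x |>.
Definition cov_curv t a b c : R :=
  <| covd_Rm_at g (F x) (X t) (X a) (X b) (X c), nu x |>.

Lemma tan_secC a i : tan_sec a i = tan_sec i a.
Proof.
have Wx := UW Ux; rewrite /tan_sec.
move: (Rm_at_anti hg (X a) (X i) (X i) Wx) (Rm_at_skew hg (X i) (X a) (X i) (X a) Wx).
move: (metric_sym hg Wx).
generalize (Rm_at g (F x)) (g (F x)) (X a) (X i) => Rx G0 Xa Xi sG -> sk.
by rewrite ipNl sk opprK ipC.
Qed.

Lemma shape_frame_D i : 'D_(shape_vec g F nu x (e i)) F x = h x (e i) (e i) *: X i.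
Proof.
by rewrite shape_vec_frame
  (linear_predZ (derive_dir_linear_row (hyp_open hS) (hyp_smooth hS) Ux)).
Qed.

(** Writing N(a,b;i,j) for the second derivative of h, the chain is N(a,a;i,i) to N(a,i;a,i) by
    differentiated Codazzi, to N(i,a;a,i) by Ricci, to N(i,a;i,a) by symmetry, and to N(i,i;a,a) by
    Codazzi again. Gauss replaces the intrinsic curvature in the Ricci step. *)
Lemma simons_diag a i :
  covb2 G h (e a) (e a) x (e i) (e i) = covb2 G h (e i) (e i) x (e a) (e a)
  + (h x (e i) (e i) - h x (e a) (e a)) *
    (2 * tan_sec a i + h x (e a) (e a) * h x (e i) (e i))
  + (h x (e a) (e a) * nor_sec i - h x (e i) (e i) * nor_sec a)
  + (cov_curv a a i i + cov_curv i a i a).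
Proof.
have Wx := UW Ux.
have C b c d f := etrans
  (codazzi_derive hS erefl erefl erefl b c d f Ux)
  (derive_ncurv hS erefl erefl erefl b c d f Ux).
have C1 := C (e a) (e a) (e i) (e i); have C2 := C (e i) (e a) (e i) (e a).
have Ge b c d f := gauss_equation hS erefl erefl erefl b c d f Ux.
have G1 := Ge (e a) (e i) (e a) (e i); have G2 := Ge (e a) (e i) (e i) (e a).
have Rc := ricci_identity hG (e a) (e i) (e a) (e i) sh Ux.
have S : covb2 G h (e i) (e a) x (e a) (e i) = covb2 G h (e i) (e a) x (e i) (e a).
  exact: (covb2_sym hG).
have E1 := h_eigen (Rm_at G x (e a) (e i) (e a)) i.
have E2 := h_eigenr (Rm_at G x (e a) (e i) (e i)) a.
have hia : h x (e i) (e a) = h x (e a) (e i) by exact: hsym.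
have hai := hdiag (i := a) (j := i).
have an p q r := Rm_at_anti hg p q r Wx; have sk p q r s := Rm_at_skew hg p q r s Wx.
rewrite /tan_sec /nor_sec /cov_curv.
move: (shape_frame_D a) (shape_frame_D i).
move: an sk C1 C2 G1 G2 Rc S E1 E2 hia hai (metric_sym hg Wx).
rewrite -/G -/h; clear; generalize (covb2 G h) => N2.
generalize (covd_Rm_at g (F x)) (Rm_at g (F x)) (Rm_at G x) => cR Rx RG.
generalize (ip (G x)) (h x) => iG h0.
generalize (g (F x)) (nu x) => G0 nx.
generalize ('D_(shape_vec g F nu x (e a)) F x) ('D_(shape_vec g F nu x (e i)) F x).
move=> Ya Yi an sk C1 C2 G1 G2 Rc S E1 E2 hia hai sG Sa Si; move: C1 C2 Sa Si.
move: an sk G1 G2 Rc S E1 E2 hia hai sG.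
(* For a = i, diagonality of [h] gives nothing. The claim is then that the nabla R terms vanish,
   which follows from the differentiated Codazzi equation with equal arguments. *)
have [->|ai] := eqVneq a i.
  move: (X i) => Xi an sk G1 G2 Rc S E1 E2 hia _ sG C1 _ Ya1 _; rewrite Ya1 ipZr in C1.
  have Z p q : ip G0 (Rx p p q) nx = 0.
    by have := congr1 (fun w => ip G0 w nx) (an p p q); rewrite /= ipNl; lra.
  have nn p q : ip G0 (Rx p q nx) nx = 0.
    by have := sk p q nx nx; rewrite (ipC nx _ sG); lra.
  have A1 := congr1 (fun w => ip G0 w nx) (an Xi nx Xi); rewrite /= ipNl in A1.
  have A2 : ip G0 (Rx Xi Xi Xi) Xi = 0.
    by have := congr1 (fun w => ip G0 w Xi) (an Xi Xi Xi); rewrite /= ipNl; lra.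
  rewrite A1 nn A2 in C1; lra.
move: (X a) (X i) => Xa Xi an sk G1 G2 Rc S E1 E2 hia hai sG C1 C2 Ya1 Yi1.
rewrite Ya1 ipZr in C1; rewrite Yi1 ipZr in C2.
have nn p q : ip G0 (Rx p q nx) nx = 0.
  by have := sk p q nx nx; rewrite (ipC nx _ sG); lra.
have A1 := congr1 (fun w => ip G0 w nx) (an Xa nx Xa); rewrite /= ipNl in A1.
have A2 := sk Xa Xi Xa Xi; rewrite (ipC Xa _ sG) in A2.
rewrite (hai isT) !mul0r in C1; rewrite hia (hai isT) !mul0r A1 A2 in C2.
rewrite hia (hai isT) mul0r A2 in G1; rewrite (hai isT) hia (hai isT) mul0r in G2.
rewrite E1 E2 in Rc;
(* The intrinsic sectional curvature of the plane, expressed by the Gauss equation as the ambient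
   one plus a product of principal curvatures. *)
have I1 : iG (RG (e a) (e i) (e a)) (e i) =
    - ip G0 (Rx Xa Xi Xi) Xa - h0 (e a) (e a) * h0 (e i) (e i) by lra.
have I2 : iG (RG (e a) (e i) (e i)) (e a) =
    ip G0 (Rx Xa Xi Xi) Xa + h0 (e i) (e i) * h0 (e a) (e a) by lra.
rewrite I1 I2 in Rc; lra.
Qed.

End SimonsIdentity.

(** * Estimates at a point under the curvature bounds *)

Section SimonsInequality.
Variables (R : realType) (n : nat).
Hypothesis n2 : (2 <= n)%N.
Variables (W : set 'rV[R]_n.+1) (g : 'rV[R]_n.+1 -> 'M[R]_n.+1).
Variables (U : set 'rV[R]_n) (F nu : 'rV[R]_n -> 'rV[R]_n.+1).
Hypothesis hS : hypersurface_on W g U F nu.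
Variables (K1 K2 K' H : R).
Hypothesis hsec : forall z, W z -> forall u v, free [:: u; v] -> K2 <= sec g z u v <= K1.
Hypothesis hK' : forall z e, W z -> orthonormal_basis g z e -> covd_Rm_norm g z e <= K'.
Hypothesis hH : forall y, U y -> mean_curvature g F nu y = H.
Hypothesis H_ge0 : 0 <= H.
Let hg := hyp_metric hS.
Let UW := hyp_maps hS.
Let G := induced_metric g F.
Let hG : metric_on U G := induced_metric_on hS.
Let h := sff g F nu.
Let sh : smooth_form U h := smooth_sff hS.
Let hsym y u v : U y -> h y u v = h y v u := fun Uy => sff_sym hS u v Uy.
Let n_gt0 : 0 < n%:R :> R. Proof. by rewrite ltr0n (ltn_trans _ n2). Qed.

Lemma sff_trace y : U y -> form_trace G h y = n%:R * H.
Proof.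
move=> Uy; rewrite -(hH Uy) /mean_curvature /Defs.shape second_form_mx mulrC divfK//.
by rewrite gt_eqF.
Qed.

Variables (x : 'rV[R]_n) (e : 'I_n -> 'rV[R]_n).
Hypothesis Ux : U x.
Hypothesis eON : orthonormal_basis G x e.
Hypothesis hdiag : forall i j, i != j -> h x (e i) (e j) = 0.

Let lam i := h x (e i) (e i).
Let mu i := lam i - H.
Let T a i j := covb G h (e a) x (e i) (e j).
Let N a i := covb2 G h (e a) (e a) x (e i) (e i).
Local Notation X i := ('D_(e i) F x).

Lemma principal_trace0 : \sum_i mu i = 0.
Proof.
rewrite sumrB -(form_trace_frame hG Ux eON sh) sff_trace// sumr_const card_ord.
by rewrite mulr_natl subrr.
Qed.

Lemma covb_trace0_frame a : \sum_i T a i i = 0.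
Proof.
rewrite -(form_trace_frame hG Ux eON (smooth_covb hG (e a) sh)).
exact: (covb_trace0 hG _ sh sff_trace Ux).
Qed.

(** The trace of h is constant on all of [U], so the trace of its first derivative vanishes on [U]
    and can be differentiated once more; the Christoffel correction in [covb2] is a first derivative
    too. *)
Lemma covb2_trace0_frame a : \sum_i N a i = 0.
Proof.
have s1 b := smooth_covb hG b sh; have s2 b c := smooth_covb hG c (s1 b).
have t1 b y : U y -> form_trace G (covb G h b) y = 0.
  by move=> Uy; exact: (covb_trace0 hG _ sh sff_trace Uy).
have t2 b c : form_trace G (covb G (covb G h b) c) x = 0.
  exact: (covb_trace0 hG _ (s1 b) (t1 b) Ux).
rewrite /N /covb2 sumrB -(form_trace_frame hG Ux eON (s2 _ _)) t2.
by rewrite -(form_trace_frame hG Ux eON (s1 _)) t1// subrr.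
Qed.

Let Xon i j : ip (g (F x)) (X i) (X j) = (i == j)%:R.
Proof. by rewrite -(ip_induced hS _ _ Ux) eON. Qed.

(** The bound on nabla R is stated for ambient bases: index 0 carries the normal, the others the
    images of the principal directions. *)
Definition adapted_frame (i : 'I_n.+1) : 'rV[R]_n.+1 :=
  if unlift ord0 i is Some j then X j else nu x.

Lemma adapted_frame_orthonormal : orthonormal_basis g (F x) adapted_frame.
Proof.
have nX i : ip (g (F x)) (nu x) (X i) = 0.
  by rewrite (ipC _ _ (metric_sym hg (UW Ux))) (hyp_normal hS).
move=> i j; rewrite /adapted_frame.
case: (unliftP ord0 i) => [i'|] ->; case: (unliftP ord0 j) => [j'|] ->.
- by rewrite Xon (inj_eq lift_inj).
- by rewrite (hyp_normal hS).
- by rewrite nX.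
- by rewrite (hyp_unit hS).
Qed.

Lemma sum_lift_le (f : 'I_n.+1 -> R) : (forall i, 0 <= f i) ->
  \sum_(i < n) f (lift ord0 i) <= \sum_i f i.
Proof. by move=> f0; rewrite big_ord_recl lerDr. Qed.

(** For each pair of tangential indices, a single term of the inner triple sum is retained. *)
Lemma sum_lift_le2 (q : 'I_n.+1 -> 'I_n.+1 -> 'I_n.+1 -> 'I_n.+1 -> 'I_n.+1 -> R)
    (k s t : 'I_n -> 'I_n -> 'I_n.+1) : (forall i j k s t, 0 <= q i j k s t) ->
  \sum_a \sum_i q (lift ord0 a) (lift ord0 i) (k a i) (s a i) (t a i) <=
  \sum_i \sum_j \sum_k \sum_s \sum_t q i j k s t.
Proof.
move=> q0.
have s3 i j : 0 <= \sum_k \sum_s \sum_t q i j k s t by do 3!(apply: sumr_ge0 => ? _).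
have s4 i : 0 <= \sum_j \sum_k \sum_s \sum_t q i j k s t by apply: sumr_ge0 => ? _.
apply: le_trans (sum_lift_le s4); apply: ler_sum => a _.
apply: le_trans (sum_lift_le (s3 _)); apply: ler_sum => i _.
move: (lift ord0 a) (lift ord0 i) (k a i) (s a i) (t a i) => i' j' k' s' t'.
apply: le_trans (sum_ge_term k' _); last by move=> l; do 2!(apply: sumr_ge0 => ? _).
apply: le_trans (sum_ge_term s' _); last by move=> l; apply: sumr_ge0 => ? _.
exact: (sum_ge_term t').
Qed.

(** The choices (a, i) and (i, a) for [f a i] yield the two components of nabla R that occur in
    Simons' identity. *)
Lemma cov_curv_sum (f : 'I_n -> 'I_n -> 'I_n * 'I_n) :
  \sum_a \sum_i (ip (g (F x)) (covd_Rm_at g (F x) (X (f a i).1) (X a) (X i) (X (f a i).2))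
     (nu x)) ^+ 2 <= K' ^+ 2.
Proof.
pose Y := adapted_frame.
have YE i : Y (lift ord0 i) = X i by rewrite /Y /adapted_frame liftK.
have Y0 : Y ord0 = nu x by rewrite /Y /adapted_frame unlift_none.
pose q i j k s t := ip (g (F x)) (covd_Rm_at g (F x) (Y t) (Y i) (Y j) (Y k)) (Y s) ^+ 2.
have q0 i j k s t : 0 <= q i j k s t by exact: sqr_ge0.
have S0 : 0 <= \sum_i \sum_j \sum_k \sum_s \sum_t q i j k s t.
  by do 5!(apply: sumr_ge0 => ? _).
have : \sum_i \sum_j \sum_k \sum_s \sum_t q i j k s t <= K' ^+ 2.
  have hk : Num.sqrt (\sum_i \sum_j \sum_k \sum_s \sum_t q i j k s t) <= K'.
    exact: (hK' (UW Ux) adapted_frame_orthonormal).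
  have k0 : 0 <= K' by apply: le_trans hk; exact: sqrtr_ge0.
  by rewrite -(sqr_sqrtr S0) ler_sqr ?nnegrE// sqrtr_ge0.
apply: le_trans; apply: le_trans (sum_lift_le2 (fun a i => lift ord0 (f a i).2)
  (fun _ _ => ord0) (fun a i => lift ord0 (f a i).1) q0).
rewrite le_eqVlt; apply/orP; left; apply/eqP; apply: eq_bigr => a _; apply: eq_bigr => i _.
by rewrite /q !YE Y0.
Qed.

Let K'_ge0 : 0 <= K'.
Proof. by apply: le_trans (hK' (UW Ux) adapted_frame_orthonormal); exact: sqrtr_ge0. Qed.

(** Cauchy-Schwarz over all pairs gives sqrt n * K' * phi, since the weight mu_i^2 is summed n
    times; this is relaxed to n * K' * phi to match the target constant. *)
Lemma cov_curv_weighted (phi : R) (f : 'I_n -> 'I_n -> 'I_n * 'I_n) : 0 <= phi ->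
  \sum_i mu i ^+ 2 = phi ^+ 2 ->
  - (n%:R * K' * phi) <= \sum_a \sum_i mu i *
    ip (g (F x)) (covd_Rm_at g (F x) (X (f a i).1) (X a) (X i) (X (f a i).2)) (nu x).
Proof.
move=> phi0 mu2; rewrite lerNl; apply: le_trans (ler_norm _) _; rewrite normrN.
have b0 : 0 <= n%:R * K' * phi by rewrite !mulr_ge0// ltW.
rewrite -ler_sqr ?nnegrE// real_normK ?num_real//.
rewrite pair_bigA; apply: le_trans (cauchy_schwarz_sum _ _ _) _.
have := cov_curv_sum f; rewrite pair_bigA/= => hk.
rewrite -(pair_bigA _ (fun _ i => mu i ^+ 2))/= sumr_const card_ord mu2.
apply: le_trans (ler_wpM2l _ hk) _; first by rewrite mulrn_wge0// sqr_ge0.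
have -> : phi ^+ 2 *+ n = n%:R * phi ^+ 2 by rewrite mulr_natl.
rewrite (_ : (n%:R * K' * phi) ^+ 2 = n%:R * (n%:R * phi ^+ 2 * K' ^+ 2)); last by ring.
rewrite ler_peMl ?mulr_ge0 ?sqr_ge0 ?(ltW n_gt0)// ler1n.
exact: ltnW.
Qed.

Lemma simons_reaction (phi : R) : 0 <= phi -> \sum_i mu i ^+ 2 = phi ^+ 2 ->
  - phi ^+ 4 - n%:R * (n%:R - 2) * H / Num.sqrt (n%:R * (n%:R - 1)) * phi ^+ 3
  + n%:R * (H ^+ 2 + (K2 - K1) * H / 2 + 2 * K2 - K1) * phi ^+ 2
  - 2 * n%:R * K' * phi + n%:R ^+ 2 * H * (K2 - K1) / 2 <=
  \sum_a \sum_i lam i * N a i.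
Proof.
move=> phi0 mu2; have Wx := UW Ux.
have nn : ip (g (F x)) (nu x) (nu x) = 1 by exact: (hyp_unit hS).
have nX i : ip (g (F x)) (nu x) (X i) = 0.
  by rewrite (ipC _ _ (metric_sym hg Wx)) (hyp_normal hS).
apply: (simons_reaction_bound n2 (mu := mu) (r := nor_sec g F nu x e)
  (K := tan_sec g F x e)
  (D := fun a i => cov_curv g F nu x e a a i i + cov_curv g F nu x e i a i a)).
- exact: H_ge0.
- exact: phi0.
- by move=> i; rewrite /mu subrK.
- exact: principal_trace0.
- exact: mu2.
- move=> a i ai; have Xaa := Xon a a; have Xai := Xon a i; have Xii := Xon i i.
  rewrite eqxx in Xaa; rewrite eqxx in Xii; rewrite (negbTE ai) in Xai.
  have X0 : 0 < ip (g (F x)) (X i) (X i) by rewrite Xii.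
  by have /andP[+ _] := sec_orthogonal (hsec Wx) Xaa Xai X0; rewrite Xii mulr1.
- by move=> a i; exact: (tan_secC hS).
- move=> i; have := sec_orthogonal (hsec Wx) (u := nu x) (v := X i).
  by rewrite Xon eqxx nX nn !mulr1; apply.
- exact: covb2_trace0_frame.
- by move=> a i; exact: (simons_diag hS Ux eON hdiag).
- have b1 := cov_curv_weighted (fun a i => (a, i)) phi0 mu2.
  have b2 := cov_curv_weighted (fun a i => (i, a)) phi0 mu2.
  have -> : \sum_a \sum_i mu i * (cov_curv g F nu x e a a i i + cov_curv g F nu x e i a i a) =
    \sum_a \sum_i mu i * cov_curv g F nu x e a a i i
    + \sum_a \sum_i mu i * cov_curv g F nu x e i a i a.
    rewrite -big_split/=; apply: eq_bigr => a _; rewrite -big_split/=.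
    by apply: eq_bigr => i _; rewrite mulrDr.
  rewrite (_ : - (2 * n%:R * K' * phi) = - (n%:R * K' * phi) - (n%:R * K' * phi)).
    exact: lerD b1 b2.
  by ring.
Qed.

Lemma simons_kato (eps : R) : 0 < eps ->
  (1 + 2 / (n%:R * (1 + eps))) * \sum_a \sum_i T a i i ^+ 2
  - n%:R * (n%:R - 1) / (2 * eps) * (K1 - K2) ^+ 2 <=
  \sum_a \sum_i \sum_j T a i j ^+ 2.
Proof.
move=> eps0; have Wx := UW Ux.
apply: (kato n2 (c := fun a j => ncurv g F nu (e a) (e j) (e a) x)).
- exact: eps0.
- by move=> a i j; exact: (covb_sym hG _ _ _ hsym Ux).
- exact: covb_trace0_frame.
- move=> a j _; have := codazzi hS erefl erefl erefl (e a) (e j) (e a) Ux.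
  by rewrite -/G -/h -/(T a j a) -/(T j a a) => <-; rewrite addrC subrK.
- move=> a j aj; apply: (mixed_curvature_bound hg Wx (hsec Wx)).
  + by rewrite Xon eqxx.
  + by rewrite Xon eqxx.
  + exact: (hyp_unit hS).
  + by rewrite Xon (negbTE aj).
  + exact: (hyp_normal hS).
  + exact: (hyp_normal hS).
Qed.

End SimonsInequality.

(** * Gradient, Hessian and Laplacian of a function in a frame *)

Section ScalarOperators.
Variables (R : realType) (n : nat) (U V : set 'rV[R]_n) (G : 'rV[R]_n -> 'M[R]_n).
Hypothesis hG : metric_on U G.
Variable phi : 'rV[R]_n -> R.
Hypotheses (oV : open V) (sphi : smooth_on V phi).
Variables (x : 'rV[R]_n) (e : 'I_n -> 'rV[R]_n).
Hypotheses (Ux : U x) (Vx : V x) (eON : orthonormal_basis G x e).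

Lemma hessian_linl v : linear (fun u => hessian G phi x u v).
Proof.
apply: linear_pred_sub; first exact: (derive_dir_linear oV (smooth_derive oV v sphi) Vx).
exact: (linear_pred_comp (derive_dir_linear oV sphi Vx) (christoffel_linl hG v Ux)).
Qed.

Lemma hessian_linr u : linear (hessian G phi x u).
Proof.
apply: linear_pred_sub.
  apply: (derive_fam_linear oV (L := fun y v => 'D_v phi y)) => //.
    by move=> y Vy; exact: (derive_dir_linear oV sphi Vy).
  by move=> v; exact: smooth_derive.
exact: (linear_pred_comp (derive_dir_linear oV sphi Vx) (christoffel_linr hG u Ux)).
Qed.

Lemma laplacian_frame : laplacian G phi x = \sum_a hessian G phi x (e a) (e a).
Proof.
rewrite /laplacian mxtrace_mulC (tr_frame hG Ux eON); apply: eq_bigr => a _.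
move: (e a) => u; rewrite {1}(lin_rowE u (ip_linl _ u)) [RHS](lin_rowE u (hessian_linl u)).
apply: eq_bigr => i _; congr (_ *: _).
rewrite (lin_rowE u (ip_linr _ _)) [RHS](lin_rowE u (hessian_linr _)).
by apply: eq_bigr => j _; rewrite ip_ei mxE.
Qed.

Lemma ip_grad w : ip (G x) (grad G phi x) w = 'D_w phi x.
Proof.
rewrite /ip /grad mulmxKV; last exact: (posdef_unitmx (fun u => metric_pos hG Ux)).
rewrite (lin_rowE w (derive_dir_linear oV sphi Vx)) mxE; apply: eq_bigr => k _.
by rewrite !mxE mulrC.
Qed.

Lemma grad_norm_frame :
  ip (G x) (grad G phi x) (grad G phi x) = \sum_a ('D_(e a) phi x) ^+ 2.
Proof.
rewrite ip_grad {1}(frame_expand hG Ux eON (grad G phi x)).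
rewrite (linear_pred_sum (derive_dir_linear oV sphi Vx)); apply: eq_bigr => a _.
by rewrite (linear_predZ (derive_dir_linear oV sphi Vx)) ip_grad.
Qed.

Lemma derive_at_min v : (forall y, 0 <= phi y) -> phi x = 0 -> 'D_v phi x = 0.
Proof.
move=> phi0 px0; have /nbhs_ballP[r /= r0 rV] : nbhs x V by exact: open_nbhs_nbhs.
pose d := r / (`|v| + 1).
have v1 : 0 < `|v| + 1 by rewrite ltr_wpDl.
have d0 : 0 < d by rewrite divr_gt0.
have inV (t : R) : t \in `]-d, d[ -> V (x + t *: v).
  rewrite in_itv/= => /andP[t1 t2]; apply: rV.
  rewrite -ball_normE /ball_/= opprD addrA subrr sub0r normrN normrZ.
  have td : `|t| < d by rewrite ltr_norml t1 t2.
  apply: le_lt_trans (_ : `|t| * (`|v| + 1) < _); first by rewrite ler_wpM2l// lerDl.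
  by rewrite -ltr_pdivlMr.
have dL t : V (x + t *: v) ->
    is_derive t 1 (fun s : R => phi (x + s *: v)) ('D_v phi (x + t *: v)).
  by move=> Vt; apply: is_derive_line; exact: (smooth_derivable oV sphi Vt).
have x0 : x + (0 : R) *: v = x by rewrite scale0r addr0.
have d00 : (0 : R) \in `]-d, d[ by rewrite in_itv/= oppr_lt0 d0.
have m0 : is_derive (0 : R) (1 : R) (fun s : R => phi (x + s *: v)) (0 : R).
  apply: (derive1_at_min (a := - d) (b := d) _ _ d00) => [|t td|t td].
  - by rewrite ltW// (lt_trans _ d0)// oppr_lt0.
  - by have [] := dL t (inV t td).
  - by rewrite x0 px0.
have [_ E] := dL 0 (inV 0 d00); have [_ E0] := m0.
by move: E; rewrite E0 x0 => ->.
Qed.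

End ScalarOperators.

(** * Derivatives of the norm of the traceless part, and the final inequality *)

Section TracelessNorm.
Variables (R : realType) (n : nat).
Hypothesis n2 : (2 <= n)%N.
Variables (W : set 'rV[R]_n.+1) (g : 'rV[R]_n.+1 -> 'M[R]_n.+1).
Variables (U : set 'rV[R]_n) (F nu : 'rV[R]_n -> 'rV[R]_n.+1).
Hypothesis hS : hypersurface_on W g U F nu.
Variables (K1 K2 K' H : R).
Hypothesis hsec : forall z, W z -> forall u v, free [:: u; v] -> K2 <= sec g z u v <= K1.
Hypothesis hK' : forall z e, W z -> orthonormal_basis g z e -> covd_Rm_norm g z e <= K'.
Hypothesis hH : forall y, U y -> mean_curvature g F nu y = H.
Hypothesis H_ge0 : 0 <= H.
Let oU := hyp_open hS.
Let G := induced_metric g F.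
Let hG : metric_on U G := induced_metric_on hS.
Let h := sff g F nu.
Let sh : smooth_form U h := smooth_sff hS.
Let phi := traceless_norm g F nu.
Let hsym y u v : U y -> h y u v = h y v u := fun Uy => sff_sym hS u v Uy.

Lemma traceless_norm_ge0 y : 0 <= phi y.
Proof. exact: sqrtr_ge0. Qed.

Lemma principal_norm y (e : 'I_n -> 'rV[R]_n) : U y -> orthonormal_basis G y e ->
  (forall i j, i != j -> h y (e i) (e j) = 0) ->
  \sum_i (h y (e i) (e i) - H) ^+ 2 = pairing G h h y - n%:R * H ^+ 2.
Proof.
move=> Uy eON hd; have tr := principal_trace0 n2 hS hH Uy eON.
rewrite (pairing_frame hG Uy eON sh sh).
have -> : \sum_i \sum_j h y (e i) (e j) * h y (e j) (e i) = \sum_i h y (e i) (e i) ^+ 2.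
  apply: eq_bigr => i _; rewrite (bigD1 i)//= big1 ?addr0 ?expr2// => j ji.
  by rewrite (hd j i ji) mulr0.
have -> : n%:R * H ^+ 2 = \sum_(i < n) H ^+ 2 by rewrite sumr_const card_ord mulr_natl.
have z : \sum_i (2 * H) * (h y (e i) (e i) - H) = 0 by rewrite -mulr_sumr tr mulr0.
rewrite -sumrB -[RHS]subr0 -[X in _ = _ - X]z -sumrB; apply: eq_bigr => i _.
by ring.
Qed.

(** The right-hand side contains no root and is smooth on [U]. That the trace under the root is
    nonnegative is read off in a principal frame. *)
Lemma traceless_norm_sqr y : U y -> phi y ^+ 2 = pairing G h h y - n%:R * H ^+ 2.
Proof.
move=> Uy; have [e [eON hd]] := principal_frame hS Uy.
have ge0 : 0 <= pairing G h h y - n%:R * H ^+ 2.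
  by rewrite -(principal_norm Uy eON hd); apply: sumr_ge0 => i _; exact: sqr_ge0.
rewrite /phi /traceless_norm /HS_norm.
suff -> : \tr (traceless g F nu y *m (induced_metric g F y *m (traceless g F nu y)^T
    *m invmx (induced_metric g F y))) = pairing G h h y - n%:R * H ^+ 2.
  by rewrite sqr_sqrtr.
have tE := sff_trace n2 hH Uy; rewrite /form_trace in tE.
rewrite /traceless (hH Uy) /Defs.shape second_form_mx -/G -/h /pairing.
have hmT : (form_mx h y)^T = form_mx h y.
  by apply/matrixP => i j; rewrite mxE [LHS]mxE [RHS]mxE; exact: hsym.
have uGy := posdef_unitmx (fun u => metric_pos hG Uy).
have IT : (invmx (G y))^T = invmx (G y) by rewrite trmx_inv (metric_sym hG Uy).
have IG := mulVmx uGy; have GI := mulmxV uGy.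
have -> : (form_mx h y *m invmx (G y) - H%:M)^T = invmx (G y) *m form_mx h y - H%:M.
  by rewrite linearB/= tr_scalar_mx trmx_mul IT hmT.
move: tE IG GI; move: (form_mx h y) => b; move: (invmx (G y)) => I; move: (G y).
move=> G0 tE IG GI.
(* The traceless operator is self-adjoint, so its norm squared is the trace of its square. *)
have -> : (b *m I - H%:M) *m (G0 *m (I *m b - H%:M) *m I) =
    b *m I *m b *m I - (2 * H) *: (b *m I) + (H ^+ 2)%:M.
  have -> : G0 *m (I *m b - H%:M) *m I = b *m I - H%:M.
    by rewrite mulmxBr mulmxA GI mul1mx mul_mx_scalar mulmxBl -scalemxAl GI scalemx1.
  rewrite mulmxBl mulmxBr mul_mx_scalar mul_scalar_mx scalerBr scale_scalar_mx -expr2.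
  by rewrite !mulmxA opprB addrA addrAC mulr_natl mulr2n scalerDl opprD addrA addrAC.
have trN M : \tr (- M : 'M[R]_n) = - \tr M by exact: linearN.
rewrite !mxtraceD trN mxtraceZ mxtrace_scalar tE -mulr_natl; ring.
Qed.

Section Point.
Variables (V : set 'rV[R]_n) (x : 'rV[R]_n) (e : 'I_n -> 'rV[R]_n).
Hypotheses (oV : open V) (sphi : smooth_on V phi) (Ux : U x) (Vx : V x).
Hypothesis eON : orthonormal_basis G x e.
Hypothesis hdiag : forall i j, i != j -> h x (e i) (e j) = 0.
Let lam i := h x (e i) (e i).
Let T a i j := covb G h (e a) x (e i) (e j).
Let N a i := covb2 G h (e a) (e a) x (e i) (e i).

(** Obtained from phi^2, hence without dividing by phi. It holds at all points of [U] and [V], which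
    allows a second differentiation. *)
Lemma derive_traceless_norm y v : U y -> V y ->
  phi y * 'D_v phi y = pairing G (covb G h v) h y.
Proof.
move=> Uy Vy; have dphi := smooth_derivable oV (v := v) sphi Vy.
have E : 'D_v (fun z => phi z * phi z) y = 'D_v (pairing G h h) y.
  rewrite (derive_eq_on oU (g := fun z => pairing G h h z - n%:R * H ^+ 2) _ _ Uy).
    have dQ : derivable (pairing G h h) y v.
      rewrite /pairing; apply: (smooth_derivable oU _ Uy).
      have sI := smooth_invmx oU (fun z Uz => posdef_unitmx (fun u => metric_pos hG Uz))
        (metric_smooth hG).
      have sb := smooth_form_mx hG sh.
      by apply: (smooth_mxtrace oU); do 3!apply: (smooth_mulmx oU) => //.
    by rewrite (deriveB dQ (derivable_cst (n%:R * H ^+ 2) y v)) derive_cst subr0.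
  by move=> z Uz; rewrite -expr2 traceless_norm_sqr.
move: E; rewrite (deriveM dphi dphi) (derive_pairing hG v sh sh Uy).
rewrite (pairingC G h (covb G h v)) -!mulr2n => /eqP.
by rewrite eqrMn2r//= => /eqP.
Qed.

Lemma derive_traceless_norm_frame a : phi x * 'D_(e a) phi x = \sum_i T a i i * lam i.
Proof.
rewrite derive_traceless_norm// (pairing_frame hG Ux eON (smooth_covb hG _ sh) sh).
apply: eq_bigr => i _; rewrite (bigD1 i)//= big1 ?addr0// => j ji.
by rewrite (hdiag ji) mulr0.
Qed.

(** The identity for phi * D phi is differentiated along v = e_a, and its instance in the direction
    nabla_v v is subtracted: this completes the Hessian on the left and [covb2] on the right. *)
Lemma bochner_traceless_norm a :
  ('D_(e a) phi x) ^+ 2 + phi x * hessian G phi x (e a) (e a) =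
  \sum_i lam i * N a i + \sum_i \sum_j T a i j ^+ 2.
Proof.
have s1 b := smooth_covb hG b sh; have s2 b c := smooth_covb hG c (s1 b).
pose v := e a.
have dphi := smooth_derivable oV (v := v) sphi Vx.
have ddphi := smooth_derivable oV (v := v) (smooth_derive oV v sphi) Vx.
have E : 'D_v (fun z => phi z * 'D_v phi z) x = 'D_v (pairing G (covb G h v) h) x.
  have oUV : open (U `&` V) by exact: openI.
  by apply: (derive_eq_on oUV) => // y [Uy Vy]; exact: derive_traceless_norm.
move: E; rewrite (deriveM dphi ddphi) (derive_pairing hG v (s1 v) sh Ux) => E.
have EG := derive_traceless_norm (christoffel G x v v) Ux Vx.
have P (B B' : 'rV[R]_n -> 'rV[R]_n -> 'rV[R]_n -> R) : smooth_form U B -> smooth_form U B' ->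
  pairing G B B' x = \sum_i \sum_j B x (e i) (e j) * B' x (e j) (e i).
  by move=> sB sB'; exact: (pairing_frame hG Ux eON sB sB').
have hE : hessian G phi x v v = 'D_v ('D_v phi) x - 'D_(christoffel G x v v) phi x by [].
have {}E : phi x * 'D_v ('D_v phi) x + 'D_v phi x * 'D_v phi x =
  pairing G (covb G (covb G h v) v) h x + pairing G (covb G h v) (covb G h v) x by exact: E.
rewrite -/v hE; move: E EG.
move: ('D_v ('D_v phi) x) ('D_v phi x) ('D_(christoffel G x v v) phi x) (phi x).
move=> dd d dg p E EG.
have -> : d ^+ 2 + p * (dd - dg) = (p * dd + d * d) - p * dg by ring.
rewrite (etrans E (f_equal2 +%R (P _ _ (s2 v v) sh) (P _ _ (s1 v) (s1 v)))).
rewrite (etrans EG (P _ _ (s1 _) sh)).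
apply: (etrans (addrAC _ _ _)); apply: (f_equal2 +%R).
  rewrite -sumrB; apply: eq_bigr => i _; rewrite -sumrB (bigD1 i)//= big1 => [|j ji].
    by rewrite addr0 -mulrBl mulrC.
  by rewrite (hdiag ji) !mulr0 subrr.
apply: eq_bigr => i _; apply: eq_bigr => j _; rewrite expr2.
exact: (f_equal (fun r => T a i j * r) (covb_sym hG _ _ _ hsym Ux)).
Qed.

End Point.

Lemma simons_inequality (eps : R) x : 0 < eps -> U x -> smooth_near x phi ->
  2 / (n%:R * (1 + eps)) * ip (G x) (grad G phi x) (grad G phi x)
  - phi x ^+ 4
  - n%:R * (n%:R - 2) * H / Num.sqrt (n%:R * (n%:R - 1)) * phi x ^+ 3
  + n%:R * (H ^+ 2 + (K2 - K1) * H / 2 + 2 * K2 - K1) * phi x ^+ 2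
  - 2 * n%:R * K' * phi x
  + n%:R ^+ 2 * H * (K2 - K1) / 2
  - n%:R * (n%:R - 1) / (2 * eps) * (K1 - K2) ^+ 2
  <= phi x * laplacian G phi x.
Proof.
move=> eps0 Ux [V [oV Vx sphi]]; have [e [eON hd]] := principal_frame hS Ux.
rewrite (laplacian_frame hG oV sphi Ux Vx eON) (grad_norm_frame hG oV sphi Ux Vx eON).
have mu2 : \sum_i (h x (e i) (e i) - H) ^+ 2 = phi x ^+ 2.
  by rewrite traceless_norm_sqr// principal_norm.
have p0 := traceless_norm_ge0 x.
have A := simons_reaction n2 hS hsec hK' hH H_ge0 Ux eON hd p0 mu2.
have B := simons_kato n2 hS hsec hH Ux eON eps0.
have C := bochner_traceless_norm oV sphi Ux Vx eON hd.
have D := derive_traceless_norm_frame oV sphi Ux Vx eON hd.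
have {C} C : phi x * \sum_a hessian G phi x (e a) (e a) + \sum_a ('D_(e a) phi x) ^+ 2 =
    \sum_a \sum_i h x (e i) (e i) * covb2 G h (e a) (e a) x (e i) (e i)
    + \sum_a \sum_i \sum_j covb G h (e a) x (e i) (e j) ^+ 2.
  rewrite mulr_sumr -!big_split/=; apply: eq_bigr => a _.
  by rewrite addrC; exact: C.
have n0 : 0 < n%:R :> R by rewrite ltr0n (ltn_trans _ n2).
have n1 : 0 < n%:R - 1 :> R by rewrite subr_gt0 ltr1n.
(* The order of the bounds is read off from an actual plane, spanned by the normal and one tangent
   direction. *)
have K21 : K2 <= K1.
  have i0 : 'I_n by case: (n) n2 => // m _; exact: ord0.
  have Xi : ip (g (F x)) ('D_(e i0) F x) ('D_(e i0) F x) = 1.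
    by rewrite -(ip_induced hS _ _ Ux) eON eqxx.
  have fr : free [:: nu x; 'D_(e i0) F x].
    apply: (@orthogonal_free _ _ g (F x)); first exact: (hyp_unit hS).
      rewrite (ipC _ _ (metric_sym (hyp_metric hS) (hyp_maps hS Ux))).
      exact: (hyp_normal hS).
    by rewrite Xi.
  by have /andP[] := hsec (hyp_maps hS Ux) fr; exact: le_trans.
have c0 : 0 <= 2 / (n%:R * (1 + eps)).
  by rewrite divr_ge0// mulr_ge0 ?(ltW n0)// addr_ge0// ltW.
have k0 : 0 <= n%:R * (n%:R - 1) / (2 * eps) * (K1 - K2) ^+ 2.
  by rewrite mulr_ge0 ?sqr_ge0// divr_ge0 ?mulr_ge0 ?(ltW n0) ?(ltW n1) ?(ltW eps0).
(* If phi vanishes at x, so does its gradient. The right-hand side reduces to its two constant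
   terms, both nonpositive as K2 <= K1 and H >= 0. *)
have [px0|px0] := eqVneq (phi x) 0.
  have -> : \sum_a ('D_(e a) phi x) ^+ 2 = 0.
    apply: big1 => a _; rewrite (derive_at_min oV sphi Vx (e a) traceless_norm_ge0 px0).
    by rewrite expr0n.
  rewrite px0 !expr0n/= !mulr0 mul0r !subr0 !add0r.
  have hk : 0 <= n%:R ^+ 2 * H * (K1 - K2) by rewrite !mulr_ge0 ?sqr_ge0 ?subr_ge0.
  move: k0; move: (n%:R * (n%:R - 1) / _ * _) => k k0; lra.
(* As T is traceless, phi * D_a phi is the sum of T_aii mu_i; Cauchy-Schwarz bounds its square by
   phi^2 times the sum of T_aii^2, and phi^2 is cancelled. *)
have E : \sum_a ('D_(e a) phi x) ^+ 2 <= \sum_a \sum_i covb G h (e a) x (e i) (e i) ^+ 2.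
  apply: ler_sum => a _; have p2 : 0 < phi x ^+ 2.
    by rewrite lt_neqAle sqr_ge0 andbT eq_sym sqrf_eq0.
  rewrite -(ler_pM2l p2) -exprMn D.
  have -> : \sum_i covb G h (e a) x (e i) (e i) * h x (e i) (e i) =
      \sum_i covb G h (e a) x (e i) (e i) * (h x (e i) (e i) - H).
    have t0 := covb_trace0_frame n2 hS hH Ux eON a.
    apply: esym; rewrite (eq_bigr _ (fun i _ => mulrBr _ _ _)) sumrB -mulr_suml.
    by rewrite t0 mul0r subr0.
  by apply: le_trans (cauchy_schwarz_sum _ _ _) _; rewrite mu2 mulrC.
have E2 : (1 + 2 / (n%:R * (1 + eps))) * \sum_a ('D_(e a) phi x) ^+ 2 <=
    (1 + 2 / (n%:R * (1 + eps))) * \sum_a \sum_i covb G h (e a) x (e i) (e i) ^+ 2.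
  by rewrite ler_wpM2l// addr_ge0.
have {}C : phi x * \sum_a hessian G phi x (e a) (e a) =
    \sum_a \sum_i h x (e i) (e i) * covb2 G h (e a) (e a) x (e i) (e i)
    + \sum_a \sum_i \sum_j covb G h (e a) x (e i) (e j) ^+ 2
    - \sum_a ('D_(e a) phi x) ^+ 2 by rewrite -C addrK.
rewrite C.
have {}E2 := le_trans (lerB E2 (lexx _)) B.
have := lerB (lerD A E2) (lexx (\sum_a ('D_(e a) phi x) ^+ 2)).
move: (\sum_a \sum_i _) (\sum_a \sum_i _) => S1 S2; apply: le_trans.
rewrite le_eqVlt; apply/orP; left; apply/eqP.
move: (\sum_a _ ^+ 2) => S3.
move: (n%:R * (n%:R - 1) / (2 * eps) * _) => k.
move: (_ / Num.sqrt _) => o.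
move: (2 / (n%:R * _)) (phi x) => q p.
ring.
Qed.

End TracelessNorm.

(** * From a pair of charts to the immersed hypersurface *)

Lemma open_ldom (R : realType) (m m' : nat) (T T' : topologicalType) (f : T -> T')
    (c : chart R m T) (d : chart R m' T') :
  is_chart c -> open (dom d) -> continuous f -> open (ldom f c d).
Proof.
move=> [_ oi cK _ pc] od cf; rewrite openE => z [p [dp dfp] <-].
have Iz : img c (cmap c p) by exists p.
have ct : {for cmap c p, continuous (f \o param c)}.
  exact: (continuous_comp (pc _ (mem_set Iz)) (cf _)).
have near_d : nbhs (cmap c p) ((f \o param c) @^-1` dom d).
  by apply: ct; rewrite /= cK//; exact: open_nbhs_nbhs.
have near_c := open_nbhs_nbhs (conj oi Iz).
apply: filterS2 near_d near_c => y /= + [q dq qy]; rewrite -qy cK// => dfq.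
by exists q.
Qed.

Lemma chart_hypersurface_on (R : realType) (n : nat)
    (N : manifold R n.+1) (g : riemannian_metric N) (M : manifold R n) (f : M -> N)
    (nu : chart R n.+1 N -> M -> 'rV[R]_n.+1) c d :
  immersion f -> unit_normal g f nu -> atlas M c -> atlas N d ->
  hypersurface_on (img d) (g d) (ldom f c d) (lrep f c d) (fun y => nu d (param c y)).
Proof.
move=> [cf im] [_ nuP] Mc Nd; have [sF iF] := im c d Mc Nd; have [snu nuE] := nuP c d Mc Nd.
have [chM _ _] := atlasP M; have [chN _ _] := atlasP N.
have [od oi _ _ _] := chN d Nd; have chc := chM c Mc.
have oU := open_ldom chc od cf.
split.
- split => //.
  + exact/smooth_on_mx/gram_smooth.
  + by move=> x; exact: gram_sym.
  + by move=> x u; exact: gram_pos.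
- exact: oU.
- exact: smooth_on_mx.
- move=> _ [p [dp dfp] <-]; have [_ _ cK _ _] := chc.
  by exists (f p) => //; rewrite /lrep cK.
- exact: iF.
- exact: smooth_on_mx.
- by move=> x Ux; have [] := nuE x Ux.
- by move=> x u Ux; have [_] := nuE x Ux; apply.
Qed.

Theorem theorem3p1 (R : realType) (n : nat) (hn : (2 <= n)%N)
  (N : manifold R n.+1) (g : riemannian_metric N) (hN : orientable N)
  (K1 K2 K' : R) (hsec : sec_bounded g K2 K1) (hK' : covd_Rm_bounded g K')
  (M : manifold R n) (hM : orientable M)
  (f : M -> N) (hf : immersion f)
  (nu : chart R n.+1 N -> M -> 'rV[R]_n.+1) (hnu : unit_normal g f nu)
  (H : R) (hH0 : H != 0 -> 0 < H)
  (hH : forall c d x, atlas M c -> atlas N d -> ldom f c d x ->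
     mean_curvature (g d) (lrep f c d) (fun y => nu d (param c y)) x = H) :
  exists2 eps : R, 0 < eps &
    forall c d x, atlas M c -> atlas N d -> ldom f c d x ->
      let F := lrep f c d in
      let G := induced_metric (g d) F in
      let phi := traceless_norm (g d) F (fun y => nu d (param c y)) in
      smooth_near x phi ->
      phi x * laplacian G phi x >=
        2 / (n%:R * (1 + eps)) * ip (G x) (grad G phi x) (grad G phi x)
        - phi x ^+ 4
        - n%:R * (n%:R - 2) * H / Num.sqrt (n%:R * (n%:R - 1)) * phi x ^+ 3
        + n%:R * (H ^+ 2 + (K2 - K1) * H / 2 + 2 * K2 - K1) * phi x ^+ 2
        - 2 * n%:R * K' * phi x
        + n%:R ^+ 2 * H * (K2 - K1) / 2
        - n%:R * (n%:R - 1) / (2 * eps) * (K1 - K2) ^+ 2.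
Proof.
exists 1 => // c d x Mc Nd Ux /=.
apply: (simons_inequality hn (chart_hypersurface_on hf hnu Mc Nd)) => //.
- by move=> z Wz u v; exact: hsec.
- by move=> z e Wz; exact: hK'.
- by move=> y; exact: hH.
(* The choice of orientation enters only as H >= 0, the sign with which Okumura's inequality and the
   bound on the normal curvatures are multiplied by H. *)
- by have [->|/hH0/ltW] := eqVneq H 0.
Qed.
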